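(* Let $(\Sigma^n,g,h,u,\mu,\lambda)$ be a gradient Einstein-type structure isometrically immersed by $\phi$ into $I\times_f M^n$, with potential function $h=\pi_I\circ\phi$, where the fiber $M^n$ has sectional curvature $k_M\le\inf_I(f'^2-ff'')$. If $$\lambda\ge\frac{f'(h)}{f(h)}-(n-1)\frac{f''(h)}{f(h)}+\left|\mu+\frac{f'(h)}{f(h)}\right|+H(nH+\theta),$$ then $u$ is a constant map.
   Context: A gradient Einstein-type structure $(\Sigma^n,g,h,u,\mu,\lambda)$ consists of a connected, complete (possibly compact) Riemannian manifold $(\Sigma^n,g)$, a real number $\alpha>0$, a smooth map $u:(\Sigma^n,g)\to(N^p,g')$ into a Riemannian manifold, with tension field $\tau_g u=\mathrm{trace}\,\nabla(du)$, and smooth functions $h,\mu,\lambda$ on $\Sigma$ such that $Ric_g-\alpha u^*g'+\mathrm{Hess}\,h-\mu\,dh\otimes dh=\lambda g$ and $\tau_g u=du(\nabla h)$. $I\times_f M^n$ is $I\times M^n$ with metric $\langle\,,\rangle=\pi_I^*(dt^2)+f^2(\pi_I)\pi_M^*(g_M)$, where $I\subset\mathbb{R}$ is an open interval, $f:I\to(0,\infty)$ is smooth, and $M^n$ is a connected oriented Riemannian manifold. For an oriented hypersurface $\Sigma^n$ with unit normal $\nu$, the shape operator is $AX=-\overline\nabla_X\nu$, the mean curvature $H$ is given by $nH=\mathrm{tr}\,A$, and the angle function is $\theta=\langle\nu,\partial_t\rangle$. *)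

(* Defs.v *)
(* Differential geometry in local coordinates.
   Vectors are rows: a matrix of components acts on the right, and the
   differential of a map has the index of the source coordinate as row index.
   A tensor (field) is the family of its component functions in all charts,
   each of them being meaningful on the domain of the chart only. *)
From HB Require Import structures.
From mathcomp Require Export all_boot all_order all_algebra.
From mathcomp Require Export all_classical all_reals all_analysis.
Export Order.TTheory GRing.Theory Num.Theory.
Export numFieldNormedType.Exports.

Set Implicit Arguments.
Unset Strict Implicit.
Unset Printing Implicit Defensive.

Local Open Scope ring_scope.
Local Open Scope classical_set_scope.

(** * Manifolds *)

(* The data of an atlas, with a preferred chart at each point; the axioms are
   in [smooth_manifold]. *)
Record charted_space (R : realType) (n : nat) := ChartedSpace {
  carrier :> topologicalType;
  chart : Type;
  dom : chart -> set carrier;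
  coord : chart -> carrier -> 'rV[R]_n;
  chart_at : carrier -> chart }.

(* F read in the chart c, that is, F composed with the inverse of coord c. *)
Definition in_chart (R : realType) n (X : charted_space R n) (c : chart X)
    (F : X -> R) (x : 'rV[R]_n) : R :=
  get [set F q | q in dom c `&` coord c @^-1` [set x]].

(* The derivative of F along the i-th coordinate vector field of c. *)
Definition pd (R : realType) n (X : charted_space R n) (c : chart X)
    (i : 'I_n) (F : X -> R) (q : X) : R :=
  'D_(delta_mx 0 i) (in_chart c F) (coord c q).

(* F is of class C^k in the coordinates c, on an open subset O of dom c. *)
Fixpoint Ck (R : realType) n (X : charted_space R n) (c : chart X) (k : nat)
    (O : set X) (F : X -> R) : Prop :=
  (forall q, O q -> {for q, continuous F}) /\
  if k is k'.+1 then
    forall i : 'I_n,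
      (forall q, O q ->
         derivable (in_chart c F) (coord c q) (delta_mx 0 i)) /\
      Ck c k' O (pd c i F)
  else True.

Definition smooth_on (R : realType) n (X : charted_space R n)
    (O : set X) (F : X -> R) : Prop :=
  forall (c : chart X) (k : nat), Ck c k (dom c `&` O) F.

Definition smooth (R : realType) n (X : charted_space R n) (F : X -> R) :=
  smooth_on [set: X] F.

Record smooth_manifold (R : realType) n (X : charted_space R n) : Prop := {
  manifold_hausdorff : hausdorff_space X;
  manifold_second_countable : @second_countable X;
  chart_at_dom : forall q : X, dom (chart_at q) q;
  dom_open : forall c : chart X, open (dom c);
  coord_inj : forall c : chart X, {in dom c &, injective (coord c)};
  coord_cont : forall (c : chart X) q, dom c q -> {for q, continuous (coord c)};
  coord_open : forall (c : chart X) (O : set X),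
    open O -> O `<=` dom c -> open (coord c @` O);
  transition_smooth : forall (c : chart X) (i : 'I_n),
    smooth_on (dom c) (fun q => coord c q 0 i) }.

Definition connected_space (T : topologicalType) :=
  [set: T] !=set0 /\ connected [set: T].

(* The Jacobian of the change of coordinates from c to c'. *)
Definition jacobian_mx (R : realType) n (X : charted_space R n)
    (c c' : chart X) (q : X) : 'M[R]_n :=
  \matrix_(i, j) pd c i (fun r => coord c' r 0 j) q.

(* An orientation is a locally constant choice, for each chart c, of whether
   the coordinate frame of c is positively (1) or negatively (-1) oriented. *)
Definition orientation (R : realType) n (X : charted_space R n)
    (o : chart X -> X -> R) : Prop :=
  forall (c : chart X) q, dom c q ->
    [/\ o c q = 1 \/ o c q = -1, {for q, continuous (o c)} &
        forall c' : chart X, dom c' q ->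
          o c q = Num.sg (\det (jacobian_mx c c' q)) * o c' q].

(** * Smooth maps *)

Definition smooth_map (R : realType) n m (X : charted_space R n)
    (Y : charted_space R m) (u : X -> Y) : Prop :=
  continuous u /\
  forall (c' : chart Y) (a : 'I_m),
    smooth_on (u @^-1` dom c') (fun q => coord c' (u q) 0 a).

Definition dmap (R : realType) n m (X : charted_space R n)
    (Y : charted_space R m) (u : X -> Y) (c : chart X) (c' : chart Y) (q : X) :
    'M[R]_(n, m) :=
  \matrix_(i, a) pd c i (fun r => coord c' (u r) 0 a) q.

Definition dfun (R : realType) n (X : charted_space R n) (F : X -> R)
    (c : chart X) (q : X) : 'rV[R]_n :=
  \row_i pd c i F q.

(** * Riemannian metrics *)

Definition tensor2 (R : realType) n (X : charted_space R n) :=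
  chart X -> X -> 'M[R]_n.

Definition inner (R : realType) n (G : 'M[R]_n) (v w : 'rV[R]_n) : R :=
  (v *m G *m w^T) 0 0.

Record riemannian_metric (R : realType) n (X : charted_space R n)
    (g : tensor2 X) : Prop := {
  metric_sym : forall c q, dom c q -> (g c q)^T = g c q;
  metric_pos : forall c q, dom c q ->
    forall v : 'rV[R]_n, v != 0 -> 0 < inner (g c q) v v;
  metric_smooth : forall c i j, smooth_on (dom c) (fun q => g c q i j);
  metric_tensor : forall c c' q, dom c q -> dom c' q ->
    g c q = jacobian_mx c c' q *m g c' q *m (jacobian_mx c c' q)^T }.

Definition pullback (R : realType) n m (X : charted_space R n)
    (Y : charted_space R m) (u : X -> Y) (g' : tensor2 Y)
    (c : chart X) (c' : chart Y) (q : X) : 'M[R]_n :=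
  dmap u c c' q *m g' c' (u q) *m (dmap u c c' q)^T.

(** * Levi-Civita connection and curvature *)

(* nabla_(d_i) d_j = \sum_k christoffel g c i j k * d_k *)
Definition christoffel (R : realType) n (X : charted_space R n)
    (g : tensor2 X) (c : chart X) (i j k : 'I_n) (q : X) : R :=
  2^-1 * \sum_(l < n) invmx (g c q) k l *
    (pd c i (fun r => g c r j l) q + pd c j (fun r => g c r i l) q
     - pd c l (fun r => g c r i j) q).

(* With R(V, W)Z = nabla_V nabla_W Z - nabla_W nabla_V Z - nabla_[V, W] Z,
   R(d_i, d_j) d_k = \sum_l riemann g c i j k l * d_l *)
Definition riemann (R : realType) n (X : charted_space R n)
    (g : tensor2 X) (c : chart X) (i j k l : 'I_n) (q : X) : R :=
  pd c i (christoffel g c j k l) q - pd c j (christoffel g c i k l) q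
  + \sum_(m < n) (christoffel g c j k m q * christoffel g c i m l q
                  - christoffel g c i k m q * christoffel g c j m l q).

Definition curvature (R : realType) n (X : charted_space R n)
    (g : tensor2 X) (c : chart X) (q : X) (v w z : 'rV[R]_n) : 'rV[R]_n :=
  \row_l \sum_(i < n) \sum_(j < n) \sum_(k < n)
    v 0 i * w 0 j * z 0 k * riemann g c i j k l q.

(* Ric(W, Z) is the trace of V |-> R(V, W)Z. *)
Definition ricci (R : realType) n (X : charted_space R n)
    (g : tensor2 X) (c : chart X) (q : X) : 'M[R]_n :=
  \matrix_(j, k) \sum_(i < n) riemann g c i j k i q.

Definition sectional (R : realType) n (X : charted_space R n)
    (g : tensor2 X) (c : chart X) (q : X) (v w : 'rV[R]_n) : R :=
  inner (g c q) (curvature g c q v w w) v /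
  (inner (g c q) v v * inner (g c q) w w - inner (g c q) v w ^+ 2).

(* All sectional curvatures are at most K. *)
Definition sectional_le (R : realType) n (X : charted_space R n)
    (g : tensor2 X) (K : \bar R) : Prop :=
  forall (c : chart X) (q : X) (v w : 'rV[R]_n),
    dom c q -> row_free (col_mx v w) -> ((sectional g c q v w)%:E <= K)%E.

Definition hessian (R : realType) n (X : charted_space R n)
    (g : tensor2 X) (F : X -> R) (c : chart X) (q : X) : 'M[R]_n :=
  \matrix_(i, j) (pd c i (pd c j F) q
                  - \sum_(k < n) christoffel g c i j k q * pd c k F q).

Definition gradient (R : realType) n (X : charted_space R n)
    (g : tensor2 X) (F : X -> R) (c : chart X) (q : X) : 'rV[R]_n :=
  dfun F c q *m invmx (g c q).

(** * Completeness *)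

Definition geodesic (R : realType) n (X : charted_space R n)
    (g : tensor2 X) (gamma : R -> X) : Prop :=
  continuous gamma /\
  forall (t : R) (c : chart X), dom c (gamma t) ->
    let x (i : 'I_n) (s : R) := coord c (gamma s) 0 i in
    (forall (i : 'I_n) (k : nat), derivable (derive1n k (x i)) t 1) /\
    forall k : 'I_n,
      derive1n 2 (x k) t + \sum_(i < n) \sum_(j < n)
        christoffel g c i j k (gamma t) * derive1 (x i) t * derive1 (x j) t = 0.

(* Through every point and in every direction there is a geodesic defined on
   the whole real line. *)
Definition complete_metric (R : realType) n (X : charted_space R n)
    (g : tensor2 X) : Prop :=
  forall (c : chart X) (q : X) (v : 'rV[R]_n), dom c q ->
    exists gamma : R -> X,
      [/\ geodesic g gamma, gamma 0 = q &
          forall i, derive1 (fun s => coord c (gamma s) 0 i) 0 = v 0 i].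

(** * Tension field and gradient Einstein-type structures *)

(* The component a of (nabla du)(d_i, d_j). *)
Definition second_fundamental_form (R : realType) n m (X : charted_space R n)
    (Y : charted_space R m) (g : tensor2 X) (g' : tensor2 Y) (u : X -> Y)
    (c : chart X) (c' : chart Y) (q : X) (a : 'I_m) (i j : 'I_n) : R :=
  pd c i (pd c j (fun r => coord c' (u r) 0 a)) q
  - \sum_(k < n) christoffel g c i j k q * dmap u c c' q k a
  + \sum_(b < m) \sum_(d < m)
      christoffel g' c' b d a (u q) * dmap u c c' q i b * dmap u c c' q j d.

Definition tension (R : realType) n m (X : charted_space R n)
    (Y : charted_space R m) (g : tensor2 X) (g' : tensor2 Y) (u : X -> Y)
    (c : chart X) (c' : chart Y) (q : X) : 'rV[R]_m :=
  \row_a \sum_(i < n) \sum_(j < n)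
    invmx (g c q) i j * second_fundamental_form g g' u c c' q a i j.

Record gradient_Einstein_type (R : realType) n p (X : charted_space R n)
    (g : tensor2 X) (Y : charted_space R p) (g' : tensor2 Y) (alpha : R)
    (h : X -> R) (u : X -> Y) (mu lambda : X -> R) : Prop := {
  gE_manifold : smooth_manifold X;
  gE_connected : connected_space X;
  gE_metric : riemannian_metric g;
  gE_complete : complete_metric g;
  gE_target_manifold : smooth_manifold Y;
  gE_target_metric : riemannian_metric g';
  gE_alpha : 0 < alpha;
  gE_u_smooth : smooth_map u;
  gE_h_smooth : smooth h;
  gE_mu_smooth : smooth mu;
  gE_lambda_smooth : smooth lambda;
  gE_ricci : forall (c : chart X) (c' : chart Y) (q : X),
    dom c q -> dom c' (u q) ->
    ricci g c q - alpha *: pullback u g' c c' q + hessian g h c q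
      - mu q *: ((dfun h c q)^T *m dfun h c q) = lambda q *: g c q;
  gE_tension : forall (c : chart X) (c' : chart Y) (q : X),
    dom c q -> dom c' (u q) ->
    tension g g' u c c' q = gradient g h c q *m dmap u c c' q }.

(** * Isometric immersions and oriented hypersurfaces *)

Record isometric_immersion (R : realType) n m (X : charted_space R n)
    (P : charted_space R m) (g : tensor2 X) (gP : tensor2 P) (phi : X -> P) :
    Prop := {
  immersion_smooth : smooth_map phi;
  immersion_inj : forall (c : chart X) (c' : chart P) (q : X),
    dom c q -> dom c' (phi q) -> row_free (dmap phi c c' q);
  immersion_isometric : forall (c : chart X) (c' : chart P) (q : X),
    dom c q -> dom c' (phi q) -> pullback phi gP c c' q = g c q }.

(* The components, in the charts of P, of a section of phi^*TP. *)
Definition field_along (R : realType) n m (X : charted_space R n)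
    (P : charted_space R m) (phi : X -> P) := chart P -> X -> 'rV[R]_m.

Record unit_normal (R : realType) n m (X : charted_space R n)
    (P : charted_space R m) (gP : tensor2 P) (phi : X -> P)
    (nu : field_along phi) : Prop := {
  normal_tensor : forall (c c' : chart P) (q : X),
    dom c (phi q) -> dom c' (phi q) ->
    nu c' q = nu c q *m jacobian_mx c c' (phi q);
  normal_smooth : forall (c : chart P) (a : 'I_m),
    smooth_on (phi @^-1` dom c) (fun q => nu c q 0 a);
  normal_unit : forall (c : chart P) (q : X), dom c (phi q) ->
    inner (gP c (phi q)) (nu c q) (nu c q) = 1;
  normal_orth : forall (c : chart X) (c' : chart P) (q : X),
    dom c q -> dom c' (phi q) ->
    forall v : 'rV[R]_n,
      inner (gP c' (phi q)) (v *m dmap phi c c' q) (nu c' q) = 0 }.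

(* The row i is the ambient covariant derivative of nu along d_i. *)
Definition covariant_along (R : realType) n m (X : charted_space R n)
    (P : charted_space R m) (gP : tensor2 P) (phi : X -> P)
    (nu : field_along phi) (c : chart X) (c' : chart P) (q : X) :
    'M[R]_(n, m) :=
  \matrix_(i, k) (pd c i (fun r => nu c' r 0 k) q
    + \sum_(a < m) \sum_(b < m)
        christoffel gP c' a b k (phi q) * dmap phi c c' q i a * nu c' q 0 b).

(* dphi(AV) = - nabla_V nu for all V; A is unique since dphi is injective. *)
Definition shape_operator (R : realType) n m (X : charted_space R n)
    (P : charted_space R m) (gP : tensor2 P) (phi : X -> P)
    (nu : field_along phi) (A : tensor2 X) : Prop :=
  forall (c : chart X) (c' : chart P) (q : X), dom c q -> dom c' (phi q) ->
    A c q *m dmap phi c c' q = - covariant_along gP nu c c' q.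

Definition mean_curvature (R : realType) n (X : charted_space R n)
    (A : tensor2 X) (q : X) : R :=
  \tr (A (chart_at q) q) / n%:R.

(** * Warped products *)

Definition smooth_fun_on (R : realType) (I : set R) (f : R -> R) : Prop :=
  forall (k : nat) (t : R), I t -> derivable (derive1n k f) t 1.

(* I is used as a type, with the topology induced by that of R; the coordinate
   on the factor I is the inclusion into R. *)
Definition interval_prod (R : realType) n (I : set R) (M : charted_space R n) :
    charted_space R (1 + n) :=
  @ChartedSpace R (1 + n) (I * M)%type (chart M)
    (fun c => [set z | dom c z.2])
    (fun c z => row_mx (const_mx (set_val z.1)) (coord c z.2))
    (fun z => chart_at z.2).

Definition piI (R : realType) n (I : set R) (M : charted_space R n)
    (z : interval_prod I M) : R := set_val z.1.

Definition warped_metric (R : realType) n (I : set R) (f : R -> R)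
    (M : charted_space R n) (gM : tensor2 M) : tensor2 (interval_prod I M) :=
  fun c z => block_mx 1%:M 0 0 (f (piI z) ^+ 2 *: gM c z.2).

(* The components of d/dt, the same in all charts of [interval_prod I M]. *)
Definition partial_t (R : realType) n : 'rV[R]_(1 + n) :=
  row_mx (const_mx 1) 0.

Definition angle (R : realType) n n' (I : set R) (f : R -> R)
    (X : charted_space R n) (M : charted_space R n') (gM : tensor2 M)
    (phi : X -> interval_prod I M) (nu : field_along phi) (q : X) : R :=
  let c := chart_at (phi q) in
  inner (warped_metric f gM c (phi q)) (nu c q) (partial_t R n').

(* Main.v *)
(* By the Gauss equation and k_M <= f'^2 - f f'', the scalar curvature S of g
   satisfies S <= - n (n - 1) f''/f + n^2 H^2 - |A|^2. Moreover
   Hess h = (f'/f) (g - dh (x) dh) + theta <A . , . >. Hence the trace of the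
   Einstein-type equation gives
     alpha |du|^2 <= n (f'/f - (n - 1) f''/f + H (n H + theta) - lambda)
                     - (mu + f'/f) |dh|^2 - |A|^2 <= 0,
   because |dh|^2 <= n. So du = 0, and u is constant by connectedness.

   In coordinates, the Gauss equation is obtained by differentiating the
   Christoffel symbols of the first kind of g, which are <nabla_j phi_k, phi_m>
   for the pulled-back connection, and by expanding <nabla_j phi_k, nabla_i phi_m>
   in the frame formed by the phi_l and the normal. *)
From HB Require Import structures.
Require Import Defs.
From mathcomp Require Import ring lra.

Set Implicit Arguments.
Unset Strict Implicit.
Unset Printing Implicit Defensive.
Local Open Scope ring_scope.
Local Open Scope classical_set_scope.

(** * Calculus in R^n *)

(** Two obstacles shape the proof. Smoothness is given by iterated partial derivatives in charts, so
    the differentiability of C^1 functions, the symmetry of second derivatives and the chain rule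
    have to be recovered from the mean value theorem. And no manifold structure is established on I
    x M: a map into it is a pair ([height], [fib]) of a real function and a map into M, ambient
    quantities are written out in these two components, and the only connection pulled back by
    general lemmas is that of M. The Gauss equation then becomes a polynomial identity in the
    derivatives of the components.

    The bound f'^2 - f f'' on k_M is tuned to the warped product: the f'^2 terms of the ambient
    curvature cancel against it, and what remains is -f''/f times the Gram determinant of two frame
    vectors, whatever their position relative to d/dt. Orthonormal vectors may have linearly
    dependent projections to M, so the bound on k_M is used in a form free of division. *)

Lemma derive_germ (R : numFieldType) (V W T : normedModType R)
    (f : V -> T) (g : W -> T) (a v : V) (b w : W) :
  f a = g b -> (\forall t \near (0 : R), f (t *: v + a) = g (t *: w + b)) ->
  'D_v f a = 'D_w g b /\ (derivable f a v -> derivable g b w).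
Proof.
move=> fg0 fg.
(* A directional derivative only sees difference quotients along one line, so f and g may live on
   different spaces, such as a product chart and one of its factors. *)
have E : \forall t \near (0:R)^', t^-1 *: (f (t *: v + a) - f a) =
     t^-1 *: (g (t *: w + b) - g b).
  apply: cvg_within.
  by near=> t; rewrite fg0; congr (_ *: (_ - _)); near: t.
split.
  rewrite /derive; congr (lim _).
  rewrite eqEsubset; split; apply/near_eq_cvg => //.
  by near do apply/esym.
by move=> /cvg_ex[/= l fl]; apply/cvg_ex; exists l => /=; apply/(cvg_trans _
  fl)/near_eq_cvg.
Unshelve. all: by end_near. Qed.

Lemma is_derive_line (R : numFieldType) (V W : normedModType R)
    (f : V -> W) (x d : V) (t : R) :
  derivable f (x + t *: d) d ->
  is_derive t 1 (fun s : R => f (x + s *: d)) ('D_d f (x + t *: d)).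
Proof.
move=> df.
have E : \forall s \near (0 : R), f (s *: d + (x + t *: d)) =
    (fun s : R => f (x + s *: d)) (s *: 1 + t).
  by near=> s => /=; congr f; rewrite scalerDl addrCA [_%:A]mulr1.
have [-> dv] := @derive_germ _ _ _ _ f (fun s : R => f (x + s *: d))
  (x + t *: d) d t 1 (erefl _) E.
exact/derivableP/dv.
Unshelve. all: by end_near. Qed.

Lemma MVT_line (R : realType) (V : normedModType R) (f : V -> R) (x d : V) (s : R) :
  (forall t : R, `|t| <= `|s| -> derivable f (x + t *: d) d) ->
  exists2 t, `|t| <= `|s| & f (x + s *: d) - f x = s * 'D_d f (x + t *: d).
Proof.
move=> df.
have D (t : R) : `|t| <= `|s| -> is_derive t 1 (fun u : R => f (x + u *: d)) ('D_d f (x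
  + t *: d)).
  by move=> ts; apply: is_derive_line; apply: df.
have C (a b : R) : (forall t : R, t \in `[a, b]%R -> `|t| <= `|s|) ->
    {within `[a, b], continuous (fun u : R => f (x + u *: d))}.
  move=> ab; apply: derivable_within_continuous => t tab.
  by have [] := D t (ab t tab).
case: (lerP 0 s) => s0.
  have I (t : R) : t \in `[0, s]%R -> `|t| <= `|s|.
    by rewrite in_itv/= => /andP[t0 ts]; rewrite !ger0_norm.
  have [] := @MVT_segment _ (fun u : R => f (x + u *: d)) (fun t => 'D_d f (x + t *:
    d)) 0 s s0.
  - by move=> t; rewrite in_itv/= => /andP[t0 ts]; apply/D/I; rewrite in_itv/= !ltW.
  - exact: C.
  - by move=> t /I ts; rewrite scale0r addr0 subr0 => ->; exists t => //; rewrite mulrC.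
have I (t : R) : t \in `[s, 0]%R -> `|t| <= `|s|.
  rewrite in_itv/= => /andP[t0 ts]; rewrite !ler0_norm ?lerN2//; exact: ltW.
have [] := @MVT_segment _ (fun u : R => f (x + u *: d)) (fun t => 'D_d f (x + t *: d))
  s 0 (ltW s0).
- by move=> t; rewrite in_itv/= => /andP[t0 ts]; apply/D/I; rewrite in_itv/= !ltW.
- exact: C.
- move=> t /I ts; rewrite scale0r addr0 sub0r => E; exists t => //.
  by rewrite -opprB E mulrN opprK mulrC.
Qed.

Lemma mx_norm_le (R : realType) m n (x : 'M[R]_(m, n)) (e : R) :
  0 <= e -> (forall i j, `|x i j| <= e) -> `|x| <= e.
Proof.
move=> e0 xe; rewrite [leLHS]/Num.Def.normr /= mx_normrE.
by apply/bigmax_leP; split => // -[i j] _; apply: xe.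
Qed.

Lemma le_mx_norm (R : realType) m n (x : 'M[R]_(m, n)) i j : `|x i j| <= `|x|.
Proof.
rewrite [leRHS]/Num.Def.normr /= mx_normrE.
by apply/bigmax_geP; right => /=; exists (i, j).
Qed.

(** The candidate differential is 0. The increment of f is cut into n steps parallel to the axes,
    and the mean value theorem bounds each of them by a small partial derivative times the norm of
    h. *)
Lemma C1_critical_differentiable (R : realType) n (f : 'rV[R]_n -> R) (x : 'rV[R]_n) :
  (forall i, \forall y \near x, derivable f y (delta_mx 0 i)) ->
  (forall i, {for x, continuous ('D_(delta_mx 0 i) f)}) ->
  (forall i, 'D_(delta_mx 0 i) f x = 0) -> differentiable f x.
Proof.
move=> df cf f0.
have O : f \o shift x = cst (f x) + (\0 : {linear 'rV[R]_n -> R}) +o_ (0 : 'rV[R]_n) id.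
  apply/eqaddoP => e e0 /=.
  (* The successor keeps the denominator positive when n = 0. *)
  pose e' := e / n.+1%:R.
  have e'0 : 0 < e' by rewrite divr_gt0.
  have : \forall y \near x, forall i,
      derivable f y (delta_mx 0 i) /\ `|'D_(delta_mx 0 i) f y| <= e'.
    apply: (@filter_forall _ 'I_n (fun i => [set y | derivable f y (delta_mx 0 i) /\
      `|'D_(delta_mx 0 i) f y| <= e']) (nbhs x) (nbhs_filter x)) => i.
    apply: (@filterI _ (nbhs x) (nbhs_filter x) _ _ (df i)).
    have ci : 'D_(delta_mx 0 i) f y @[y --> x] --> (0 : R).
      by rewrite -(f0 i); exact: cf.
    exact: (cvgr0_norm_le _ ci).
  case/nbhs_ballP => d /= d0 Bd.
  near=> h => /=.
  have dheight : `|h| < d by near: h; apply/nbhs_ballP; exists d => //= y; rewrite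
    -ball_normE /= sub0r normrN.
  have B y : `|y| <= `|h| -> forall i,
      derivable f (x + y) (delta_mx 0 i) /\ `|'D_(delta_mx 0 i) f (x + y)| <= e'.
    move=> yh; apply: Bd; rewrite -ball_normE /= opprD addrA subrr sub0r normrN.
    exact: le_lt_trans dheight.
  (* The corners of the path from x to x + h; for the maximum norm the whole path stays within
     distance |h| of x. *)
  pose P (k : nat) : 'rV[R]_n := \row_j (if (j < k)%N then h 0 j else 0).
  have key k : (k <= n)%N -> `|f (x + P k) - f x| <= k%:R * (e' * `|h|).
    elim: k => [_|k IHk kn].
      have -> : P 0%N = 0 by apply/rowP => j; rewrite !mxE.
      by rewrite addr0 subrr normr0 mul0r.
    pose i := Ordinal kn.
    have PS : P k.+1 = P k + h 0 i *: delta_mx 0 i.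
      apply/rowP => j; rewrite !mxE eqxx/= ltnS leq_eqVlt -val_eqE /=.
      case: eqP => [jk|jk]; rewrite ?orbT/= ?mulr0 ?addr0//.
      rewrite jk ltnn add0r mulr1; congr (h _ _); exact: val_inj.
    have Ph (t : R) : `|t| <= `|h 0 i| -> `|P k + t *: delta_mx 0 i| <= `|h|.
      move=> th; apply: mx_norm_le => // a j; rewrite ord1 !mxE eqxx/= -val_eqE/=.
      case: eqP => [jk|jk]; rewrite ?mulr0 ?addr0//.
        rewrite jk ltnn add0r mulr1; apply: le_trans th _; exact: le_mx_norm.
      by case: ifP => _; rewrite ?normr0//; exact: le_mx_norm.
    have [t th E] := @MVT_line _ _ f (x + P k) (delta_mx 0 i) (h 0 i)
      (fun (t : R) th => ltac:(rewrite -addrA; exact: (B _ (Ph t th) i).1)).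
    rewrite PS addrA -(subrK (f (x + P k)) (f (_ + _ + _))) -addrA mulrS mulrDl mul1r.
    apply: le_trans (ler_normD _ _) _; apply: lerD; last exact/IHk/ltnW.
    rewrite E normrM mulrC -addrA; apply: ler_pM => //; last exact: le_mx_norm.
    by have [] := B _ (Ph t th) i.
  have -> : (f \o shift x - (cst (f x) + \0)) h = f (x + P n) - f x.
    rewrite !fctE /= addr0; congr (f _ - _); rewrite addrC; congr (_ + _).
    by apply/rowP => j; rewrite !mxE ltn_ord.
  apply: le_trans (key n (leqnn n)) _.
  rewrite mulrA ler_wpM2r// /e' mulrCA ler_piMr ?(ltW e0)//.
  by rewrite ler_pdivrMr// mul1r ler_nat.
apply/diff_locallyP.
have dE := @diff_unique _ _ _ f (\0 : {linear _ -> _}) x (fun=> cvg_cst _) O.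
rewrite dE; split => //; exact: cst_continuous.
Unshelve. all: by end_near. Qed.

Lemma linear_form_derive (R : realType) n (a : 'I_n -> R) :
  exists L : 'rV[R]_n -> R, (forall y, differentiable L y) /\
    forall y i, is_derive y (delta_mx 0 i : 'rV[R]_n) L (a i).
Proof.
pose l := fun y : 'rV[R]_n => (y *m (\col_i a i)) 0 0.
have ll : linear l.
  by move=> b y z; rewrite /l mulmxDl -scalemxAl !mxE.
pose lM := GRing.isLinear.Build _ _ _ _ l ll.
pose L : {linear 'rV[R]_n -> R} := HB.pack l lM.
have DL y : differentiable L y.
  have -> : (L : _ -> _) = \sum_(j < n) (fun y : 'rV[R]_n => y 0 j * a j).
    by apply/funext => z; rewrite fct_sumE /= /l mxE; apply: eq_bigr => j _; rewrite mxE.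
  apply: differentiable_sum => j.
  by apply: differentiableM => //; exact: differentiable_coord.
have cL : continuous L by move=> y; exact: differentiable_continuous.
exists L; split=> // y i.
apply: DeriveDef; first exact: diff_derivable.
rewrite deriveE// diff_lin//= /l mxE (bigD1 i)//= !mxE !eqxx mul1r big1 ?addr0// => j ji.
by rewrite !mxE (negPf ji) andbF mul0r.
Qed.

(** Subtracting the linear form with the same partial derivatives at x leads back to the critical
    case. *)
Lemma C1_differentiable (R : realType) n (f : 'rV[R]_n -> R) (x : 'rV[R]_n) :
  (forall i, \forall y \near x, derivable f y (delta_mx 0 i)) ->
  (forall i, {for x, continuous ('D_(delta_mx 0 i) f)}) -> differentiable f x.
Proof.
move=> df cf.
have [L [DL dL]] := linear_form_derive (fun i => 'D_(delta_mx 0 i) f x).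
have kD y i : derivable f y (delta_mx 0 i) -> is_derive y (delta_mx 0 i : 'rV[R]_n)
    (f - L) ('D_(delta_mx 0 i) f y - 'D_(delta_mx 0 i) f x).
  by move=> dfy; apply: is_deriveB; exact: derivableP.
have -> : f = (f - L) + L by rewrite subrK.
apply: differentiableD => //.
move: (f - L) kD => k kD.
apply: C1_critical_differentiable.
- move=> i; near=> y.
  have dfy : derivable f y (delta_mx 0 i) by near: y; exact: df.
  by have [] := kD y i dfy.
- move=> i.
  have E : {near x, (fun y => 'D_(delta_mx 0 i) f y - 'D_(delta_mx 0 i) f x) =1
      'D_(delta_mx 0 i) k}.
    near=> y.
    have dfy : derivable f y (delta_mx 0 i) by near: y; exact: df.
    by have [_ ->] := kD y i dfy.
  have E0 := nbhs_singleton E.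
  suff: 'D_(delta_mx 0 i) k y @[y --> x] --> 'D_(delta_mx 0 i) k x by [].
  rewrite -E0.
  apply: cvg_trans; first exact: (near_eq_cvg E).
  by apply: cvgB; [exact: cf | exact: cvg_cst].
- move=> i; have [_ ->] := kD x i (nbhs_singleton (df i)); exact: subrr.
Unshelve. all: by end_near. Qed.

(** The mean value theorem is applied twice: along v to y |-> f (y + s *: w) - f y, then along w to
    the derivative of f in the direction v. *)
Lemma second_difference (R : realType) (V : normedModType R) (f : V -> R)
    (x v w : V) (s : R) :
  (forall a b : R, `|a| <= `|s| -> `|b| <= `|s| -> derivable f (x + a *: v + b *: w) v) ->
  (forall a b : R, `|a| <= `|s| -> `|b| <= `|s| ->
      derivable ('D_v f) (x + a *: v + b *: w) w) ->
  exists a b : R, [/\ `|a| <= `|s|, `|b| <= `|s| &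
    f (x + s *: v + s *: w) - f (x + s *: v) - (f (x + s *: w) - f x) =
    s * s * 'D_w ('D_v f) (x + a *: v + b *: w)].
Proof.
move=> dv dw.
pose g := fun y => f (y + s *: w) - f y.
have shift_der (a : R) : `|a| <= `|s| ->
    is_derive (x + a *: v) v (fun y => f (y + s *: w))
      ('D_v f (x + a *: v + s *: w)).
  move=> as_.
  have E : \forall t \near (0 : R), f (t *: v + (x + a *: v + s *: w)) =
      (fun y => f (y + s *: w)) (t *: v + (x + a *: v)).
    by near=> t; rewrite !addrA.
  have [-> H] := @derive_germ _ _ _ _ f (fun y => f (y + s *: w)) _ _ _ _ (erefl _) E.
  exact/derivableP/H/dv.
have dv0 (a : R) : `|a| <= `|s| -> derivable f (x + a *: v) v.
  by move=> as_; have := dv a 0 as_; rewrite normr0 scale0r addr0; apply.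
have [a as_ Ea] := @MVT_line _ _ g x v s (fun a as_ => ltac:(
  apply: derivableB; [by have [] := shift_der a as_ | exact: dv0])).
have [b bs Eb] := @MVT_line _ _ ('D_v f) (x + a *: v) w s (fun b bs => dw a b as_ bs).
exists a, b; split=> //.
rewrite -mulrA -Eb.
have -> : f (x + s *: v + s *: w) - f (x + s *: v) - (f (x + s *: w) - f x) =
  g (x + s *: v) - g x by [].
rewrite Ea; congr (_ * _); rewrite deriveB; last exact: dv0.
  by have := shift_der a as_ => /@derive_val ->.
by have [] := shift_der a as_.
Unshelve. all: by end_near. Qed.

Lemma dist_le_of_second_difference (R : realFieldType) (e s l l' p p' a b c d : R) :
  0 < s -> a - b - (c - d) = s * s * p -> a - c - (b - d) = s * s * p' ->
  `|l - p| <= e / 2 -> `|l' - p'| <= e / 2 -> `|l - l'| <= e.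
Proof.
move=> s0 E E' h1 h2.
have ss0 : s * s != 0 by rewrite mulf_neq0 ?gt_eqF.
have EE : p = p' by apply: (mulfI ss0); rewrite -E -E'; ring.
rewrite -EE in h2.
have -> : l - l' = (l - p) - (l' - p) by ring.
by rewrite [e]splitr; apply: le_trans (ler_normB _ _) _; apply: lerD.
Qed.

(** The second difference is symmetric in v and w, so one and the same number is s * s times a value
    of either mixed derivative at some point near x; continuity at x does the rest. *)
Lemma schwarz (R : realType) (V : normedModType R) (f : V -> R) (x v w : V) :
  (\forall y \near x, [/\ derivable f y v, derivable f y w,
      derivable ('D_v f) y w & derivable ('D_w f) y v]) ->
  {for x, continuous ('D_w ('D_v f))} -> {for x, continuous ('D_v ('D_w f))} ->
  'D_w ('D_v f) x = 'D_v ('D_w f) x.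
Proof.
move=> df cvw cwv; apply/eqP; rewrite -subr_eq0 -normr_le0; apply/ler_addgt0Pr => e e0.
rewrite add0r.
have e20 : 0 < e / 2 by rewrite divr_gt0.
have H1 : \forall y \near x, `|'D_w ('D_v f) x - 'D_w ('D_v f) y| <= e / 2.
  by move/cvgrPdist_le: cvw; apply.
have H2 : \forall y \near x, `|'D_v ('D_w f) x - 'D_v ('D_w f) y| <= e / 2.
  by move/cvgrPdist_le: cwv; apply.
have /nbhs_ballP[d /= d0 B] := @filterI _ (nbhs x) (nbhs_filter x) _ _ df
   (@filterI _ (nbhs x) (nbhs_filter x) _ _ H1 H2).
(* K and s are chosen so that the parallelogram spanned by s *: v and s *: w stays in the ball of
   radius d; the 1 keeps K positive when v = w = 0. *)
pose K := `|v| + `|w| + 1.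
have K0 : 0 < K by rewrite /K ltr_wpDl// addr_ge0.
pose s := d / 2 / K.
have s0 : 0 < s by rewrite !divr_gt0.
have near_x (a b : R) : `|a| <= `|s| -> `|b| <= `|s| -> ball x d (x + a *: v + b *: w).
  move=> as_ bs; rewrite -ball_normE /= -addrA opprD addrA subrr sub0r normrN.
  have : `|a *: v + b *: w| <= s * `|v| + s * `|w|.
    apply: le_trans (ler_normD _ _) _; rewrite !normrZ.
    by apply: lerD; apply: ler_wpM2r; rewrite // -(gtr0_norm s0).
  move=> /le_lt_trans; apply; rewrite -mulrDr.
  apply: (@le_lt_trans _ _ (s * K)).
    by rewrite ler_pM2l// /K lerDl.
  by rewrite /s divfK ?gt_eqF// ltr_pdivrMr// ltr_pMr// ltr1n.
have near_x' (a b : R) : `|a| <= `|s| -> `|b| <= `|s| -> ball x d (x + a *: w + b *: v).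
  by move=> as_ bs; rewrite addrAC; exact: near_x.
have [a [b [as_ bs E]]] := @second_difference _ _ f x v w s
  (fun a b as_ bs => ltac:(by have [[]] := B _ (near_x a b as_ bs)))
  (fun a b as_ bs => ltac:(by have [[]] := B _ (near_x a b as_ bs))).
have [a' [b' [as'_ bs' E']]] := @second_difference _ _ f x w v s
  (fun a b as_ bs => ltac:(by have [[]] := B _ (near_x' a b as_ bs)))
  (fun a b as_ bs => ltac:(by have [[]] := B _ (near_x' a b as_ bs))).
have [_ [h1 _]] := B _ (near_x a b as_ bs).
have [_ [_ h2]] := B _ (near_x' a' b' as'_ bs').
rewrite (addrAC x (s *: w) (s *: v)) in E'.
exact: (dist_le_of_second_difference s0 E E' h1 h2).
Qed.

Lemma differentiable_const_ball (R : realType) n (f : 'rV[R]_n -> R) (x : 'rV[R]_n) (e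
  : R) :
  (forall y, ball x e y -> differentiable f y) ->
  (forall y, ball x e y -> forall i, 'D_(delta_mx 0 i) f y = 0) ->
  forall y, ball x e y -> f y = f x.
Proof.
move=> df f0 y xy.
have near_x (t : R) : `|t| <= `|1 : R| -> ball x e (x + t *: (y - x)).
  rewrite normr1 => t1; move: xy; rewrite -!ball_normE /= opprD addrA subrr sub0r normrN.
  rewrite normrZ -normrN opprB; apply: le_lt_trans; exact: ler_piMl.
have [t t1] := @MVT_line _ _ f x (y - x) 1 
  (fun t t1 => @diff_derivable _ _ _ f _ _ (df _ (near_x t t1))).
rewrite scale1r [x + _]addrC subrK mul1r => /eqP; rewrite subr_eq => /eqP ->.
rewrite deriveE; last exact/df/near_x.
rewrite [X in 'd _ _ X]row_sum_delta linear_sum big1 ?add0r// => i _.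
rewrite linearZ /= -deriveE; last exact/df/near_x.
by rewrite f0 ?scaler0//; exact: near_x.
Qed.

(** * Partial derivatives in charts *)

Section Coordinates.
Context (R : realType) (n : nat) (X : charted_space R n).
Hypothesis hX : smooth_manifold X.
Implicit Types (c : chart X) (q : X) (F G : X -> R) (O : set X).

(** Since [pd] has some value even where the limit does not exist, the rules of calculus are stated
    for this relation, which includes derivability. *)
Definition is_pd c (i : 'I_n) q F (dF : R) :=
  is_derive (coord c q) (delta_mx 0 i : 'rV[R]_n) (in_chart c F) dF.

(** Injectivity of the chart leaves a single value for [get] to pick. *)
Lemma in_chartE c F q : dom c q -> in_chart c F (coord c q) = F q.
Proof.
move=> cq; rewrite /in_chart.
have -> : [set F r | r in dom c `&` coord c @^-1` [set coord c q]] = [set F q].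
  apply/seteqP; split=> [_ [r [/= cr rq] <-]|_ ->]; last by exists q.
  by congr F; apply: (coord_inj hX (c := c)) => //; rewrite inE.
by have [y] := (@getPex _ [set F q] (ex_intro _ (F q) erefl)).
Qed.

(** Charts are open maps, so neighbourhoods in X become neighbourhoods in R^n. All passages from
    germs on X to germs of coordinate expressions go through this. *)
Lemma near_coord c q (P : X -> Prop) (Q : 'rV[R]_n -> Prop) :
  dom c q -> (\forall r \near q, P r) ->
  (forall r, dom c r -> P r -> Q (coord c r)) ->
  \forall x \near coord c q, Q x.
Proof.
move=> cq qP PQ; move: qP; rewrite /prop_near1 nbhsE => -[U [U_open Uq] UP].
have oUc : open (U `&` dom c) by apply: openI => //; exact: (dom_open hX).
rewrite nbhsE; exists (coord c @` (U `&` dom c)).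
  by split; [apply: (coord_open hX) => // r [] | exists q].
by move=> _ [r [Ur cr] <-]; apply: PQ => //; exact: UP.
Qed.

Lemma near_in_chart c q F G : dom c q -> {near q, F =1 G} ->
  {near coord c q, in_chart c F =1 in_chart c G}.
Proof.
move=> cq FG; apply: (near_coord cq FG) => r cr.
by rewrite !in_chartE.
Qed.

Lemma is_pd_near c i q F G dF : dom c q -> {near q, F =1 G} ->
  is_pd c i q F dF -> is_pd c i q G dF.
Proof. by move=> cq FG; apply: near_eq_is_derive; exact: near_in_chart. Qed.

Lemma pd_near c i q F G : dom c q -> {near q, F =1 G} -> pd c i F q = pd c i G q.
Proof. by move=> cq FG; apply: near_eq_derive; exact: near_in_chart. Qed.

Lemma is_pdE c i q F dF : is_pd c i q F dF -> pd c i F q = dF.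
Proof. by move=> /@derive_val. Qed.

Lemma is_pd_eq c i q F dF dG : is_pd c i q F dF -> dF = dG -> is_pd c i q F dG.
Proof. by move=> + <-. Qed.

Lemma is_pd_near_derive c i q F (f : 'rV[R]_n -> R) dF : dom c q ->
  (forall r, dom c r -> f (coord c r) = F r) ->
  is_derive (coord c q) (delta_mx 0 i : 'rV[R]_n) f dF -> is_pd c i q F dF.
Proof.
move=> cq fF; apply: near_eq_is_derive.
apply: (near_coord (P := fun=> True) cq); first exact: filterT.
by move=> r cr _; rewrite in_chartE// fF.
Qed.

Lemma is_pd_cst c i q (a : R) : dom c q -> is_pd c i q (fun=> a) 0.
Proof.
by move=> cq; apply: (@is_pd_near_derive _ _ _ _ (cst a)) => //; exact: is_derive_cst.
Qed.

Lemma is_pdD c i q F G dF dG : dom c q ->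
  is_pd c i q F dF -> is_pd c i q G dG -> is_pd c i q (fun r => F r + G r) (dF + dG).
Proof.
move=> cq hF hG; apply: (@is_pd_near_derive _ _ _ _ (in_chart c F + in_chart c G)) => //.
  by move=> r cr; rewrite fctE !in_chartE.
exact: is_deriveD.
Qed.

Lemma is_pdM c i q F G dF dG : dom c q ->
  is_pd c i q F dF -> is_pd c i q G dG ->
  is_pd c i q (fun r => F r * G r) (dF * G q + F q * dG).
Proof.
move=> cq hF hG.
have H : is_derive (coord c q) (delta_mx 0 i : 'rV[R]_n) (in_chart c F * in_chart c G)
    (in_chart c F (coord c q) *: dG + in_chart c G (coord c q) *: dF) by exact:
      is_deriveM.
apply: is_pd_eq.
  by apply: is_pd_near_derive H => // r cr; rewrite fctE !in_chartE.
by rewrite !in_chartE// addrC; congr (_ + _); exact: mulrC.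
Qed.

Lemma is_pdN c i q F dF : dom c q -> is_pd c i q F dF -> is_pd c i q (fun r => - F r)
  (- dF).
Proof.
move=> cq hF; apply: (@is_pd_near_derive _ _ _ _ (- in_chart c F)) => //.
  by move=> r cr; rewrite fctE !in_chartE.
exact: is_deriveN.
Qed.

Lemma is_pdB c i q F G dF dG : dom c q ->
  is_pd c i q F dF -> is_pd c i q G dG -> is_pd c i q (fun r => F r - G r) (dF - dG).
Proof. by move=> cq hF hG; apply: is_pdD => //; exact: is_pdN. Qed.

Lemma is_pdV c i q F dF : dom c q -> F q != 0 ->
  is_pd c i q F dF -> is_pd c i q (fun r => (F r)^-1) (- (dF * (F q)^-1 * (F q)^-1)).
Proof.
move=> cq F0 hF.
have F0' : in_chart c F (coord c q) != 0 by rewrite in_chartE.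
have H : is_derive (coord c q) (delta_mx 0 i : 'rV[R]_n) (fun y => (in_chart c F y)^-1)
    (- (in_chart c F (coord c q)) ^- 2 *: dF).
  case: hF => dFx <-; apply: DeriveDef; first exact: derivableV.
  exact: deriveV.
apply: is_pd_eq.
  by apply: is_pd_near_derive H => // r cr; rewrite !in_chartE.
rewrite in_chartE// -exprVn expr2 scaleNr; congr (- _).
by rewrite [LHS]mulrC mulrA.
Qed.

Lemma is_pd_sum c i q (I : Type) (s : seq I) (P : pred I) (F : I -> X -> R) (dF : I ->
  R) :
  dom c q -> (forall j, P j -> is_pd c i q (F j) (dF j)) ->
  is_pd c i q (fun r => \sum_(j <- s | P j) F j r) (\sum_(j <- s | P j) dF j).
Proof.
move=> cq hF; elim: s => [|j s IHs].
  apply: is_pd_eq; last by rewrite big_nil.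
  apply: (@is_pd_near _ _ _ (fun=> 0)) => //; last exact: is_pd_cst.
  by near=> r; rewrite big_nil.
rewrite big_cons.
case: ifP => Pj.
  apply: (@is_pd_near _ _ _ (fun r => F j r + \sum_(j <- s | P j) F j r)) => //.
    by near=> r; rewrite big_cons Pj.
  by apply: is_pdD => //; exact: hF.
apply: (@is_pd_near _ _ _ (fun r => \sum_(j <- s | P j) F j r)) => //.
by near=> r; rewrite big_cons Pj.
Unshelve. all: by end_near. Qed.

Lemma is_pd_comp1 c i q (f : R -> R) F dF : dom c q -> derivable f (F q) 1 ->
  is_pd c i q F dF -> is_pd c i q (fun r => f (F r)) (derive1 f (F q) * dF).
Proof.
move=> cq df hF.
apply: (@is_pd_near_derive _ _ _ _ (f \o in_chart c F)) => //.
  by move=> r cr; rewrite /= in_chartE.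
set x := coord c q; set v : 'rV[R]_n := delta_mx 0 i.
have Fx : in_chart c F x = F q by rewrite in_chartE.
(* Only the derivative of F along v is given, not its differentiability, so the chain rule is
   applied to the restriction of F to a line. *)
pose l := fun s : R => in_chart c F (x + s *: v).
have Dl : is_derive (0 : R) (1 : R) l dF.
  have := @is_derive_line _ _ _ (in_chart c F) x v 0.
  rewrite scale0r addr0 => H.
  by case: hF => hF <-; exact: H.
have l0 : l 0 = F q by rewrite /l scale0r addr0.
have D2 : derivable f (l 0) 1 by rewrite l0.
have [dl lE] := Dl.
have D3 : derivable (f \o l) (0 : R) 1.
  apply/derivable1_diffP/(differentiable_comp (f := l) (g := f)); exact/derivable1_diffP.
have E : \forall t \near (0 : R), (f \o l) (t *: 1 + 0) = (f \o in_chart c F) (t *: v +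
  x).
  by near=> t; rewrite /l /= addr0 [_%:A]mulr1 addrC.
have [E1 E2] := @derive_germ _ _ _ _ (f \o l) (f \o in_chart c F) 0 1 x v
  (ltac:(by rewrite /l /= scale0r addr0)) E.
apply: DeriveDef; first exact: E2.
apply: etrans (esym E1) _.
have := derive1_comp dl D2; rewrite derive1E => ->.
by rewrite l0 [derive1 l 0]derive1E lE.
Unshelve. all: by end_near. Qed.

Lemma in_chart_continuous c q F : dom c q -> {for q, continuous F} ->
  {for coord c q, continuous (in_chart c F)}.
Proof.
move=> cq cF.
suff : in_chart c F x @[x --> coord c q] --> in_chart c F (coord c q) by [].
rewrite in_chartE// => A /cF FA.
by apply: (near_coord (P := fun r => A (F r)) cq FA) => r cr; rewrite /= in_chartE.
Qed.

Lemma near_dom c q : dom c q -> \forall r \near q, dom c r.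
Proof. by move=> cq; apply: open_nbhs_nbhs; split => //; exact: dom_open. Qed.

Lemma near_open O q : open O -> O q -> \forall r \near q, O r.
Proof. by move=> oO Oq; exact: open_nbhs_nbhs. Qed.

(** * Functions of class C^k on an open part of a chart *)

Section Ck.
Variables (c : chart X) (O : set X).
Hypothesis oO : open O.
Hypothesis Oc : O `<=` dom c.

Lemma Ck_cont k F q : Ck c k O F -> O q -> {for q, continuous F}.
Proof. by case: k => [|k] [] cF _ /cF. Qed.

Lemma Ck_is_pd k F q i : Ck c k.+1 O F -> O q -> is_pd c i q F (pd c i F q).
Proof. by case=> _ /(_ i)[dF _] Oq; apply/derivableP/dF. Qed.

Lemma Ck_pd k F i : Ck c k.+1 O F -> Ck c k O (pd c i F).
Proof. by case=> _ /(_ i)[]. Qed.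

Lemma Ck_mono k F : Ck c k.+1 O F -> Ck c k O F.
Proof.
elim: k F => [F []//|k IHk F [cF dF]]; split=> // i.
by have [dFi CFi] := dF i; split=> //; exact: IHk.
Qed.

Lemma CkS k F (dF : 'I_n -> X -> R) : (forall q, O q -> {for q, continuous F}) ->
  (forall i q, O q -> is_pd c i q F (dF i q)) -> (forall i, Ck c k O (pd c i F)) ->
  Ck c k.+1 O F.
Proof.
move=> cF pF CF; split=> // i; split=> // q Oq.
by have [] := pF i q Oq.
Qed.

Lemma near_cont F G q : {near q, F =1 G} -> {for q, continuous F} -> {for q, continuous
  G}.
Proof.
move=> FG cF.
suff : G x @[x --> q] --> G q by [].
rewrite -(nbhs_singleton FG); apply: cvg_trans cF; exact: near_eq_cvg.
Qed.

Lemma Ck_ext k F G : (forall q, O q -> F q = G q) -> Ck c k O F -> Ck c k O G.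
Proof.
have nO (F1 G1 : X -> R) q : (forall q, O q -> F1 q = G1 q) -> O q -> {near q, F1 =1 G1}.
  move=> FG Oq; near=> r; apply: FG; near: r; exact: near_open.
elim: k F G => [|k IHk] F G FG [cF dF].
  by split=> // q Oq; apply: (near_cont (nO _ _ q FG Oq)); exact: cF.
split; first by move=> q Oq; apply: (near_cont (nO _ _ q FG Oq)); exact: cF.
move=> i; have [dFi CFi] := dF i; split.
  move=> q Oq; have := is_pd_near (i := i) (Oc Oq) (nO _ _ q FG Oq) (derivableP (dFi q
    Oq)).
  by case.
apply: IHk CFi => q Oq; apply: pd_near; [exact: Oc | exact: nO].
Unshelve. all: by end_near. Qed.

Lemma Ck_pdE k F G i : (forall q, O q -> is_pd c i q F (G q)) -> Ck c k O G ->
  Ck c k O (pd c i F).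
Proof. by move=> FG; apply: Ck_ext => q /FG /is_pdE. Qed.

Lemma Ck_cst k (a : R) : Ck c k O (fun=> a).
Proof.
elim: k a => [|k IHk] a; first by split=> // q _; exact: cst_continuous.
apply: CkS => [q Oq|i q Oq|i].
- exact: cst_continuous.
- by apply: is_pd_cst; exact: Oc.
- by apply: (@Ck_pdE _ _ (fun=> 0)) => // q Oq; apply: is_pd_cst; exact: Oc.
Qed.

Lemma CkD k F G : Ck c k O F -> Ck c k O G -> Ck c k O (fun q => F q + G q).
Proof.
elim: k F G => [|k IHk] F G CF CG.
  by split=> // q Oq; apply: cvgD; [exact: (Ck_cont CF)|exact: (Ck_cont CG)].
have pFG i q : O q -> is_pd c i q (fun q => F q + G q) (pd c i F q + pd c i G q).
  by move=> Oq; apply: is_pdD; [exact: Oc|exact: Ck_is_pd CF _|exact: Ck_is_pd CG _].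
apply: (CkS _ pFG) => [q Oq|i].
- by apply: cvgD; [exact: (Ck_cont CF)|exact: (Ck_cont CG)].
- by apply: (Ck_pdE (pFG i)); apply: IHk; exact: Ck_pd.
Qed.

Lemma CkM k F G : Ck c k O F -> Ck c k O G -> Ck c k O (fun q => F q * G q).
Proof.
elim: k F G => [|k IHk] F G CF CG.
  by split=> // q Oq; apply: cvgM; [exact: (Ck_cont CF)|exact: (Ck_cont CG)].
have pFG i q : O q ->
    is_pd c i q (fun q => F q * G q) (pd c i F q * G q + F q * pd c i G q).
  by move=> Oq; apply: is_pdM; [exact: Oc|exact: Ck_is_pd CF _|exact: Ck_is_pd CG _].
apply: (CkS _ pFG) => [q Oq|i].
- by apply: cvgM; [exact: (Ck_cont CF)|exact: (Ck_cont CG)].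
- apply: (Ck_pdE (pFG i)).
  by apply: CkD; apply: IHk => //; (exact: Ck_pd || exact: Ck_mono).
Qed.

Lemma CkN k F : Ck c k O F -> Ck c k O (fun q => - F q).
Proof.
move=> CF; apply: (@Ck_ext _ (fun q => -1 * F q)) => [q _|]; first by rewrite mulN1r.
by apply: CkM => //; exact: Ck_cst.
Qed.

Lemma CkB k F G : Ck c k O F -> Ck c k O G -> Ck c k O (fun q => F q - G q).
Proof. by move=> CF CG; apply: CkD => //; exact: CkN. Qed.

Lemma Ck_sum k (I : Type) (s : seq I) (P : pred I) (F : I -> X -> R) :
  (forall j, P j -> Ck c k O (F j)) -> Ck c k O (fun q => \sum_(j <- s | P j) F j q).
Proof.
move=> CF; elim: s => [|j s IHs].
  by apply: (@Ck_ext _ (fun=> 0)) => [q _|]; [rewrite big_nil | exact: Ck_cst].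
case Pj : (P j); last by apply: Ck_ext IHs => q _; rewrite big_cons Pj.
apply: (@Ck_ext _ (fun q => F j q + \sum_(j <- s | P j) F j q)) => [q _|].
  by rewrite big_cons Pj.
by apply: CkD => //; exact: CF.
Qed.

Lemma Ck_prod k (I : Type) (s : seq I) (P : pred I) (F : I -> X -> R) :
  (forall j, P j -> Ck c k O (F j)) -> Ck c k O (fun q => \prod_(j <- s | P j) F j q).
Proof.
move=> CF; elim: s => [|j s IHs].
  by apply: (@Ck_ext _ (fun=> 1)) => [q _|]; [rewrite big_nil | exact: Ck_cst].
case Pj : (P j); last by apply: Ck_ext IHs => q _; rewrite big_cons Pj.
apply: (@Ck_ext _ (fun q => F j q * \prod_(j <- s | P j) F j q)) => [q _|].
  by rewrite big_cons Pj.
by apply: CkM => //; exact: CF.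
Qed.

Lemma CkV k F : (forall q, O q -> F q != 0) -> Ck c k O F -> Ck c k O (fun q => (F q)^-1).
Proof.
move=> F0; elim: k => [|k IHk] CF.
  by split=> // q Oq; apply: cvgV; [exact: F0|exact: (Ck_cont CF)].
have pF i q : O q ->
    is_pd c i q (fun q => (F q)^-1) (- (pd c i F q * (F q)^-1 * (F q)^-1)).
  by move=> Oq; apply: is_pdV; [exact: Oc|exact: F0|exact: Ck_is_pd CF _].
(* The derivative of 1/F contains 1/F again, which the induction hypothesis provides at order k. *)
have CV := IHk (Ck_mono CF).
apply: (CkS _ pF) => [q Oq|i].
- by apply: cvgV; [exact: F0|exact: (Ck_cont CF)].
- by apply: (Ck_pdE (pF i)); apply/CkN/CkM => //; apply: CkM => //; exact: Ck_pd.
Qed.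

Lemma Ck_differentiable F q : Ck c 1 O F -> O q ->
  differentiable (in_chart c F) (coord c q).
Proof.
move=> CF Oq; have cq := Oc Oq; apply: C1_differentiable => i.
  apply: (near_coord (P := O) cq); first exact: near_open.
  by move=> r cr Or; have [] := Ck_is_pd i CF Or.
have H : {near coord c q, in_chart c (pd c i F) =1 'D_(delta_mx 0 i) (in_chart c F)}.
  apply: (near_coord (P := O) cq); first exact: near_open.
  by move=> r cr Or; rewrite in_chartE.
have cF := in_chart_continuous cq (Ck_cont (Ck_pd i CF) Oq).
suff : 'D_(delta_mx 0 i) (in_chart c F) x @[x --> coord c q] -->
    'D_(delta_mx 0 i) (in_chart c F) (coord c q) by [].
rewrite -(nbhs_singleton H); apply: cvg_trans cF; exact: (near_eq_cvg H).
Qed.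

Lemma pdC F q i j : Ck c 2 O F -> O q -> pd c i (pd c j F) q = pd c j (pd c i F) q.
Proof.
move=> CF Oq; have cq := Oc Oq.
have H a r : O r -> {near coord c r, in_chart c (pd c a F) =1 'D_(delta_mx 0 a)
  (in_chart c F)}.
  move=> Or; apply: (near_coord (P := O) (Oc Or)); first exact: near_open.
  by move=> r' cr' Or'; rewrite in_chartE.
have D a b r : O r -> is_derive (coord c r) (delta_mx 0 b : 'rV[R]_n)
    ('D_(delta_mx 0 a) (in_chart c F)) (pd c b (pd c a F) r).
  move=> Or; apply: (near_eq_is_derive (H a r Or)).
  exact: (Ck_is_pd _ (Ck_pd a CF) Or).
have E a b : {near coord c q, in_chart c (pd c b (pd c a F)) =1
    'D_(delta_mx 0 b) ('D_(delta_mx 0 a) (in_chart c F))}.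
  apply: (near_coord (P := O) cq); first exact: near_open.
  by move=> r cr Or; rewrite in_chartE//; have := D a b r Or => /@derive_val ->.
have C a b : {for coord c q, continuous
    ('D_(delta_mx 0 b) ('D_(delta_mx 0 a) (in_chart c F)))}.
  have cF := in_chart_continuous cq (Ck_cont (Ck_pd b (Ck_pd a CF)) Oq).
  suff : 'D_(delta_mx 0 b) ('D_(delta_mx 0 a) (in_chart c F)) x @[x --> coord c q] -->
    'D_(delta_mx 0 b) ('D_(delta_mx 0 a) (in_chart c F)) (coord c q) by [].
  rewrite -(nbhs_singleton (E a b)); apply: cvg_trans cF; exact: (near_eq_cvg (E a b)).
have pdpd a b : pd c b (pd c a F) q =
    'D_(delta_mx 0 b) ('D_(delta_mx 0 a) (in_chart c F)) (coord c q).
  by have := D a b q Oq => /@derive_val ->.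
rewrite !pdpd; apply: schwarz => //.
apply: (near_coord (P := O) cq); first exact: near_open.
move=> r cr Or; split.
- by have [] := Ck_is_pd j CF Or.
- by have [] := Ck_is_pd i CF Or.
- by have [] := D j i r Or.
- by have [] := D i j r Or.
Qed.

Lemma pd0_locally_constant F q : Ck c 1 O F -> O q ->
  (forall r i, O r -> pd c i F r = 0) -> \forall r \near q, F r = F q.
Proof.
move=> CF Oq F0; have cq := Oc Oq.
(* The mean value argument takes place in a ball inside the image of O, which contains the segments
   issuing from its centre. *)
have : \forall x \near coord c q, exists2 r, O r & x = coord c r.
  apply: (near_coord (P := O) cq); first exact: near_open.
  by move=> r _ Or; exists r.
case/nbhs_ballP => e /= e0 B.
have cst_B := @differentiable_const_ball _ _ (in_chart c F) (coord c q) e.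
have nb : \forall r \near q, ball (coord c q) e (coord c r).
  have cc := coord_cont hX cq.
  apply: cc; exact: nbhsx_ballx.
near=> r.
have cr : dom c r by near: r; exact: near_dom.
rewrite -(in_chartE F cq) -(in_chartE F cr); apply: cst_B.
- by move=> y /B[s Os ->]; apply: Ck_differentiable.
- by move=> y /B[s Os ->] i; exact: F0.
- by near: r.
Unshelve. all: by end_near. Qed.

End Ck.
End Coordinates.

(** * The chain rule *)

Section Chain.
Context (R : realType) (n m : nat) (X : charted_space R n) (Y : charted_space R m).
Hypotheses (hX : smooth_manifold X) (hY : smooth_manifold Y).
Variables (u : X -> Y) (c : chart X) (c' : chart Y).

Lemma is_pd_chain i q (F : Y -> R) :
  dom c q -> (\forall r \near q, dom c' (u r)) ->
  differentiable (in_chart c' F) (coord c' (u q)) ->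
  (forall a, differentiable (in_chart c (fun r => coord c' (u r) 0 a)) (coord c q)) ->
  is_pd c i q (fun r => F (u r))
    (\sum_(a < m) pd c' a F (u q) * pd c i (fun r => coord c' (u r) 0 a) q).
Proof.
move=> cq nu dF du.
(* The coordinate expression of u, assembled from its components so that its differentiability
   follows from theirs; it agrees with u only on the image of the chart. *)
pose U : 'rV[R]_n -> 'rV[R]_m := \sum_(a < m) (fun x =>
  in_chart c (fun r => coord c' (u r) 0 a) x *: delta_mx 0 a).
have UE x a : U x 0 a = in_chart c (fun r => coord c' (u r) 0 a) x.
  rewrite /U fct_sumE summxE (bigD1 a)//= !mxE !eqxx mulr1 big1 ?addr0// => b ba.
  by rewrite !mxE eq_sym (negPf ba) andbF mulr0.
have UEf a : (fun x => U x 0 a) = in_chart c (fun r => coord c' (u r) 0 a).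
  by apply/funext => x; exact: UE.
have Uc r : dom c r -> U (coord c r) = coord c' (u r).
  by move=> cr; apply/rowP => a; rewrite UE in_chartE.
have dU : differentiable U (coord c q).
  by apply: differentiable_sum => a; exact: differentiableZl.
have dF' : differentiable (in_chart c' F) (U (coord c q)) by rewrite Uc.
have H : is_derive (coord c q) (delta_mx 0 i : 'rV[R]_n) (in_chart c' F \o U)
    (\sum_(a < m) pd c' a F (u q) * pd c i (fun r => coord c' (u r) 0 a) q).
  have dFU : differentiable (in_chart c' F \o U) (coord c q) by exact:
    differentiable_comp.
  apply: DeriveDef; first exact: diff_derivable.
  rewrite deriveE// diff_comp//= -(@deriveE _ _ _ U)//.
  rewrite (@derive_mx _ _ _ _ U _ _ (@diff_derivable _ _ _ U _ _ dU)).
  rewrite [X in 'd _ _ X]row_sum_delta linear_sum; apply: eq_bigr => a _.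
  rewrite linearZ /= -deriveE// Uc// mulrC mxE; congr (_ * _).
  by rewrite UEf.
apply: near_eq_is_derive H.
apply: (near_coord hX (P := fun r => dom c' (u r)) cq nu) => r cr cur.
by rewrite /= Uc// !in_chartE.
Qed.

Section ChainCk.
Variables (O : set X) (V : set Y).
Hypotheses (oO : open O) (Oc : O `<=` dom c) (oV : open V) (Vc : V `<=` dom c').
Hypotheses (uO : forall q, O q -> V (u q)) (cu : continuous u).

Lemma Ck_chain1 i q (F : Y -> R) : O q ->
  (forall a, Ck c 1 O (fun r => coord c' (u r) 0 a)) -> Ck c' 1 V F ->
  is_pd c i q (fun r => F (u r))
    (\sum_(a < m) pd c' a F (u q) * pd c i (fun r => coord c' (u r) 0 a) q).
Proof.
move=> Oq Cu CF; apply: is_pd_chain.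
- exact: Oc.
- by near=> r; apply/Vc/uO; near: r; exact: near_open.
- by apply: (Ck_differentiable hY oV) => //; exact: uO.
- by move=> a; exact: (Ck_differentiable hX oO).
Unshelve. all: by end_near. Qed.

Lemma Ck_comp k (F : Y -> R) :
  (forall a, Ck c k O (fun r => coord c' (u r) 0 a)) -> Ck c' k V F ->
  Ck c k O (fun r => F (u r)).
Proof.
have contF k' F1 q : Ck c' k' V F1 -> O q -> {for q, continuous (fun r => F1 (u r))}.
  move=> CF Oq; apply: (@continuous_comp _ _ _ u F1 q); first exact: cu.
  by apply: (Ck_cont CF); exact: uO.
elim: k F => [|k IHk] F Cu CF; first by split=> // q Oq; exact: contF CF Oq.
have Cu1 a : Ck c 1 O (fun r => coord c' (u r) 0 a).
  by move: (Cu a); elim: k {IHk Cu CF} => // k IHk /(Ck_mono (c := c)) /IHk.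
have CF1 : Ck c' 1 V F.
  by move: CF; elim: k {IHk Cu} => // k IHk /(Ck_mono (c := c')) /IHk.
have pF i q (Oq : O q) := Ck_chain1 i Oq Cu1 CF1.
apply: (CkS _ pF) => [q Oq|i]; first exact: contF CF Oq.
apply: (Ck_pdE hX oO Oc (pF i)).
apply: (Ck_sum hX oO Oc) => a _; apply: (CkM hX oO Oc).
- apply: IHk; last exact: Ck_pd CF.
  by move=> b; apply: Ck_mono; exact: Cu.
- exact: Ck_pd (Cu a).
Qed.

End ChainCk.
End Chain.

(** The chain rule with the identity of X as inner map. The mean curvature is computed in the
    preferred chart of each point; this carries the vanishing of du from there to the other
    charts. *)
Lemma dmap_change_chart (R : realType) n m (X : charted_space R n)
    (Y : charted_space R m) (u : X -> Y) (c c1 : chart X) (c' : chart Y) (q : X) :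
  smooth_manifold X -> smooth_map u -> smooth_manifold Y ->
  dom c q -> dom c1 q -> dom c' (u q) ->
  dmap u c c' q = jacobian_mx c c1 q *m dmap u c1 c' q.
Proof.
move=> hX [cu su] hY cq c1q cuq.
have oU : open (u @^-1` dom c').
  by apply: open_comp; [move=> ? _; exact: cu | exact: (dom_open hY)].
have oV : open (dom c1 `&` u @^-1` dom c').
  by apply: openI => //; exact: (dom_open hX).
have oO : open (dom c `&` dom c1) by apply: openI; exact: (dom_open hX).
apply/matrixP => i a; rewrite !mxE.
under eq_bigr do rewrite !mxE mulrC.
apply: is_pdE; apply: (@is_pd_chain _ _ _ X X hX hX id c c1) => //.
- exact: near_dom.
- by apply: (Ck_differentiable hX oV) (su c' a c1 1%N) _ => // r [].
- move=> b; apply: (Ck_differentiable hX oO) (@transition_smooth _ _ _ hX c1 b c 1%N) _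
  => //.
Qed.

(** * Derivatives on a product with an interval *)

Section Warped.
Context (R : realType) (n : nat) (I : set R) (M : charted_space R n).
Hypotheses (hM : smooth_manifold M) (I_open : open I).
Local Notation P := (interval_prod I M).
Implicit Types (c : chart M) (z : P).

Lemma piI_in z : I (piI z).
Proof. exact: (set_valP z.1). Qed.

(** Functions on the product are presented by a K defined on all of R, so that freezing one argument
    leaves an honest function on R or on M. The product charts are accessed only in this way. *)
Lemma in_chart_prod c (K : R -> M -> R) (t : R) (p : M) : I t -> dom c p ->
  in_chart (X := P) c (fun w : P => K (piI w) w.2) (row_mx (const_mx t) (coord c p)) =
    K t p.
Proof.
move=> It cp; rewrite /in_chart.
pose w : P := (exist _ t (mem_set It), p).
have -> : [set K (piI r) r.2 | r in @dom _ _ P c `&`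
    @coord _ _ P c @^-1` [set row_mx (const_mx t) (coord c p)]] = [set K t p].
  apply/seteqP; split=> [_ [r [/= cr rq] <-]|_ ->]; last by exists w.
  have [r1 r2] := eq_row_mx rq.
  have -> : piI r = t by have := congr1 (fun A : 'M[R]_1 => A 0 0) r1; rewrite !mxE.
  by congr K; apply: (coord_inj hM (c := c)) => //; rewrite inE.
by have [y] := (@getPex _ [set K t p] (ex_intro _ (K t p) erefl)).
Qed.

Lemma pd_prod_l c (K : R -> M -> R) z : dom c z.2 ->
  pd (X := P) c (lshift n 0) (fun w : P => K (piI w) w.2) z =
  derive1 (fun t => K t z.2) (piI z).
Proof.
move=> cz; rewrite /pd derive1E.
have E0 : in_chart (X := P) c (fun w : P => K (piI w) w.2) (coord (c : chart P) z) = K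
  (piI z) z.2.
  exact: (in_chart_prod K (piI_in z) cz).
apply: (derive_germ (f := in_chart (X := P) c (fun w : P => K (piI w) w.2))
  (g := fun t => K t z.2) (a := coord (c : chart P) z) (b := piI z) E0 _).1.
(* Openness of I: a small move in the direction d/dt stays in the product. *)
have nI : \forall t \near (0 : R), I (t + piI z).
  have : \forall t \near piI z, I t.
    by apply: open_nbhs_nbhs; split=> //; exact: piI_in.
  by rewrite (near_shift 0 (piI z)) subr0.
near=> t.
have -> : t *: delta_mx 0 (lshift n 0) + coord (c : chart P) z =
    row_mx (const_mx (t + piI z)) (coord c z.2).
  rewrite -[delta_mx _ _]hsubmxK (_ : lsubmx _ = const_mx 1); last first.
    by apply/matrixP => i j; rewrite !ord1 !mxE -val_eqE.
  rewrite (_ : rsubmx _ = 0); last first.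
    by apply/matrixP => i j; rewrite !ord1 !mxE eqxx -val_eqE.
  rewrite scale_row_mx add_row_mx scaler0 add0r; congr row_mx.
  by apply/matrixP => i j; rewrite !mxE mulr1.
rewrite (in_chart_prod K) ?[_%:A]mulr1//; near: t; exact: nI.
Unshelve. all: by end_near. Qed.

Lemma pd_prod_r c (a : 'I_n) (K : R -> M -> R) z : dom c z.2 ->
  pd (X := P) c (rshift 1 a) (fun w : P => K (piI w) w.2) z = pd c a (K (piI z)) z.2.
Proof.
move=> cz; rewrite /pd.
have E0 : in_chart (X := P) c (fun w : P => K (piI w) w.2) (coord (c : chart P) z) =
    in_chart c (K (piI z)) (coord c z.2).
  by rewrite [RHS](in_chartE hM)//; exact: (in_chart_prod K (piI_in z) cz).
apply: (derive_germ (f := in_chart (X := P) c (fun w : P => K (piI w) w.2))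
  (g := in_chart c (K (piI z))) (a := coord (c : chart P) z) (b := coord c z.2) E0 _).1.
have nx : \forall x \near coord c z.2, exists2 r, dom c r & x = coord c r.
  apply: (near_coord hM (P := fun=> True) cz); first exact: filterT.
  by move=> r cr _; exists r.
have nt : \forall t \near (0 : R), exists2 r, dom c r & t *: delta_mx 0 a + coord c z.2
  = coord c r.
  have ct : (t *: delta_mx 0 a + coord c z.2) @[t --> (0 : R)] --> coord c z.2.
    suff : (t *: delta_mx 0 a + coord c z.2) @[t --> (0 : R)] -->
        0 *: delta_mx 0 a + coord c z.2 by rewrite scale0r add0r.
    apply: cvgD; last exact: cvg_cst.
    exact: scalel_continuous.
  exact: ct _ nx.
near=> t.
have -> : t *: delta_mx 0 (rshift 1 a) + coord (c : chart P) z =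
    row_mx (const_mx (piI z)) (t *: delta_mx 0 a + coord c z.2).
  rewrite -[X in _ *: X]hsubmxK (_ : lsubmx _ = 0); last first.
    by apply/matrixP => i j; rewrite !ord1 !mxE eqxx -val_eqE.
  rewrite (_ : rsubmx _ = delta_mx 0 a); last first.
    by apply/matrixP => i j; rewrite !ord1 !mxE eqxx/= -!val_eqE.
  rewrite scale_row_mx add_row_mx scaler0 add0r; congr row_mx.
have [r cr ->] : exists2 r, dom c r & t *: delta_mx 0 a + coord c z.2 = coord c r.
  by near: t.
by rewrite (in_chart_prod K (piI_in z) cr) (in_chartE hM).
Unshelve. all: by end_near. Qed.

End Warped.

(* Otherwise failed unifications of distinct partial derivatives unfold them
   down to filters and do not end. *)
Opaque pd.

(** * Orthonormal frames *)

Lemma tr_scalar11 (R : realType) (x : 'M[R]_1) : x^T = x.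
Proof. by apply/matrixP => i j; rewrite !ord1 mxE. Qed.

Lemma inner_sym (R : realType) n (G : 'M[R]_n) (v w : 'rV[R]_n) :
  G^T = G -> inner G v w = inner G w v.
Proof.
by move=> GT; rewrite /inner -[v *m G *m _]tr_scalar11 !trmx_mul trmxK GT mulmxA.
Qed.

Lemma innerDl (R : realType) n (G : 'M[R]_n) (v v' w : 'rV[R]_n) :
  inner G (v + v') w = inner G v w + inner G v' w.
Proof. by rewrite /inner !mulmxDl mxE. Qed.

Lemma innerDr (R : realType) n (G : 'M[R]_n) (v w w' : 'rV[R]_n) :
  inner G v (w + w') = inner G v w + inner G v w'.
Proof. by rewrite /inner linearD mulmxDr mxE. Qed.

Lemma innerNl (R : realType) n (G : 'M[R]_n) (v w : 'rV[R]_n) :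
  inner G (- v) w = - inner G v w.
Proof. by rewrite /inner !mulNmx mxE. Qed.

Lemma innerBl (R : realType) n (G : 'M[R]_n) (v v' w : 'rV[R]_n) :
  inner G (v - v') w = inner G v w - inner G v' w.
Proof. by rewrite innerDl innerNl. Qed.

Lemma innerZl (R : realType) n (G : 'M[R]_n) (a : R) (v w : 'rV[R]_n) :
  inner G (a *: v) w = a * inner G v w.
Proof. by rewrite /inner -!scalemxAl mxE. Qed.

Lemma innerZr (R : realType) n (G : 'M[R]_n) (a : R) (v w : 'rV[R]_n) :
  inner G v (a *: w) = a * inner G v w.
Proof. by rewrite /inner linearZ -scalemxAr mxE. Qed.

Lemma inner_rows (R : realType) n k l (G : 'M[R]_n) (V : 'M[R]_(k, n)) (W : 'M[R]_(l,
  n)) i j :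
  inner G (row i V) (row j W) = (V *m G *m W^T) i j.
Proof.
rewrite /inner -!row_mul tr_row !mxE; apply: eq_bigr => a _; rewrite !mxE.
by congr (_ * _); apply: eq_bigr => b _; rewrite !mxE.
Qed.

(** Gram-Schmidt by induction on the dimension: N clears the first row and column of G and leaves
    the Schur complement S, whose value at v is that of G at the nonzero vector w. The rows of B are
    the frame. *)
Lemma orthonormal_frame (R : realType) n (G : 'M[R]_n) : G^T = G ->
  (forall v : 'rV[R]_n, v != 0 -> 0 < inner G v v) ->
  exists B : 'M[R]_n, B *m G *m B^T = 1%:M.
Proof.
elim: n G => [|n IHn] G GT Gpos; first by exists 1%:M; apply/matrixP => -[].
move: G GT Gpos; change n.+1 with (1 + n)%N => G GT Gpos.
pose a := G 0 0; pose b := ursubmx G; pose D := drsubmx G.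
have ulE : ulsubmx G = a%:M.
  by apply/matrixP => i j; rewrite !ord1 !mxE; congr (G _ _); apply: val_inj.
have dlE : dlsubmx G = b^T by rewrite /b trmx_ursub GT.
have DT : D^T = D by rewrite /D trmx_drsub GT.
have GE : G = block_mx a%:M b b^T D by rewrite -ulE -dlE submxK.
have a0 : 0 < a.
  have := Gpos (row 0 1%:M); rewrite inner_rows mul1mx trmx1 mulmx1; apply.
  by apply/eqP => /matrixP /(_ 0 0) /eqP; rewrite !mxE eqxx oner_eq0.
have an0 : a != 0 by rewrite gt_eqF.
pose N : 'M[R]_(1 + n) := block_mx 1%:M 0 (- a^-1 *: b^T) 1%:M.
pose S := D - a^-1 *: (b^T *m b).
have NGN : N *m G *m N^T = block_mx a%:M 0 0 S.
  rewrite GE /N mulmx_block tr_block_mx mulmx_block.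
  rewrite !mul1mx !mul0mx !trmx0 !addr0 !trmx1 !mulmx0 !mulmx1 linearZ /= trmxK.
  rewrite -!scalemxAl -!scalemxAr !mul_mx_scalar !mul_scalar_mx !scalerA.
  rewrite mulNr mulVf// !scaleN1r !addr0 !addNr mul0mx scaler0 add0r.
  by congr block_mx; rewrite /S addrC scaleNr.
have Spos v : v != 0 -> 0 < inner S v v.
  move=> v0; pose w : 'rV[R]_(1 + n) := row_mx 0 v *m N.
  have w0 : w != 0.
    apply: contra v0 => /eqP; rewrite /w /N mul_row_block !mul0mx mulmx1 !add0r => w0.
    by apply/eqP; have := congr1 rsubmx w0; rewrite row_mxKr linear0.
  have -> : inner S v v = inner G w w; last exact: Gpos.
  rewrite /inner /w trmx_mul !mulmxA -(mulmxA _ N) -(mulmxA _ (N *m G)) NGN.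
  by rewrite mul_row_block tr_row_mx mul_row_col !mul0mx !mulmx0 !add0r trmx0 mulmx0
    add0r.
have ST : S^T = S by rewrite /S linearB linearZ /= trmx_mul trmxK DT.
have [B' HB'] := IHn S ST Spos.
pose L : 'M[R]_(1 + n) := block_mx (Num.sqrt a)^-1%:M 0 0 B'.
exists (L *m N).
rewrite trmx_mul !mulmxA -(mulmxA L N) -(mulmxA L (N *m G)) NGN.
rewrite /L mulmx_block tr_block_mx mulmx_block !mul0mx !mulmx0 !addr0 !add0r !trmx0
  !mulmx0.
rewrite !mul0mx HB' tr_scalar_mx -!scalar_mxM.
rewrite [X in X%:M](_ : _ = 1) ?addr0 ?add0r; last first.
  rewrite -{2}(sqr_sqrtr (ltW a0)) expr2 mulrA mulVf ?mul1r ?mulfV// gt_eqF// sqrtr_gt0//.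
by rewrite -scalar_mx_block.
Qed.

Section Frame.
Context (R : realType) (n : nat) (G B : 'M[R]_n).
Hypothesis BG : B *m G *m B^T = 1%:M.

Let BBG : (B^T *m B) *m G = 1%:M.
Proof. by have := mulmx1C BG; rewrite mulmxA. Qed.

Lemma frame_unit : G \in unitmx.
Proof. by have /mulmx1_unit[] := BBG. Qed.

(** This turns contractions with the inverse metric into sums over the frame. *)
Lemma frame_invmx : invmx G = B^T *m B.
Proof. by rewrite -[LHS]mul1mx -BBG mulmxK// frame_unit. Qed.

Lemma frame_unitB : B \in unitmx.
Proof. by have := BG; rewrite -mulmxA => /mulmx1_unit[]. Qed.

End Frame.

(** * Christoffel symbols *)

Section Christoffel.
Context (R : realType) (n : nat) (X : charted_space R n) (g : tensor2 X).

Definition pd_metric c i q : 'M[R]_n := \matrix_(j, l) pd c i (fun r => g c r j l) q.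

(** The connection matrix for row vectors: row j holds the components of nabla_i d_j. *)
Definition christoffel_mx c i q : 'M[R]_n := \matrix_(j, k) christoffel g c i j k q.

(** Christoffel symbols of the first kind: the entry (j, l) is g(nabla_i d_j, d_l). *)
Definition christoffel1_mx c i q : 'M[R]_n :=
  \matrix_(j, l) (2^-1 * (pd_metric c i q j l + pd_metric c j q i l - pd_metric c l q i
    j)).

Lemma christoffel_mxE c i q : christoffel_mx c i q = christoffel1_mx c i q *m (invmx (g
  c q))^T.
Proof.
apply/matrixP => j k; rewrite [LHS]mxE [RHS]mxE /christoffel big_distrr.
apply: eq_bigr => l _ /=.
have -> : christoffel1_mx c i q j l = 2^-1 * (pd c i (fun r => g c r j l) q
    + pd c j (fun r => g c r i l) q - pd c l (fun r => g c r i j) q).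
  by rewrite mxE; congr (_ * (_ + _ - _)); exact: mxE.
by rewrite [_^T l k]mxE mulrCA mulrC.
Qed.

Definition riemann_mx c i j q : 'M[R]_n := \matrix_(k, l) riemann g c i j k l q.

Lemma curvatureE c q (v w z : 'rV[R]_n) :
  curvature g c q v w z = z *m \sum_i \sum_j (v 0 i * w 0 j) *: riemann_mx c i j q.
Proof.
apply/rowP => l; rewrite !mxE.
under [RHS]eq_bigr do rewrite summxE big_distrr /=.
rewrite [RHS]exchange_big; apply: eq_bigr => i _ /=.
under [RHS]eq_bigr do rewrite summxE big_distrr /=.
rewrite [RHS]exchange_big; apply: eq_bigr => j _ /=.
by apply: eq_bigr => k _; rewrite !mxE mulrA (mulrC (z 0 k)).
Qed.

Hypotheses (hX : smooth_manifold X) (hg : riemannian_metric g).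

Lemma metric_frame c q : dom c q -> exists B : 'M[R]_n, B *m g c q *m B^T = 1%:M.
Proof.
by move=> cq; apply: orthonormal_frame; [exact: (metric_sym hg)|exact: (metric_pos hg)].
Qed.

Lemma metric_unit c q : dom c q -> g c q \in unitmx.
Proof. by move=> /metric_frame[B]; exact: frame_unit. Qed.

Lemma pd_metric_sym c i q : dom c q -> (pd_metric c i q)^T = pd_metric c i q.
Proof.
move=> cq; apply/matrixP => j l; rewrite !mxE; apply: (pd_near hX) => //.
near=> r; have cr : dom c r by near: r; exact: near_dom.
by rewrite -[in LHS](metric_sym hg cr) mxE.
Unshelve. all: by end_near. Qed.

Lemma christoffel_mx_metric c i q : dom c q -> christoffel_mx c i q *m g c q =
  christoffel1_mx c i q.
Proof.
move=> cq; rewrite christoffel_mxE trmx_inv (metric_sym hg cq) mulmxKV//; exact: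
  metric_unit.
Qed.

(** Compatibility of the connection with the metric; later on, derivatives of a metric are always
    written as this sum. *)
Lemma christoffel1_mxD c i q : dom c q -> christoffel1_mx c i q + (christoffel1_mx c i
  q)^T = pd_metric c i q.
Proof.
move=> cq; apply/matrixP => j l.
have S := congr1 (fun A : 'M[R]_n => A j l) (pd_metric_sym i cq).
rewrite /= [X in X = _]mxE in S; rewrite [LHS]mxE [X in X + _]mxE [X in _ + X]mxE [X in
  _ + X]mxE.
by move: (pd_metric c) S => D ->; field.
Qed.

Lemma christoffel_mx_sym c i j k q : dom c q -> christoffel_mx c i q j k =
  christoffel_mx c j q i k.
Proof.
move=> cq; rewrite !mxE /christoffel; congr (_ * _); apply: eq_bigr => l _.
congr (_ * _); have /matrixP Sl := pd_metric_sym l cq.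
by move: (Sl i j); rewrite !mxE => ->; rewrite [_ + pd c j _ _]addrC.
Qed.

Lemma metric_Ck c k i j : Ck c k (dom c) (fun r => g c r i j).
Proof. by have := @metric_smooth _ _ _ _ hg c i j c k; rewrite setIid. Qed.

Lemma det_Ck c k m (F : X -> 'M[R]_m) :
  (forall i j, Ck c k (dom c) (fun r => F r i j)) -> Ck c k (dom c) (fun r => \det (F r)).
Proof.
move=> CF; have oc := dom_open hX c; rewrite /determinant.
apply: (Ck_sum hX) => // s _; apply: (CkM hX) => //; first exact: Ck_cst.
by apply: (Ck_prod hX).
Qed.

Lemma invmx_metric_Ck c k i j : Ck c k (dom c) (fun r => invmx (g c r) i j).
Proof.
have oc := dom_open hX c.
(* Cramer's formula exhibits the inverse as a rational function of the entries. *)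
apply: (@Ck_ext _ _ _ hX _ _ oc _ _ (fun r => (\det (g c r))^-1 * cofactor (g c r) j
  i)) => //.
  by move=> r cr; rewrite /invmx (metric_unit cr) !mxE.
apply: (CkM hX) => //.
  apply: (CkV hX) => //; last by apply: det_Ck => *; exact: metric_Ck.
  by move=> r cr; have := metric_unit cr; rewrite unitmxE unitfE.
rewrite /cofactor; apply: (CkM hX) => //; first exact: Ck_cst.
apply: det_Ck => a b.
apply: (@Ck_ext _ _ _ hX _ _ oc _ _ (fun r => g c r (lift j a) (lift i b))) => //.
  by move=> r _; rewrite !mxE.
exact: metric_Ck.
Qed.

Lemma christoffel_Ck c k i j l : Ck c k (dom c) (christoffel g c i j l).
Proof.
have oc := dom_open hX c.
apply: (CkM hX) => //; first exact: Ck_cst.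
apply: (Ck_sum hX) => // m _; apply: (CkM hX) => //; first exact: invmx_metric_Ck.
by apply: (CkB hX) => //; first apply: (CkD hX) => //; apply: Ck_pd; exact: metric_Ck.
Qed.

End Christoffel.

(** * Partial derivatives of matrix-valued functions *)

Section MatrixPd.
Context (R : realType) (n : nat) (X : charted_space R n) (hX : smooth_manifold X).
Variables (c : chart X) (q : X).
Hypothesis cq : dom c q.

Definition is_pdmx i k l (F : X -> 'M[R]_(k, l)) (dF : 'M[R]_(k, l)) :=
  forall a b, is_pd c i q (fun r => F r a b) (dF a b).

Lemma is_pdmx_mul i k l m (F : X -> 'M[R]_(k, l)) (G : X -> 'M[R]_(l, m)) dF dG :
  is_pdmx i F dF -> is_pdmx i G dG ->
  is_pdmx i (fun r => F r *m G r) (dF *m G q + F q *m dG).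
Proof.
move=> hF hG a b; apply: is_pd_eq.
  apply: (@is_pd_near _ _ _ hX _ _ _ (fun r => \sum_j F r a j * G r j b)) => //.
    by near=> r; rewrite mxE.
  by apply: (is_pd_sum hX) => // j _; apply: (is_pdM hX).
by rewrite !mxE -big_split.
Unshelve. all: by end_near. Qed.

Lemma is_pdmx_tr i k l (F : X -> 'M[R]_(k, l)) dF :
  is_pdmx i F dF -> is_pdmx i (fun r => (F r)^T) dF^T.
Proof.
move=> hF a b; rewrite mxE.
apply: (@is_pd_near _ _ _ hX _ _ _ (fun r => F r b a)) => //.
by near=> r; rewrite mxE.
Unshelve. all: by end_near. Qed.

Lemma is_pdmxD i k l (F G : X -> 'M[R]_(k, l)) dF dG :
  is_pdmx i F dF -> is_pdmx i G dG -> is_pdmx i (fun r => F r + G r) (dF + dG).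
Proof.
move=> hF hG a b; rewrite mxE.
apply: (@is_pd_near _ _ _ hX _ _ _ (fun r => F r a b + G r a b)) => //.
  by near=> r; rewrite mxE.
by apply: (is_pdD hX).
Unshelve. all: by end_near. Qed.

Lemma is_pdmx_sum i k l (I : Type) (s : seq I) (F : I -> X -> 'M[R]_(k, l)) dF :
  (forall j, is_pdmx i (F j) (dF j)) ->
  is_pdmx i (fun r => \sum_(j <- s) F j r) (\sum_(j <- s) dF j).
Proof.
move=> hF a b; rewrite summxE.
apply: (@is_pd_near _ _ _ hX _ _ _ (fun r => \sum_(j <- s) F j r a b)) => //.
  by near=> r; rewrite summxE.
by apply: (is_pd_sum hX) => // j _; apply: hF.
Unshelve. all: by end_near. Qed.

Lemma is_pdmxZ i k l (a : X -> R) (F : X -> 'M[R]_(k, l)) da dF :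
  is_pd c i q a da -> is_pdmx i F dF ->
  is_pdmx i (fun r => a r *: F r) (da *: F q + a q *: dF).
Proof.
move=> ha hF b d; rewrite !mxE.
apply: (@is_pd_near _ _ _ hX _ _ _ (fun r => a r * F r b d)) => //.
  by near=> r; rewrite mxE.
by apply: (is_pdM hX).
Unshelve. all: by end_near. Qed.

Lemma is_pdmx_near i k l (F G : X -> 'M[R]_(k, l)) dF :
  (\forall r \near q, F r = G r) -> is_pdmx i F dF -> is_pdmx i G dF.
Proof.
move=> FG hF a b; apply: (is_pd_near hX) (hF a b) => //.
by near=> r; congr (fun_of_matrix _ a b); near: r.
Unshelve. all: by end_near. Qed.

Lemma is_pdmx_uniq i k l (F : X -> 'M[R]_(k, l)) dF dF' :
  is_pdmx i F dF -> is_pdmx i F dF' -> dF = dF'.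
Proof.
by move=> h h'; apply/matrixP => a b; rewrite -(is_pdE (h a b)) -(is_pdE (h' a b)).
Qed.

End MatrixPd.

(** * Curvature and connections along maps *)

(** Here Gi, Gj are connection matrices, Ki, Kj the lowered ones, Pij and Pji the derivatives of Gj
    and Gi, and Ki + Ki^T takes the place of the derivative of the metric G. *)
Lemma riem_lower_algebra (R : comRingType) n (Pij Pji Gi Gj Ki Kj G : 'M[R]_n) :
  Gi *m G = Ki -> Gj *m G = Kj ->
  (Pij - Pji + (Gj *m Gi - Gi *m Gj)) *m G =
  Pij *m G + Gj *m (Ki + Ki^T) - (Pji *m G + Gi *m (Kj + Kj^T))
    - Gj *m Ki^T + Gi *m Kj^T.
Proof.
move=> <- <-; rewrite !mulmxDr !mulmxDl !mulNmx !mulmxA.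
move: (_ *m G) (_ *m G) (_ *m G) (_ *m G) (Gj *m _^T) (Gi *m _^T) => a b d e x y.
by apply/matrixP => k l; rewrite !mxE; ring.
Qed.

Section RiemannMatrix.
Context (R : realType) (n : nat) (X : charted_space R n) (g : tensor2 X).
Hypotheses (hX : smooth_manifold X) (hg : riemannian_metric g).

Definition pd_christoffel c i j q : 'M[R]_n := \matrix_(k, l) pd c i (christoffel g c j
  k l) q.

(** Connection matrices act on rows from the right, hence the order of the factors. *)
Lemma riemann_mxE c i j q : riemann_mx g c i j q =
  pd_christoffel c i j q - pd_christoffel c j i q
  + (christoffel_mx g c j q *m christoffel_mx g c i q - christoffel_mx g c i q *m
    christoffel_mx g c j q).
Proof.
apply/matrixP => k l; rewrite !mxE /riemann -sumrB; congr (_ + _).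
by apply: eq_bigr => a _; rewrite !mxE.
Qed.

Lemma is_pd_christoffel c i j q : dom c q -> is_pdmx c q i (christoffel_mx g c j)
  (pd_christoffel c i j q).
Proof.
move=> cq a b; rewrite mxE.
apply: (@is_pd_near _ _ _ hX _ _ _ (christoffel g c j a b)) => //.
  by near=> r; rewrite mxE.
exact: (Ck_is_pd _ (christoffel_Ck hX hg c 1 j a b) cq).
Unshelve. all: by end_near. Qed.

Lemma is_pd_metric c i q : dom c q ->
  is_pdmx c q i (g c) (christoffel1_mx g c i q + (christoffel1_mx g c i q)^T).
Proof.
move=> cq a b; rewrite christoffel1_mxD// mxE.
exact: (Ck_is_pd _ (metric_Ck hg c 1 a b) cq).
Qed.

(** The product rule on K_j = Gamma_j g moves the derivatives onto the lowered symbols, so the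
    inverse metric appears undifferentiated. For a hypersurface the two quadratic terms become inner
    products of tangential parts of second derivatives. *)
Lemma riemann_mx_lower c i j q (dKi dKj : 'M[R]_n) : dom c q ->
  is_pdmx c q i (christoffel1_mx g c j) dKj -> is_pdmx c q j (christoffel1_mx g c i)
    dKi ->
  riemann_mx g c i j q *m g c q = dKj - dKi
    - christoffel1_mx g c j q *m invmx (g c q) *m (christoffel1_mx g c i q)^T
    + christoffel1_mx g c i q *m invmx (g c q) *m (christoffel1_mx g c j q)^T.
Proof.
move=> cq hKj hKi.
have E a b dK : is_pdmx c q a (christoffel1_mx g c b) dK ->
    dK = pd_christoffel c a b q *m g c q
      + christoffel_mx g c b q *m (christoffel1_mx g c a q + (christoffel1_mx g c a q)^T).
  move=> h; apply: (is_pdmx_uniq (c := c) (q := q) (i := a) h).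
  apply: (is_pdmx_near hX cq) (is_pdmx_mul hX cq (is_pd_christoffel a b cq)
    (is_pd_metric a cq)).
  near=> r; rewrite christoffel_mx_metric//; near: r; exact: near_dom.
have T a : christoffel1_mx g c a q *m invmx (g c q) = christoffel_mx g c a q.
  by rewrite -(christoffel_mx_metric hg)// mulmxK// (metric_unit hg).
have M a : christoffel_mx g c a q *m g c q = christoffel1_mx g c a q by exact:
  christoffel_mx_metric.
rewrite (E _ _ _ hKj) (E _ _ _ hKi) !T riemann_mxE.
exact: riem_lower_algebra.
Unshelve. all: by end_near. Qed.

End RiemannMatrix.

(** * Fields along a map and the pulled-back connection *)

Section Along.
Context (R : realType) (n m : nat) (X : charted_space R n) (Y : charted_space R m).
Hypotheses (hX : smooth_manifold X) (hY : smooth_manifold Y).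
Variables (gY : tensor2 Y) (u : X -> Y) (c : chart X) (c' : chart Y) (O : set X).
Hypotheses (hgY : riemannian_metric gY) (cu : continuous u).
Hypotheses (oO : open O) (Oc : O `<=` dom c) (uO : forall q, O q -> dom c' (u q)).
Hypothesis Cu : forall k a, Ck c k O (fun r => coord c' (u r) 0 a).
Implicit Types (V W : X -> 'rV[R]_m) (i j : 'I_n) (q : X).

Definition smooth_along V := forall k a, Ck c k O (fun r => V r 0 a).

Definition pd_row i V q : 'rV[R]_m := \row_a pd c i (fun r => V r 0 a) q.

Definition pd_row2 i j V q : 'rV[R]_m :=
  \row_a pd c i (pd c j (fun r => V r 0 a)) q.

(** The connection matrix of u^*TY in the direction d_i. *)
Definition conn i q : 'M[R]_m := \sum_e dmap u c c' q i e *: christoffel_mx gY c' e (u q).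

Definition nabla i V q : 'rV[R]_m := pd_row i V q + V q *m conn i q.

Definition tangent i q : 'rV[R]_m := row i (dmap u c c' q).

Lemma dom_openY : open (dom c'). Proof. exact: (dom_open hY). Qed.

Lemma is_pd_row i V q : smooth_along V -> O q -> is_pdmx c q i V (pd_row i V q).
Proof.
by move=> CV Oq a b; rewrite ord1 mxE; exact: (Ck_is_pd _ (CV 1%N b) Oq).
Qed.

Lemma is_pd_chain_mx i q k l (F : Y -> 'M[R]_(k, l)) (dF : 'I_m -> 'M[R]_(k, l)) : O q ->
  (forall a b, Ck c' 1 (dom c') (fun y => F y a b)) ->
  (forall e, is_pdmx c' (u q) e F (dF e)) ->
  is_pdmx c q i (fun r => F (u r)) (\sum_e dmap u c c' q i e *: dF e).
Proof.
move=> Oq CF hF a b.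
apply: is_pd_eq.
  apply: (Ck_chain1 hX hY oO Oc dom_openY (fun r h => h) uO i Oq (Cu 1) (CF a b)).
rewrite summxE; apply: eq_bigr => e _; rewrite !mxE mulrC; congr (_ * _).
by rewrite (is_pdE (hF e a b)).
Qed.

Lemma is_pd_metric_along i q : O q -> is_pdmx c q i (fun r => gY c' (u r))
  (conn i q *m gY c' (u q) + (conn i q *m gY c' (u q))^T).
Proof.
move=> Oq; have cuq := uO Oq.
have -> : conn i q *m gY c' (u q) + (conn i q *m gY c' (u q))^T =
  \sum_e dmap u c c' q i e *: (christoffel1_mx gY c' e (u q) + (christoffel1_mx gY c' e
    (u q))^T).
  rewrite /conn mulmx_suml linear_sum -big_split; apply: eq_bigr => e _ /=.
  by rewrite -scalemxAl christoffel_mx_metric// linearZ scalerDr.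
apply: is_pd_chain_mx => // [a b|e]; first exact: metric_Ck.
exact: is_pd_metric.
Qed.

(** The derivative of the metric along u is a matrix plus its transpose; each of the two covariant
    derivatives absorbs one of them. *)
Lemma nabla_metric i V W q : smooth_along V -> smooth_along W -> O q ->
  is_pd c i q (fun r => inner (gY c' (u r)) (V r) (W r))
    (inner (gY c' (u q)) (nabla i V q) (W q) + inner (gY c' (u q)) (V q) (nabla i W q)).
Proof.
move=> CV CW Oq; have cq := Oc Oq.
have H := is_pdmx_mul hX cq (is_pdmx_mul hX cq (is_pd_row i CV Oq) (is_pd_metric_along
  i Oq))
  (is_pdmx_tr hX cq (is_pd_row i CW Oq)).
apply: is_pd_eq; first exact: (H 0 0).
have add00 (x y : 'M[R]_1) : x 0 0 + y 0 0 = (x + y) 0 0 by rewrite mxE.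
rewrite /inner add00; congr (fun_of_matrix _ 0 0); rewrite /nabla.
rewrite (trmx_mul _ (gY _ _)) (metric_sym hgY)//; last exact: uO.
rewrite [in RHS]linearD /= trmx_mul !mulmxDl !mulmxDr !mulmxDl !mulmxA.
by rewrite -!addrA; congr (_ + (_ + _)); rewrite addrC.
Qed.

Lemma smooth_tangent i : smooth_along (tangent i).
Proof.
move=> k a; apply: (@Ck_ext _ _ _ hX _ _ oO Oc _ (pd c i (fun r => coord c' (u r) 0 a))).
  by move=> r _; rewrite !mxE.
apply: Ck_pd; exact: Cu.
Qed.

Lemma conn_Ck i k a b : Ck c k O (fun r => conn i r a b).
Proof.
apply: (@Ck_ext _ _ _ hX _ _ oO Oc _
  (fun r => \sum_e dmap u c c' r i e * christoffel_mx gY c' e (u r) a b)).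
  by move=> r _; rewrite summxE; apply: eq_bigr => e _; rewrite [in RHS]mxE.
apply: (Ck_sum hX) => // e _; apply: (CkM hX) => //.
  by have := smooth_tangent i k e; apply: (Ck_ext hX) => // r _; rewrite !mxE.
apply: (@Ck_ext _ _ _ hX _ _ oO Oc _ (fun r => christoffel gY c' e a b (u r))).
  by move=> r _; rewrite mxE.
apply: (Ck_comp hX hY oO Oc dom_openY (fun r h => h) uO cu) => //.
exact: christoffel_Ck.
Qed.

Lemma smooth_nabla i V : smooth_along V -> smooth_along (nabla i V).
Proof.
move=> CV k a; apply: (@Ck_ext _ _ _ hX _ _ oO Oc _
  (fun r => pd c i (fun r => V r 0 a) r + \sum_b V r 0 b * conn i r b a)).
  by move=> r _; rewrite !mxE.
apply: (CkD hX) => //; first exact: (Ck_pd _ (CV k.+1 a)).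
apply: (Ck_sum hX) => // b _; apply: (CkM hX) => //; exact: conn_Ck.
Qed.

(** Absence of torsion: second partial derivatives of u commute, and the Christoffel symbols of Y
    are symmetric. *)
Lemma nabla_tangentC i j q : O q -> nabla i (tangent j) q = nabla j (tangent i) q.
Proof.
move=> Oq; apply/rowP => k; rewrite !mxE; congr (_ + _).
  have E a b : pd c a (fun r => tangent b r 0 k) q =
      pd c a (pd c b (fun r => coord c' (u r) 0 k)) q.
    apply: (pd_near hX); first exact: Oc.
    by near=> r; rewrite !mxE.
  by rewrite !E; exact: (pdC hX oO Oc i j (Cu 2%N k) Oq).
have S a b : \sum_j0 tangent a q 0 j0 * conn b q j0 k =
    \sum_j0 \sum_e dmap u c c' q a j0 * dmap u c c' q b e * christoffel_mx gY c' e (u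
      q) j0 k.
  apply: eq_bigr => d _; rewrite summxE big_distrr; apply: eq_bigr => e _ /=.
  by rewrite !mxE mulrA.
rewrite !S exchange_big; apply: eq_bigr => d _; apply: eq_bigr => e _ /=.
rewrite (christoffel_mx_sym hY hgY _ _ _ (uO Oq)); congr (_ * _); exact: mulrC.
Unshelve. all: by end_near. Qed.

Lemma is_pd_conn i j q : O q -> is_pdmx c q i (conn j)
  (\sum_e (pd c i (fun r => dmap u c c' r j e) q *: christoffel_mx gY c' e (u q) +
     dmap u c c' q j e *: \sum_f dmap u c c' q i f *: pd_christoffel gY c' f e (u q))).
Proof.
move=> Oq; have cq := Oc Oq.
apply: (is_pdmx_sum hX cq) => e; apply: (is_pdmxZ hX cq).
  have := smooth_tangent j 1 e => Ce.
  apply: (Ck_is_pd (k := 0) i _ Oq).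
  by apply: (Ck_ext hX) Ce => // r _; rewrite mxE.
apply: is_pd_chain_mx => // [a b|f]; last exact/is_pd_christoffel/uO.
apply: (Ck_ext hY dom_openY _ _ (christoffel_Ck hY hgY c' 1 e a b)) => //.
by move=> r _; rewrite mxE.
Qed.

(** V need not be the restriction of a field on Y, so the identity is checked on connection
    matrices: the curvature of [conn] is the pull-back of that of Y. *)
Lemma nabla_comm i j V q : smooth_along V -> O q ->
  nabla i (nabla j V) q - nabla j (nabla i V) q =
  curvature gY c' (u q) (tangent i q) (tangent j q) (V q).
Proof.
move=> CV Oq; have cq := Oc Oq.
pose pp a b := pd_row2 a b V q.
have ppC a b : pp a b = pp b a.
  by apply/rowP => k; rewrite [LHS]mxE [RHS]mxE; exact: (pdC hX oO Oc a b (CV 2%N k) Oq).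
have hpp a b : is_pdmx c q a (pd_row b V) (pp a b).
  move=> e k; rewrite ord1 mxE.
  apply: (@is_pd_near _ _ _ hX _ _ _ (pd c b (fun r => V r 0 k))) => //.
    by near=> r; rewrite mxE.
  exact: (Ck_is_pd _ (Ck_pd _ (CV 2%N k)) Oq).
pose dc a b := \sum_e (pd c a (fun r => dmap u c c' r b e) q *: christoffel_mx gY c' e
  (u q) +
     dmap u c c' q b e *: \sum_f dmap u c c' q a f *: pd_christoffel gY c' f e (u q)).
have hn a b : pd_row a (nabla b V) q =
    pp a b + (pd_row a V q *m conn b q + V q *m dc a b).
  apply: (is_pdmx_uniq (is_pd_row a (smooth_nabla b CV) Oq)).
  apply: (is_pdmxD hX cq (hpp a b)).
  apply: (is_pdmx_mul hX cq (is_pd_row a CV Oq)); exact: is_pd_conn.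
(* The terms with derivatives of V are symmetric in a and b together, so the commutator only keeps
   the factor of V q. *)
have E a b : nabla a (nabla b V) q = pp a b + pd_row a V q *m conn b q
    + pd_row b V q *m conn a q + V q *m (dc a b + conn b q *m conn a q).
  rewrite {1}/nabla hn {1}/nabla mulmxDl mulmxDr mulmxA.
  by apply/rowP => k; rewrite !mxE; ring.
rewrite !E (ppC i j) curvatureE.
have -> : \sum_a \sum_b (tangent i q 0 a * tangent j q 0 b) *: riemann_mx gY c' a b (u
  q) =
   (dc i j + conn j q *m conn i q) - (dc j i + conn i q *m conn j q).
  have pS a b e : pd c a (fun r => dmap u c c' r b e) q =
      pd c b (fun r => dmap u c c' r a e) q.
    have P x y : pd c x (fun r => dmap u c c' r y e) q =
        pd c x (pd c y (fun r => coord c' (u r) 0 e)) q.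
      by apply: (pd_near hX) => //; near=> r; rewrite mxE.
    by rewrite !P; exact: (pdC hX oO Oc a b (Cu 2%N e) Oq).
  (* In the derivative of [conn], [d1] collects the second derivatives of u, symmetric and hence
     cancelling, and [d2] the derivatives of the Christoffel symbols of Y. *)
  pose d1 a b := \sum_e pd c a (fun r => dmap u c c' r b e) q *: christoffel_mx gY c' e
    (u q).
  pose d2 a b := \sum_f \sum_e (dmap u c c' q a f * dmap u c c' q b e) *:
    pd_christoffel gY c' f e (u q).
  have dcE a b : dc a b = d1 a b + d2 a b.
    rewrite /dc big_split; congr (_ + _); rewrite /d2 exchange_big.
    apply: eq_bigr => e _ /=; rewrite scaler_sumr; apply: eq_bigr => f _.
    by rewrite scalerA mulrC.
  have d1C a b : d1 a b = d1 b a by apply: eq_bigr => e _; rewrite pS.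
  have cc a b : conn b q *m conn a q = \sum_f \sum_e (dmap u c c' q a f * dmap u c c' q
    b e) *:
      (christoffel_mx gY c' e (u q) *m christoffel_mx gY c' f (u q)).
    rewrite exchange_big /conn mulmx_suml; apply: eq_bigr => e _ /=.
    rewrite mulmx_sumr; apply: eq_bigr => f _.
    by rewrite -scalemxAl -scalemxAr scalerA mulrC.
  have -> : dc i j + conn j q *m conn i q - (dc j i + conn i q *m conn j q) =
      (d2 i j - d2 j i) + (conn j q *m conn i q - conn i q *m conn j q).
    rewrite !dcE (d1C j i); set x1 := conn j q *m _; set x2 := conn i q *m _.
    by apply/matrixP => k l; rewrite !mxE; ring.
  pose s a b := dmap u c c' q i a * dmap u c c' q j b.
  transitivity ((\sum_a \sum_b s a b *: pd_christoffel gY c' a b (u q) -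
      \sum_a \sum_b s a b *: pd_christoffel gY c' b a (u q)) +
    (\sum_a \sum_b s a b *: (christoffel_mx gY c' b (u q) *m christoffel_mx gY c' a (u
      q)) -
     \sum_a \sum_b s a b *: (christoffel_mx gY c' a (u q) *m christoffel_mx gY c' b (u
       q)))).
    rewrite -!sumrB -big_split; apply: eq_bigr => a _ /=.
    rewrite -!sumrB -big_split; apply: eq_bigr => b _ /=.
    by rewrite riemann_mxE !scalerDr !scalerN ![tangent _ _ _ _]mxE.
  have cong4 (V4 : zmodType) (a a' b b' d d' e e' : V4) : a = a' -> b = b' -> d = d' ->
    e = e' ->
    a - b + (d - e) = a' - b' + (d' - e') by move=> -> -> -> ->.
  apply: cong4.
  - by [].
  - rewrite /d2 [LHS]exchange_big; apply: eq_bigr => a _; apply: eq_bigr => b _ /=.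
    by rewrite /s [X in X *: _]mulrC.
  - exact/esym/cc.
  - rewrite [RHS](cc j i) [LHS]exchange_big; apply: eq_bigr => a _; apply: eq_bigr => b
    _ /=.
    by rewrite /s [X in X *: _]mulrC.
have alg (V4 : zmodType) (p a b x y : V4) : p + a + b + x - (p + b + a + y) = x - y.
  by rewrite (addrAC p b) opprD addrACA subrr add0r.
by rewrite [RHS]mulmxBr; exact: alg.
Unshelve. all: by end_near. Qed.

End Along.

(** * Christoffel symbols of a warped product *)

Lemma derive1_sqrM (R : realType) (f : R -> R) (t a : R) : derivable f t 1 ->
  derive1 (fun s => f s ^+ 2 * a) t = 2 * f t * derive1 f t * a.
Proof.
move=> df; have H := is_deriveM (derivableP df) (derivableP df).
have -> : (fun s => f s ^+ 2 * a) = (fun s => (f * f) s * a).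
  by apply/funext => s; rewrite expr2.
have [dff E] := H.
rewrite derive1Mr// 2!derive1E E; congr (_ * _).
by rewrite -[_ *: _]/(f t * _) mulr_natl mulrnAl mulr2n.
Qed.

Section WarpedChristoffel.
Context (R : realType) (n : nat) (I : set R) (M : charted_space R n).
Hypotheses (hM : smooth_manifold M) (I_open : open I).
Context (f : R -> R) (gM : tensor2 M).
Hypotheses (hf : smooth_fun_on I f) (f_gt0 : forall t, I t -> 0 < f t).
Hypothesis hgM : riemannian_metric gM.
Local Notation P := (interval_prod I M).
Local Notation gP := (warped_metric (I := I) f gM).
Implicit Types (c : chart M) (z : P).

Lemma pd_warped_l c z : dom c z.2 -> pd_metric (X := P) gP c (lshift n 0) z =
  block_mx 0 0 0 ((2 * f (piI z) * derive1 f (piI z)) *: gM c z.2).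
Proof.
move=> cz; apply/matrixP => i j; rewrite mxE.
rewrite (pd_prod_l hM I_open (fun t m => block_mx 1%:M 0 0 (f t ^+ 2 *: gM c m) i j)) //.
have cst0 (F : R -> R) (a : R) : (forall t, F t = a) -> derive1 F (piI z) = 0.
  by move=> Fa; rewrite (_ : F = cst a) ?derive1_cst//; apply/funext.
case: (split_ordP i) => i' ->; case: (split_ordP j) => j' ->.
- by rewrite block_mxEul mxE; apply: (cst0 _ ((i' == j')%:R)) => t; rewrite block_mxEul
  mxE.
- by rewrite block_mxEur mxE; apply: (cst0 _ 0) => t; rewrite block_mxEur mxE.
- by rewrite block_mxEdl mxE; apply: (cst0 _ 0) => t; rewrite block_mxEdl mxE.
- rewrite block_mxEdr mxE.
  rewrite -derive1_sqrM; last exact: (hf (k := 0%N) (piI_in z)).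
  by congr (derive1 _ _); apply/funext => t; rewrite block_mxEdr mxE.
Qed.

Lemma pd_warped_r c a z : dom c z.2 -> pd_metric (X := P) gP c (rshift 1 a) z =
  block_mx 0 0 0 (f (piI z) ^+ 2 *: pd_metric gM c a z.2).
Proof.
move=> cz; apply/matrixP => i j; rewrite mxE.
rewrite (pd_prod_r hM a (fun t m => block_mx 1%:M 0 0 (f t ^+ 2 *: gM c m) i j)) //.
have cst0 (F : M -> R) (b : R) : (forall t, F t = b) -> pd c a F z.2 = 0.
  move=> Fb; apply: is_pdE; rewrite (_ : F = (fun=> b)); first exact: is_pd_cst.
  exact/funext.
case: (split_ordP i) => i' ->; case: (split_ordP j) => j' ->.
- by rewrite block_mxEul mxE; apply: (cst0 _ ((i' == j')%:R)) => t; rewrite block_mxEul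
  mxE.
- by rewrite block_mxEur mxE; apply: (cst0 _ 0) => t; rewrite block_mxEur mxE.
- by rewrite block_mxEdl mxE; apply: (cst0 _ 0) => t; rewrite block_mxEdl mxE.
- rewrite block_mxEdr !mxE.
  rewrite (_ : (fun m => _) = fun m => f (piI z) ^+ 2 * gM c m i' j'); last first.
    by apply/funext => m; rewrite block_mxEdr mxE.
  apply: is_pdE; apply: is_pd_eq.
    apply: (is_pdM hM cz); first exact: is_pd_cst.
    exact: (Ck_is_pd a (metric_Ck hgM c 1 i' j') cz).
  by rewrite mul0r add0r.
Qed.

Let f0 z : f (piI z) != 0. Proof. by rewrite gt_eqF// f_gt0//; exact: piI_in. Qed.

Lemma warped_unit c z : dom c z.2 -> gP c z \in unitmx.
Proof.
move=> cz; rewrite unitmxE det_ublock det1 mul1r detZ unitfE mulf_neq0//.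
  by rewrite !expf_neq0.
by have := metric_unit hgM cz; rewrite unitmxE unitfE.
Qed.

Lemma warped_sym c z : dom c z.2 -> (gP c z)^T = gP c z.
Proof.
move=> cz; rewrite /warped_metric tr_block_mx trmx1 !trmx0.
by rewrite linearZ /= (metric_sym hgM).
Qed.

Let mx0E m k (a : 'I_m) (b : 'I_k) : (0 : 'M[R]_(m, k)) a b = 0.
Proof. exact: mxE. Qed.

Let mxZE m k (x : R) (A : 'M[R]_(m, k)) a b : (x *: A) a b = x * A a b.
Proof. exact: mxE. Qed.

Let mxTE m k (A : 'M[R]_(m, k)) a b : A^T a b = A b a.
Proof. exact: mxE. Qed.

Let rowE' m k (A : 'M[R]_(m, k)) i a b : row i A a b = A i b.
Proof. exact: mxE. Qed.

Let blockE := (@block_mxEul, @block_mxEur, @block_mxEdl, @block_mxEdr).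

Lemma christoffel1_warped_l c z : dom c z.2 -> christoffel1_mx (X := P) gP c (lshift n
  0) z =
  block_mx 0 0 0 ((f (piI z) * derive1 f (piI z)) *: gM c z.2).
Proof.
move=> cz; apply/matrixP => i j; rewrite [LHS]mxE.
move: (pd_warped_l cz) (fun a => pd_warped_r a cz).
move: (pd_metric (X := P) gP c) (pd_metric gM c) => D DM El Er.
case: (split_ordP i) => i' ->; case: (split_ordP j) => j' ->.
- by rewrite (ord1 i') (ord1 j') El !blockE mx0E; field.
- by rewrite (ord1 i') El Er !blockE !mx0E; field.
- by rewrite (ord1 j') El Er !blockE !mx0E; field.
- by rewrite El !Er !blockE !mx0E !mxZE; field.
Qed.

Lemma christoffel1_warped_r c a z : dom c z.2 -> christoffel1_mx (X := P) gP c (rshift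
  1 a) z =
  block_mx 0 ((f (piI z) * derive1 f (piI z)) *: row a (gM c z.2))
    (- (f (piI z) * derive1 f (piI z)) *: (row a (gM c z.2))^T)
    (f (piI z) ^+ 2 *: christoffel1_mx gM c a z.2).
Proof.
move=> cz; apply/matrixP => i j; rewrite [LHS]mxE.
have K b l : christoffel1_mx gM c a z.2 b l = 2^-1 * (pd_metric gM c a z.2 b l +
    pd_metric gM c b z.2 a l - pd_metric gM c l z.2 a b) by rewrite mxE.
move: (pd_warped_l cz) (fun a => pd_warped_r a cz) K.
move: (christoffel1_mx gM c a z.2) (pd_metric (X := P) gP c) (pd_metric gM c) => KM D
  DM El Er K.
case: (split_ordP i) => i' ->; case: (split_ordP j) => j' ->.
- by rewrite (ord1 i') (ord1 j') El Er !blockE !mx0E; field.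
- by rewrite (ord1 i') El !Er !blockE !mx0E !mxZE rowE'; field.
- by rewrite (ord1 j') El !Er !blockE !mx0E !mxZE mxTE rowE'; field.
- by rewrite !Er !blockE !mxZE K; field.
Qed.

Lemma christoffel_warped_l c z : dom c z.2 -> christoffel_mx (X := P) gP c (lshift n 0)
  z =
  block_mx 0 0 0 (derive1 f (piI z) / f (piI z))%:M.
Proof.
move=> cz; rewrite christoffel_mxE trmx_inv warped_sym// christoffel1_warped_l//.
(* The claimed matrix is multiplied by the metric, which avoids inverting a block matrix. *)
apply: (canLR (mulmxK (warped_unit cz))).
rewrite /warped_metric mulmx_block !mul0mx !mulmx0 !addr0 add0r mul_scalar_mx scalerA.
by congr (block_mx _ _ _ (_ *: _)); field; exact: f0.
Qed.

(** The rows encode nabla_a d_t = (f'/f) d_a and nabla_a d_b = nabla^M_a d_b - f f' gM_ab d_t. *)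
Lemma christoffel_warped_r c a z : dom c z.2 -> christoffel_mx (X := P) gP c (rshift 1
  a) z =
  block_mx 0 ((derive1 f (piI z) / f (piI z)) *: delta_mx 0 a)
    (- (f (piI z) * derive1 f (piI z)) *: (row a (gM c z.2))^T) (christoffel_mx gM c a
      z.2).
Proof.
move=> cz; rewrite christoffel_mxE trmx_inv warped_sym// christoffel1_warped_r//.
apply: (canLR (mulmxK (warped_unit cz))).
rewrite /warped_metric mulmx_block !mul0mx !mulmx0 !mulmx1 !addr0 !add0r.
rewrite -!scalemxAl -!scalemxAr -rowE christoffel_mx_metric// scalerA.
by congr (block_mx _ (_ *: _) _ _); field; exact: f0.
Qed.

End WarpedChristoffel.

(** * Contractions of the curvature tensor *)

Section Contraction.
Context (R : realType) (n : nat) (B : 'M[R]_n).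

(** The value L(e_s, e_t, e_t, e_s) on rows of B. For the lowered curvature tensor it is the
    numerator of the sectional curvature of the pair. *)
Definition contract s t (L : 'I_n -> 'I_n -> 'I_n -> 'I_n -> R) : R :=
  \sum_j \sum_k B t j * B t k * \sum_i \sum_m B s i * B s m * L i j k m.

Lemma eq_contract s t L L' : (forall i j k m, L i j k m = L' i j k m) ->
  contract s t L = contract s t L'.
Proof.
move=> LL; apply: eq_bigr => j _; apply: eq_bigr => k _; congr (_ * _).
by apply: eq_bigr => i _; apply: eq_bigr => m _; rewrite LL.
Qed.

Lemma contractD s t L L' :
  contract s t (fun i j k m => L i j k m + L' i j k m) = contract s t L + contract s t L'.
Proof.
rewrite /contract -big_split; apply: eq_bigr => j _ /=.
rewrite -big_split; apply: eq_bigr => k _ /=; rewrite -mulrDr; congr (_ * _).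
rewrite -big_split; apply: eq_bigr => i _ /=.
by rewrite -big_split; apply: eq_bigr => m _ /=; rewrite mulrDr.
Qed.

Lemma contractZ s t a L :
  contract s t (fun i j k m => a * L i j k m) = a * contract s t L.
Proof.
rewrite /contract big_distrr; apply: eq_bigr => j _ /=.
rewrite big_distrr; apply: eq_bigr => k _ /=; rewrite mulrCA; congr (_ * _).
rewrite big_distrr; apply: eq_bigr => i _ /=.
by rewrite big_distrr; apply: eq_bigr => m _ /=; rewrite mulrCA.
Qed.

Lemma conjE (Y : 'M[R]_n) s t : (B *m Y *m B^T) s t = \sum_i \sum_m B s i * B t m * Y i m.
Proof.
rewrite mxE exchange_big; apply: eq_bigr => m _ /=.
by rewrite !mxE big_distrl; apply: eq_bigr => i _ /=; rewrite mulrAC.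
Qed.

Lemma contract_outer s t (X Y : 'M[R]_n) :
  contract s t (fun i j k m => X j k * Y i m) = (B *m X *m B^T) t t * (B *m Y *m B^T) s s.
Proof.
rewrite (conjE X) big_distrl; apply: eq_bigr => j _ /=.
rewrite big_distrl; apply: eq_bigr => k _ /=; rewrite -[RHS]mulrA; congr (_ * _).
rewrite (conjE Y) big_distrr; apply: eq_bigr => i _ /=.
by rewrite big_distrr; apply: eq_bigr => m _ /=; rewrite mulrCA.
Qed.

Lemma contract_cross s t (X Y : 'M[R]_n) :
  contract s t (fun i j k m => X i k * Y j m) = (B *m X *m B^T) s t * (B *m Y *m B^T) t s.
Proof.
have inn j k : \sum_i \sum_m B s i * B s m * (X i k * Y j m) =
    (B *m X) s k * (Y *m B^T) j s.
  rewrite [in RHS]mxE big_distrl; apply: eq_bigr => i _ /=.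
  rewrite [in RHS]mxE big_distrr; apply: eq_bigr => m _ /=.
  by rewrite !mxE; ring.
rewrite -(mulmxA B Y) [X in _ * X]mxE [X in X * _]mxE mulrC big_distrl; apply: eq_bigr
  => j _ /=.
rewrite big_distrr; apply: eq_bigr => k _ /=; rewrite inn.
by rewrite [B^T k t]mxE; ring.
Qed.

Lemma linear_form_sum (m : nat) (K : 'rV[R]_m -> R) (a : 'I_n -> R) (v : 'I_n ->
  'rV[R]_m) :
  (forall x y, K (x + y) = K x + K y) -> (forall b x, K (b *: x) = b * K x) ->
  K (\sum_i a i *: v i) = \sum_i a i * K (v i).
Proof.
move=> KD KZ.
have K0 : K 0 = 0 by rewrite -(scale0r 0) KZ mul0r.
by rewrite (big_morph K KD K0); apply: eq_bigr => i _; rewrite KZ.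
Qed.

(** Used for the curvature of M, with Y the differential of [fib]: the contraction evaluates it on
    the projected frame vectors. *)
Lemma contract_multilinear s t (m : nat) (K : 'rV[R]_m -> 'rV[R]_m -> 'rV[R]_m ->
  'rV[R]_m -> R)
    (Y : 'M[R]_(n, m)) :
  (forall v w z x y, K (v + w) z x y = K v z x y + K w z x y) ->
  (forall v w z x y, K z (v + w) x y = K z v x y + K z w x y) ->
  (forall v w z x y, K z x (v + w) y = K z x v y + K z x w y) ->
  (forall v w z x y, K z x y (v + w) = K z x y v + K z x y w) ->
  (forall a v z x y, K (a *: v) z x y = a * K v z x y) ->
  (forall a v z x y, K z (a *: v) x y = a * K z v x y) ->
  (forall a v z x y, K z x (a *: v) y = a * K z x v y) ->
  (forall a v z x y, K z x y (a *: v) = a * K z x y v) ->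
  contract s t (fun i j k l => K (row i Y) (row j Y) (row k Y) (row l Y)) =
  K (row s (B *m Y)) (row t (B *m Y)) (row t (B *m Y)) (row s (B *m Y)).
Proof.
move=> D1 D2 D3 D4 Z1 Z2 Z3 Z4.
have rE a : row a (B *m Y) = \sum_i B a i *: row i Y.
  by rewrite row_mul mulmx_sum_row; apply: eq_bigr => i _; rewrite mxE.
rewrite [in RHS](rE t).
rewrite (@linear_form_sum _ (fun v => K _ v _ _)) // /contract; apply: eq_bigr => j _.
rewrite (@linear_form_sum _ (fun v => K _ _ v _)) // big_distrr; apply: eq_bigr => k _ /=.
rewrite mulrA; congr (_ * _).
rewrite (rE s) (@linear_form_sum _ (fun v => K v _ _ _)) //; apply: eq_bigr => i _.
rewrite (@linear_form_sum _ (fun v => K _ _ _ v)) // big_distrr; apply: eq_bigr => l _ /=.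
by rewrite mulrA.
Qed.

End Contraction.

(** * Multilinearity of the curvature tensor, and degenerate planes *)

Section CurvatureAlgebra.
Context (R : realType) (n : nat) (X : charted_space R n) (g : tensor2 X).
Variables (c : chart X) (q : X).
Implicit Types v w z x : 'rV[R]_n.

Lemma curvatureDl v w z x : curvature g c q (v + w) z x =
  curvature g c q v z x + curvature g c q w z x.
Proof.
rewrite !curvatureE -mulmxDr -big_split; congr (_ *m _); apply: eq_bigr => i _ /=.
rewrite -big_split; apply: eq_bigr => j _ /=.
by rewrite -scalerDl mxE mulrDl.
Qed.

Lemma curvatureDm v w z x : curvature g c q z (v + w) x =
  curvature g c q z v x + curvature g c q z w x.
Proof.
rewrite !curvatureE -mulmxDr -big_split; congr (_ *m _); apply: eq_bigr => i _ /=.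
rewrite -big_split; apply: eq_bigr => j _ /=.
by rewrite -scalerDl mxE mulrDr.
Qed.

Lemma curvatureDr v w z x : curvature g c q z x (v + w) =
  curvature g c q z x v + curvature g c q z x w.
Proof. by rewrite !curvatureE mulmxDl. Qed.

Lemma curvatureZl a v z x : curvature g c q (a *: v) z x = a *: curvature g c q v z x.
Proof.
rewrite !curvatureE scalemxAr scaler_sumr; congr (_ *m _); apply: eq_bigr => i _ /=.
by rewrite scaler_sumr; apply: eq_bigr => j _; rewrite scalerA mxE mulrA.
Qed.

Lemma curvatureZm a v z x : curvature g c q z (a *: v) x = a *: curvature g c q z v x.
Proof.
rewrite !curvatureE scalemxAr scaler_sumr; congr (_ *m _); apply: eq_bigr => i _ /=.
by rewrite scaler_sumr; apply: eq_bigr => j _; rewrite scalerA mxE mulrCA.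
Qed.

Lemma curvatureZr a v z x : curvature g c q z x (a *: v) = a *: curvature g c q z x v.
Proof. by rewrite !curvatureE scalemxAl. Qed.

Lemma riemann_mxC i j : riemann_mx g c j i q = - riemann_mx g c i j q.
Proof.
rewrite !riemann_mxE.
have alg (V : zmodType) (a b d e : V) : a - b + (d - e) = - (b - a + (e - d)).
  by rewrite opprD !opprB.
exact: alg.
Qed.

Lemma curvature_diag v z : curvature g c q v v z = 0.
Proof.
rewrite curvatureE; set S := \sum_i _.
suff SN : S = - S.
  have /eqP : S *+ 2 = 0 by rewrite mulr2n {1}SN addNr.
  by rewrite -scaler_nat scaler_eq0 pnatr_eq0 /= => /eqP ->; rewrite mulmx0.
rewrite {1}/S exchange_big /S -sumrN; apply: eq_bigr => i _ /=.
by rewrite -sumrN; apply: eq_bigr => j _; rewrite riemann_mxC scalerN mulrC.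
Qed.

(** Freed of the division, the bound survives for linearly dependent v and w, where both sides
    vanish. Projections of frame vectors to the fiber can be of this kind. *)
Lemma sectional_le_curvature (k : R) v w : riemannian_metric g -> dom c q ->
  (row_free (col_mx v w) -> sectional g c q v w <= k) ->
  inner (g c q) (curvature g c q v w w) v <=
  k * (inner (g c q) v v * inner (g c q) w w - inner (g c q) v w ^+ 2).
Proof.
move=> hg cq sec; set G := g c q.
have GT : G^T = G by exact: metric_sym hg _ _ cq.
case: (boolP (row_free (col_mx v w))) => [fr|nfr].
  have w0 : w != 0.
    apply: contraTneq fr => ->; rewrite /row_free neq_ltn; apply/orP; left.
    by rewrite rank_col_mx0 (leq_ltn_trans (rank_leq_row _)).
  (* A multiple of the part of v orthogonal to w: its squared length is |w|^2 times the Gram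
     determinant, which is therefore positive. *)
  pose x := inner G w w *: v - inner G v w *: w.
  have x0 : x != 0.
    apply/eqP => xE.
    have : row_mx (inner G w w)%:M (- inner G v w)%:M *m col_mx v w = 0 :> 'rV_n.
      by rewrite mul_row_col !mul_scalar_mx scaleNr.
    rewrite -(mul0mx _ (col_mx v w)) => /(row_free_inj fr) /(congr1 lsubmx).
    rewrite row_mxKl linear0 => /matrixP /(_ 0 0); rewrite !mxE eqxx => /eqP.
    by rewrite mulr1n gt_eqF// (metric_pos hg).
  have ww : 0 < inner G w w by exact: (metric_pos hg).
  have den : 0 < inner G v v * inner G w w - inner G v w ^+ 2.
    have : 0 < inner G x x by exact: (metric_pos hg).
    have -> : inner G x x = inner G w w * (inner G v v * inner G w w - inner G v w ^+ 2).
      rewrite /x !(innerDl, innerDr, innerNl) -scaleNr !(innerZl, innerZr).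
      rewrite (inner_sym w v GT); move: (inner G v v) (inner G w w) (inner G v w) => *;
        ring.
    by rewrite pmulr_rgt0.
  by rewrite -ler_pdivrMr//; exact: sec.
have [u u0 uE] : exists2 u : 'rV[R]_(1 + 1), u != 0 & u *m col_mx v w = 0.
  move: nfr; rewrite -kermx_eq0 => /rowV0Pn[u /sub_kermxP uE u0].
  by exists u.
have {}uE : u 0 (lshift 1 0) *: v + u 0 (rshift 1 0) *: w = 0.
  rewrite -uE -[u in RHS]hsubmxK mul_row_col.
  have s11 (a : 'M[R]_1) (y : 'rV[R]_n) : a *m y = a 0 0 *: y.
    by rewrite {1}[a]mx11_scalar mul_scalar_mx.
  by rewrite !s11 !mxE.
(* A dependency between v and w means w = 0 or v proportional to w. *)
have [a0|a0] := eqVneq (u 0 (lshift 1 0)) 0.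
  have w0 : w = 0.
    move: uE; rewrite a0 scale0r add0r => /eqP; rewrite scaler_eq0 => /orP[/eqP
      b0|/eqP//].
    case/eqP: u0; apply/rowP => j; rewrite [RHS]mxE.
    by case: (split_ordP j) => j' ->; rewrite (ord1 j').
  rewrite w0 -{1}(scale0r 0) curvatureZm scale0r /inner !mul0mx linear0 !mulmx0 !mxE.
  by rewrite mulr0 expr0n /= subr0 mulr0.
have -> : v = (- (u 0 (lshift 1 0))^-1 * u 0 (rshift 1 0)) *: w.
  apply: (scalerI a0); rewrite scalerA mulNr mulrN mulrA mulfV// mul1r scaleNr.
  by apply/eqP; rewrite -addr_eq0 uE.
move: (- _ * _) => r.
rewrite curvatureZl curvature_diag scaler0 !(innerZl, innerZr) /inner !mul0mx mxE.
set y := (w *m _ *m _) 0 0.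
have -> : k * (r * (r * y) * y - (r * y) ^+ 2) = 0 by ring.
by rewrite mulr0 lexx.
Qed.

End CurvatureAlgebra.

(** * Hypersurfaces of a warped product *)

Lemma inner_warped (R : realType) n (I : set R) (M : charted_space R n) (f : R -> R)
    (gM : tensor2 M) (c : chart M) (z : interval_prod I M) (a b : R) (V W : 'rV[R]_n) :
  inner (warped_metric f gM c z) (row_mx a%:M V) (row_mx b%:M W) =
  a * b + f (piI z) ^+ 2 * inner (gM c z.2) V W.
Proof.
rewrite /inner /warped_metric mul_row_block tr_row_mx mul_row_col !mulmx0 mulmx1 addr0
  add0r.
by rewrite tr_scalar_mx -scalar_mxM -scalemxAr -scalemxAl !mxE.
Qed.

(** The rows of Q, namely the normal and the images of the frame B, are orthonormal and as many as
    the dimension, so V and W expand in them (Parseval); the tangential part is then rewritten with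
    the inverse of G. *)
Lemma hypersurface_frame (R : realType) n (ambient : 'M[R]_(1 + n)) (dphi : 'M[R]_(n, 1
  + n))
    (nu : 'rV[R]_(1 + n)) (G B : 'M[R]_n) (V W : 'rV[R]_(1 + n)) :
  ambient^T = ambient -> B *m G *m B^T = 1%:M -> dphi *m ambient *m dphi^T = G ->
  dphi *m ambient *m nu^T = 0 -> inner ambient nu nu = 1 ->
  inner ambient V W = ((V *m ambient *m dphi^T) *m invmx G *m (W *m ambient *m
    dphi^T)^T) 0 0
    + inner ambient V nu * inner ambient W nu.
Proof.
move=> GPT BG PhiG Phinu nu1.
pose Q : 'M[R]_(1 + n) := col_mx nu (B *m dphi).
have nuPhi : nu *m ambient *m dphi^T = 0.
  by apply: trmx_inj; rewrite trmx0 !trmx_mul trmxK GPT mulmxA.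
have nunu : nu *m ambient *m nu^T = 1%:M.
  by apply/matrixP => i j; rewrite !ord1 [RHS]mxE eqxx -[LHS]/(inner ambient nu nu).
have QQ : Q *m (ambient *m Q^T) = 1%:M.
  rewrite mulmxA /Q mul_col_mx tr_col_mx mul_col_row nunu trmx_mul !mulmxA nuPhi mul0mx.
  rewrite -(mulmxA B dphi) -(mulmxA B _ nu^T) Phinu mulmx0.
  by rewrite -(mulmxA B _ dphi^T) PhiG BG -scalar_mx_block.
have {}QQ := mulmx1C QQ.
have E : inner ambient V W = ((V *m ambient *m Q^T) *m (W *m ambient *m Q^T)^T) 0 0.
  rewrite /inner !trmx_mul trmxK GPT !mulmxA.
  by rewrite (_ : V *m ambient *m Q^T *m Q = V)// -!mulmxA (mulmxA ambient) QQ mulmx1.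
have QE U : U *m ambient *m Q^T = row_mx (U *m ambient *m nu^T) (U *m ambient *m dphi^T
  *m B^T).
  by rewrite /Q tr_col_mx trmx_mul mul_mx_row !mulmxA.
rewrite E !QE tr_row_mx mul_row_col mxE addrC; congr (_ + _).
  by rewrite (frame_invmx BG) !trmx_mul !trmxK !mulmxA.
by rewrite [LHS]mxE big_ord1 [in X in _ * X]mxE.
Qed.

Lemma sum_block_mx (R : realType) k l m (A : 'I_k -> 'M[R]_l) (B : 'I_k -> 'M[R]_(l, m))
    (C : 'I_k -> 'M[R]_(m, l)) (D : 'I_k -> 'M[R]_m) :
  \sum_a block_mx (A a) (B a) (C a) (D a) =
  block_mx (\sum_a A a) (\sum_a B a) (\sum_a C a) (\sum_a D a).
Proof.
apply/matrixP => i j; rewrite summxE.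
case: (split_ordP i) => i' ->; case: (split_ordP j) => j' ->.
- by rewrite block_mxEul summxE; apply: eq_bigr => a _; rewrite block_mxEul.
- by rewrite block_mxEur summxE; apply: eq_bigr => a _; rewrite block_mxEur.
- by rewrite block_mxEdl summxE; apply: eq_bigr => a _; rewrite block_mxEdl.
- by rewrite block_mxEdr summxE; apply: eq_bigr => a _; rewrite block_mxEdr.
Qed.

Section Hypersurface.
Context (R : realType) (n : nat) (X : charted_space R n) (M : charted_space R n).
Context (I : set R) (f : R -> R) (gM : tensor2 M) (g : tensor2 X).
Hypotheses (hX : smooth_manifold X) (hM : smooth_manifold M) (I_open : open I).
Hypotheses (hf : smooth_fun_on I f) (f_gt0 : forall t, I t -> 0 < f t).
Hypotheses (hgM : riemannian_metric gM) (hg : riemannian_metric g).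
Local Notation P := (interval_prod I M).
Local Notation gP := (warped_metric (I := I) f gM).
Variables (phi : X -> P) (c : chart X) (c' : chart M).
Hypothesis phi_isom : isometric_immersion g gP phi.

Definition fib (q : X) : M := (phi q).2.
Definition height (q : X) : R := piI (phi q).
(** A chart of M is also a chart of the product, so one c' serves for [fib] and for [phi]. *)
Definition overlap : set X := dom c `&` fib @^-1` dom c'.
Local Notation O := overlap.

Lemma fib_cont : continuous fib.
Proof.
have [[cphi _] _ _] := phi_isom.
move=> q; apply: (@continuous_comp _ _ _ phi (fun z : P => z.2) q); first exact: cphi.
exact: cvg_snd.
Qed.

Lemma overlap_open : open O.
Proof.
apply: openI; first exact: (dom_open hX).
by apply: open_comp; [move=> q _; exact: fib_cont | exact: (dom_open hM)].
Qed.

Lemma overlap_dom : O `<=` dom c. Proof. by move=> q []. Qed.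
Lemma overlap_fib q : O q -> dom c' (fib q). Proof. by case. Qed.

Lemma fib_Ck k a : Ck c k O (fun r => coord c' (fib r) 0 a).
Proof.
have [[_ sphi] _ _] := phi_isom.
have := sphi c' (rshift 1 a) c k.
by apply: (Ck_ext hX overlap_open overlap_dom) => r _; rewrite row_mxEr.
Qed.

Lemma height_Ck k : Ck c k O height.
Proof.
have [[_ sphi] _ _] := phi_isom.
have := sphi c' (lshift n 0) c k.
by apply: (Ck_ext hX overlap_open overlap_dom) => r _; rewrite row_mxEl mxE.
Qed.

(* With t and y the components of phi in I and M: dheight i = d_i t,
   fib_tangent i = d_i y, and fib_nabla i j is the covariant derivative of
   fib_tangent j along d_i for the connection that y pulls back from M;
   fib_inner is the metric of M along y. *)
Definition warp q := f (height q).
Definition warp1 q := derive1 f (height q).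
Definition warp2 q := derive1 (derive1 f) (height q).
Definition dheight i := pd c i height.
Definition ddheight i j := pd c i (dheight j).
Definition fib_tangent i := tangent fib c c' i.
Definition fib_nabla i j := nabla gM fib c c' i (fib_tangent j).
Definition fib_inner q (v w : 'rV[R]_n) := inner (gM c' (fib q)) v w.

Lemma I_height q : I (height q). Proof. exact: piI_in. Qed.

Lemma warp_neq0 q : warp q != 0. Proof. by rewrite gt_eqF// f_gt0//; exact: I_height. Qed.

Lemma dmap_phi q i : row i (dmap phi c c' q) = row_mx (dheight i q)%:M (fib_tangent i q).
Proof.
apply/rowP => a; rewrite mxE mxE; case: (split_ordP a) => b ->.
  rewrite row_mxEl ord1 [RHS]mxE eqxx mulr1n /dheight.
  by congr (pd c i _ q); apply/funext => r; rewrite row_mxEl mxE.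
rewrite row_mxEr /fib_tangent /tangent 2!mxE.
by congr (pd c i _ q); apply/funext => r; rewrite row_mxEr.
Qed.

Lemma metric_formula q i j : O q ->
  g c q i j = dheight i q * dheight j q + warp q ^+ 2 * fib_inner q (fib_tangent i q)
    (fib_tangent j q).
Proof.
move=> [cq cuq].
rewrite -(immersion_isometric phi_isom cq (cuq : @dom _ _ P c' (phi q))) /pullback.
by rewrite -inner_rows !dmap_phi inner_warped.
Qed.

Lemma is_pd_height i q : O q -> is_pd c i q height (dheight i q).
Proof. by move=> Oq; exact: (Ck_is_pd i (height_Ck 1) Oq). Qed.

Lemma is_pd_dheight i j q : O q -> is_pd c i q (dheight j) (ddheight i j q).
Proof. by move=> Oq; exact: (Ck_is_pd i (Ck_pd j (height_Ck 2)) Oq). Qed.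

Lemma is_pd_ddheight i j k q : O q -> is_pd c i q (ddheight j k) (pd c i (ddheight j k)
  q).
Proof. by move=> Oq; exact: (Ck_is_pd i (Ck_pd j (Ck_pd k (height_Ck 3))) Oq). Qed.

Lemma ddheightC i j q : O q -> ddheight i j q = ddheight j i q.
Proof. by move=> Oq; exact: (pdC hX overlap_open overlap_dom i j (height_Ck 2) Oq). Qed.

Lemma dddheightC i j k q : O q -> pd c i (ddheight j k) q = pd c j (ddheight i k) q.
Proof. by move=> Oq; exact: (pdC hX overlap_open overlap_dom i j (Ck_pd k (height_Ck
  3)) Oq). Qed.

Lemma is_pd_warp i q : O q -> is_pd c i q warp (warp1 q * dheight i q).
Proof.
move=> Oq; apply: (is_pd_comp1 hX); [exact: overlap_dom|exact: (hf (k := 0%N) (I_height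
  q))|].
exact: is_pd_height.
Qed.

Lemma is_pd_warp1 i q : O q -> is_pd c i q warp1 (warp2 q * dheight i q).
Proof.
move=> Oq; apply: (is_pd_comp1 hX); [exact: overlap_dom|exact: (hf (k := 1%N) (I_height
  q))|].
exact: is_pd_height.
Qed.

Lemma smooth_fib_tangent i : smooth_along c O (fib_tangent i).
Proof. exact: (smooth_tangent hX overlap_open overlap_dom fib_Ck). Qed.

Lemma smooth_nabla_fib i V : smooth_along c O V -> smooth_along c O (nabla gM fib c c'
  i V).
Proof.
exact: (smooth_nabla hX hM hgM fib_cont overlap_open overlap_dom overlap_fib fib_Ck).
Qed.

Lemma smooth_fib_nabla i j : smooth_along c O (fib_nabla i j).
Proof. exact/smooth_nabla_fib/smooth_fib_tangent. Qed.

Lemma fib_nablaC i j q : O q -> fib_nabla i j q = fib_nabla j i q.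
Proof.
exact: (nabla_tangentC hX hM hgM overlap_open overlap_dom overlap_fib fib_Ck).
Qed.

Lemma fib_innerC q v w : O q -> fib_inner q v w = fib_inner q w v.
Proof. by move=> Oq; apply: inner_sym; apply: (metric_sym hgM); exact: overlap_fib. Qed.

Lemma fib_innerDl q v v' w : fib_inner q (v + v') w = fib_inner q v w + fib_inner q v' w.
Proof. exact: innerDl. Qed.

Lemma fib_innerDr q v w w' : fib_inner q v (w + w') = fib_inner q v w + fib_inner q v w'.
Proof. exact: innerDr. Qed.

Lemma fib_innerZl q a v w : fib_inner q (a *: v) w = a * fib_inner q v w.
Proof. exact: innerZl. Qed.

Lemma fib_innerZr q a v w : fib_inner q v (a *: w) = a * fib_inner q v w.
Proof. exact: innerZr. Qed.

Lemma fib_innerBl q v v' w : fib_inner q (v - v') w = fib_inner q v w - fib_inner q v' w.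
Proof. exact: innerBl. Qed.

Lemma fib_inner_expandl q (S yj yk ym : 'rV[R]_n) (r hj hk : R) :
  fib_inner q (S + r *: (hj *: yk + hk *: yj)) ym =
  fib_inner q S ym + r * (hj * fib_inner q yk ym + hk * fib_inner q yj ym).
Proof. by rewrite fib_innerDl fib_innerZl fib_innerDl !fib_innerZl. Qed.

Lemma fib_inner_expand q (S S' yi yj yk ym : 'rV[R]_n) (r hi hj hk hm : R) :
  fib_inner q (S + r *: (hj *: yk + hk *: yj)) (S' + r *: (hi *: ym + hm *: yi)) =
  fib_inner q S S' + r * (hi * fib_inner q S ym + hm * fib_inner q S yi)
   + r * (hj * fib_inner q yk S' + hk * fib_inner q yj S')
   + r ^+ 2 * (hj * (hi * fib_inner q yk ym + hm * fib_inner q yk yi)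
      + hk * (hi * fib_inner q yj ym + hm * fib_inner q yj yi)).
Proof.
rewrite !(fib_innerDl, fib_innerDr, fib_innerZl, fib_innerZr) expr2.
move: (fib_inner q yk ym) (fib_inner q yk yi) (fib_inner q yj ym) (fib_inner q yj yi)
  (fib_inner q S S').
by move: (fib_inner q S ym) (fib_inner q S yi) (fib_inner q yk S') (fib_inner q yj S')
  => *; ring.
Qed.

Lemma is_pd_fib_inner i V W q : smooth_along c O V -> smooth_along c O W -> O q ->
  is_pd c i q (fun r => fib_inner r (V r) (W r))
    (fib_inner q (nabla gM fib c c' i V q) (W q) + fib_inner q (V q) (nabla gM fib c c'
      i W q)).
Proof.
exact: (nabla_metric hX hM hgM overlap_open overlap_dom overlap_fib fib_Ck).
Qed.

Lemma near_overlap q : O q -> \forall r \near q, O r.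
Proof. exact: near_open overlap_open. Qed.

Lemma pd_metric_formula i j l q : O q -> pd_metric g c i q j l =
  ddheight i j q * dheight l q + dheight j q * ddheight i l q
  + (2 * warp q * warp1 q * dheight i q * fib_inner q (fib_tangent j q) (fib_tangent l q)
     + warp q ^+ 2 * (fib_inner q (fib_nabla i j q) (fib_tangent l q) + fib_inner q
       (fib_tangent j q) (fib_nabla i l q))).
Proof.
move=> Oq; have cq := overlap_dom Oq; rewrite mxE; apply: is_pdE.
apply: (@is_pd_near _ _ _ hX _ _ _
  (fun r => dheight j r * dheight l r + warp r * warp r * fib_inner r (fib_tangent j r)
    (fib_tangent l r))) => //.
  near=> r; rewrite metric_formula ?expr2//; near: r; exact: near_overlap.
apply: is_pd_eq.
  apply: (is_pdD hX cq); first apply: (is_pdM hX cq (is_pd_dheight i j Oq)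
    (is_pd_dheight i l Oq)).
  apply: (is_pdM hX cq (is_pdM hX cq (is_pd_warp i Oq) (is_pd_warp i Oq))).
  exact: (is_pd_fib_inner i (smooth_fib_tangent j) (smooth_fib_tangent l) Oq).
rewrite -/(fib_nabla i j) -/(fib_nabla i l).
move: (fib_inner q _ _) (fib_inner q _ _) (fib_inner q _ _) => x y z.
by move: (ddheight i j q) (ddheight i l q) (dheight _ q) (dheight _ q) (dheight _ q)
  (warp q) (warp1 q) => *; ring.
Unshelve. all: by end_near. Qed.

(** In the alternating sum of derivatives of g, the symmetry of [ddheight] and of [fib_nabla]
    cancels all second derivatives except those in the directions j, k. *)
Lemma christoffel1_formula j k m q : O q -> christoffel1_mx g c j q k m =
  ddheight j k q * dheight m q
  + warp q * warp1 q * (dheight j q * fib_inner q (fib_tangent k q) (fib_tangent m q) +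
    dheight k q * fib_inner q (fib_tangent j q) (fib_tangent m q)
       - dheight m q * fib_inner q (fib_tangent j q) (fib_tangent k q))
  + warp q ^+ 2 * fib_inner q (fib_nabla j k q) (fib_tangent m q).
Proof.
move=> Oq; rewrite mxE.
have := fun i j l => pd_metric_formula i j l Oq; move: (pd_metric g c) => D ED.
rewrite !ED {D ED} (ddheightC m k Oq) (ddheightC m j Oq) (ddheightC k j Oq).
rewrite (fib_nablaC k j Oq) (fib_nablaC m j Oq) (fib_nablaC m k Oq) (fib_innerC
  (fib_tangent k q) (fib_nabla j m q) Oq).
move: (fib_inner q (fib_nabla j k q) (fib_tangent m q)) (fib_inner q (fib_nabla j m q)
  (fib_tangent k q)) (fib_inner q (fib_tangent j q) (fib_nabla k m q)).
move: (fib_inner q (fib_tangent k q) (fib_tangent m q)) (fib_inner q (fib_tangent j q)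
  (fib_tangent m q)) (fib_inner q (fib_tangent j q) (fib_tangent k q)).
by move: (ddheight _ _ _) (ddheight _ _ _) (ddheight _ _ _) (dheight _ q) (dheight _ q)
  (dheight _ q) (warp q) (warp1 q) => *; field.
Qed.

(* The derivative of the right-hand side of christoffel1_formula. *)
Definition d_christoffel1 i j q : 'M[R]_n := \matrix_(k, m)
  (pd c i (ddheight j k) q * dheight m q + ddheight j k q * ddheight i m q
   + (warp1 q * dheight i q * warp1 q + warp q * (warp2 q * dheight i q)) *
      (dheight j q * fib_inner q (fib_tangent k q) (fib_tangent m q) + dheight k q *
        fib_inner q (fib_tangent j q) (fib_tangent m q)
       - dheight m q * fib_inner q (fib_tangent j q) (fib_tangent k q))
   + warp q * warp1 q *
      (ddheight i j q * fib_inner q (fib_tangent k q) (fib_tangent m q)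
       + dheight j q * (fib_inner q (fib_nabla i k q) (fib_tangent m q) + fib_inner q
         (fib_nabla i m q) (fib_tangent k q))
       + (ddheight i k q * fib_inner q (fib_tangent j q) (fib_tangent m q)
         + dheight k q * (fib_inner q (fib_nabla i j q) (fib_tangent m q) + fib_inner q
           (fib_nabla i m q) (fib_tangent j q)))
       - (ddheight i m q * fib_inner q (fib_tangent j q) (fib_tangent k q)
         + dheight m q * (fib_inner q (fib_nabla i j q) (fib_tangent k q) + fib_inner q
           (fib_nabla i k q) (fib_tangent j q))))
   + (2 * warp q * warp1 q * dheight i q * fib_inner q (fib_nabla j k q) (fib_tangent m q)
      + warp q ^+ 2 * (fib_inner q (nabla gM fib c c' i (fib_nabla j k) q) (fib_tangent
        m q)
         + fib_inner q (fib_nabla j k q) (fib_nabla i m q)))).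

Lemma is_pd_christoffel1 i j q : O q -> is_pdmx c q i (christoffel1_mx g c j)
  (d_christoffel1 i j q).
Proof.
move=> Oq k m; have cq := overlap_dom Oq.
apply: (@is_pd_near _ _ _ hX _ _ _ (fun q => ddheight j k q * dheight m q
  + warp q * warp1 q * (dheight j q * fib_inner q (fib_tangent k q) (fib_tangent m q) +
    dheight k q * fib_inner q (fib_tangent j q) (fib_tangent m q)
       - dheight m q * fib_inner q (fib_tangent j q) (fib_tangent k q))
  + warp q * warp q * fib_inner q (fib_nabla j k q) (fib_tangent m q))) => //.
  near=> r; rewrite christoffel1_formula ?expr2//; near: r; exact: near_overlap.
have FF := is_pdM hX cq (is_pd_warp i Oq) (is_pd_warp i Oq).
have FF1 := is_pdM hX cq (is_pd_warp i Oq) (is_pd_warp1 i Oq).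
have dP a b := is_pd_fib_inner i (smooth_fib_tangent a) (smooth_fib_tangent b) Oq.
have dS := is_pd_fib_inner i (smooth_fib_nabla j k) (smooth_fib_tangent m) Oq.
have h2 := is_pdM hX cq (is_pd_ddheight i j k Oq) (is_pd_dheight i m Oq).
have h3 a b d := is_pdM hX cq (is_pd_dheight i a Oq) (dP b d).
have H := is_pdD hX cq (is_pdD hX cq h2 (is_pdM hX cq FF1
  (is_pdB hX cq (is_pdD hX cq (h3 j k m) (h3 k j m)) (h3 m j k)))) (is_pdM hX cq FF dS).
apply: (is_pd_eq H).
rewrite [RHS]mxE -!/(fib_nabla _ _).
rewrite (fib_innerC (fib_tangent k q) (fib_nabla i m q) Oq) (fib_innerC (fib_tangent j
  q) (fib_nabla i m q) Oq) (fib_innerC (fib_tangent j q) (fib_nabla i k q) Oq).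
move: (fib_inner q (nabla _ _ _ _ _ _ _) _) (fib_inner q (fib_nabla j k q) (fib_nabla i
  m q)) (fib_inner q (fib_nabla j k q) (fib_tangent m q)).
move: (fib_inner q (fib_nabla i k q) (fib_tangent m q)) (fib_inner q (fib_nabla i m q)
  (fib_tangent k q)) (fib_inner q (fib_nabla i j q) (fib_tangent m q)).
move: (fib_inner q (fib_nabla i m q) (fib_tangent j q)) (fib_inner q (fib_nabla i j q)
  (fib_tangent k q)) (fib_inner q (fib_nabla i k q) (fib_tangent j q)).
move: (fib_inner q (fib_tangent k q) (fib_tangent m q)) (fib_inner q (fib_tangent j q)
  (fib_tangent m q)) (fib_inner q (fib_tangent j q) (fib_tangent k q)).
move: (ddheight j k q) (ddheight i j q) (ddheight i k q) (ddheight i m q) (pd _ _ _ _).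
by move: (dheight i q) (dheight j q) (dheight k q) (dheight m q) (warp q) (warp1 q)
  (warp2 q) => *; ring.
Unshelve. all: by end_near. Qed.

Definition ambient q := gP c' (phi q).
Definition dphi q := dmap phi c c' q.
(* The ambient covariant derivative nabla_j phi_k. *)
Definition ambient_nabla j k q : 'rV[R]_(1 + n) :=
  row_mx (ddheight j k q - warp q * warp1 q * fib_inner q (fib_tangent j q)
    (fib_tangent k q))%:M
    (fib_nabla j k q + (warp1 q / warp q) *: (dheight j q *: fib_tangent k q + dheight
      k q *: fib_tangent j q)).

Lemma inner_ambient q a b V W :
  inner (ambient q) (row_mx a%:M V) (row_mx b%:M W) = a * b + warp q ^+ 2 * fib_inner q
    V W.
Proof. exact: inner_warped. Qed.

(** Both sides are explicit in [height] and [fib], so they are compared by algebra, without calculus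
    on the product. *)
Lemma ambient_nabla_tangent j k m q : O q ->
  inner (ambient q) (ambient_nabla j k q) (row m (dphi q)) = christoffel1_mx g c j q k m.
Proof.
move=> Oq; rewrite christoffel1_formula// /dphi dmap_phi /ambient_nabla inner_ambient.
rewrite fib_inner_expandl.
have F0 := warp_neq0 q.
move: (fib_inner q (fib_nabla j k q) (fib_tangent m q)) (ddheight j k q).
move: (fib_inner q (fib_tangent k q) (fib_tangent m q)) (fib_inner q (fib_tangent j q)
  (fib_tangent m q)) (fib_inner q (fib_tangent j q) (fib_tangent k q)).
by move: (warp q) (warp1 q) (dheight m q) (dheight j q) (dheight k q) F0 => *; field.
Qed.

Lemma ambient_nabla_inner i j k m q : O q ->
  inner (ambient q) (ambient_nabla j k q) (ambient_nabla i m q) =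
  (ddheight j k q - warp q * warp1 q * fib_inner q (fib_tangent j q) (fib_tangent k q)) *
    (ddheight i m q - warp q * warp1 q * fib_inner q (fib_tangent i q) (fib_tangent m q))
  + warp q ^+ 2 * fib_inner q (fib_nabla j k q) (fib_nabla i m q)
  + warp q * warp1 q * (dheight i q * fib_inner q (fib_nabla j k q) (fib_tangent m q) +
    dheight m q * fib_inner q (fib_nabla j k q) (fib_tangent i q)
      + dheight j q * fib_inner q (fib_nabla i m q) (fib_tangent k q) + dheight k q *
        fib_inner q (fib_nabla i m q) (fib_tangent j q))
  + warp1 q ^+ 2 * (dheight j q * dheight i q * fib_inner q (fib_tangent k q)
    (fib_tangent m q)
      + dheight j q * dheight m q * fib_inner q (fib_tangent i q) (fib_tangent k q)
      + dheight k q * dheight i q * fib_inner q (fib_tangent j q) (fib_tangent m q)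
      + dheight k q * dheight m q * fib_inner q (fib_tangent i q) (fib_tangent j q)).
Proof.
move=> Oq; rewrite /ambient_nabla inner_ambient.
rewrite (fib_innerC (fib_tangent i q) (fib_tangent k q) Oq) (fib_innerC (fib_tangent i
  q) (fib_tangent j q) Oq).
rewrite (fib_innerC (fib_nabla i m q) (fib_tangent k q) Oq) (fib_innerC (fib_nabla i m
  q) (fib_tangent j q) Oq).
rewrite fib_inner_expand.
have F0 := warp_neq0 q.
move: (fib_inner q (fib_nabla j k q) (fib_nabla i m q)) (fib_inner q (fib_nabla j k q)
  (fib_tangent m q)) (fib_inner q (fib_nabla j k q) (fib_tangent i q)).
move: (fib_inner q (fib_tangent k q) (fib_nabla i m q)) (fib_inner q (fib_tangent j q)
  (fib_nabla i m q)) (fib_inner q (fib_tangent k q) (fib_tangent m q)).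
move: (fib_inner q (fib_tangent k q) (fib_tangent i q)) (fib_inner q (fib_tangent j q)
  (fib_tangent m q)) (fib_inner q (fib_tangent j q) (fib_tangent i q)).
move: (fib_inner q (fib_tangent j q) (fib_tangent k q)) (fib_inner q (fib_tangent i q)
  (fib_tangent m q)) (ddheight j k q) (ddheight i m q).
by move: (warp q) (warp1 q) (dheight m q) (dheight j q) (dheight k q) (dheight i q) F0
  => *; field.
Qed.

(** * The unit normal, the Gauss equation and the Hessian of the height *)

Section Normal.
Variable nu : field_along phi.
Hypothesis nu_normal : unit_normal gP nu.

Definition normal q := nu c' q.
Definition normal0 q := nu c' q 0 (lshift n 0).
Definition normalM q : 'rV[R]_n := rsubmx (nu c' q).
(** Taken from second derivatives of the immersion, so that symmetry is immediate; [second_formE]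
    relates it to the shape operator. *)
Definition second_form j k q := inner (ambient q) (ambient_nabla j k q) (normal q).

Lemma normalE q : normal q = row_mx (normal0 q)%:M (normalM q).
Proof.
rewrite -[LHS]hsubmxK; congr row_mx.
by apply/matrixP => i j; rewrite !ord1 !mxE eqxx.
Qed.

Lemma normal_Ck k a : Ck c k O (fun q => normal q 0 a).
Proof. exact: (@normal_smooth _ _ _ _ _ _ _ _ nu_normal c' a c k). Qed.

Lemma smooth_normalM : smooth_along c O normalM.
Proof.
move=> k a; apply: (Ck_ext hX overlap_open overlap_dom) (normal_Ck k (rshift 1 a)) => r _.
by rewrite mxE.
Qed.

Lemma is_pd_normal0 i q : O q -> is_pd c i q normal0 (pd c i normal0 q).
Proof. by move=> Oq; exact: (Ck_is_pd i (normal_Ck 1 (lshift n 0)) Oq). Qed.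

Lemma frame_formula q (V W : 'rV[R]_(1 + n)) : O q ->
  inner (ambient q) V W =
  ((V *m ambient q *m (dphi q)^T) *m invmx (g c q) *m (W *m ambient q *m (dphi q)^T)^T)
    0 0
    + inner (ambient q) V (normal q) * inner (ambient q) W (normal q).
Proof.
move=> Oq; have [cq cuq] := Oq.
have cuq' : @dom _ _ P c' (phi q) by [].
have [B BG] := metric_frame hg cq.
apply: (hypersurface_frame (B := B)) => //.
- exact: warped_sym.
- exact: (immersion_isometric phi_isom cq cuq').
- apply/matrixP => i j; rewrite ord1 [RHS]mxE.
  have := normal_orth nu_normal cq cuq' (delta_mx 0 i).
  by rewrite -rowE /inner -!row_mul mxE.
- exact: (normal_unit nu_normal cuq').
Qed.

(** The left-hand side, the quadratic term of [riemann_mx_lower], is the tangential part of the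
    inner product; subtracting the normal part is what brings the second fundamental form into the
    Gauss equation. *)
Lemma ambient_nabla_frame i j k m q : O q ->
  (christoffel1_mx g c j q *m invmx (g c q) *m (christoffel1_mx g c i q)^T) k m =
  inner (ambient q) (ambient_nabla j k q) (ambient_nabla i m q) - second_form j k q *
    second_form i m q.
Proof.
move=> Oq; rewrite (frame_formula (ambient_nabla j k q) (ambient_nabla i m q) Oq) addrK.
have E a b : ambient_nabla a b q *m ambient q *m (dphi q)^T = row b (christoffel1_mx g
  c a q).
  apply/rowP => l; rewrite [RHS]mxE -ambient_nabla_tangent// /inner tr_row.
  by rewrite [RHS]mxE [LHS]mxE; apply: eq_bigr => d _; rewrite !mxE.
by rewrite !E -inner_rows.
Qed.

(** All terms of [riemann_mx_lower] are now explicit. Third derivatives of the height cancel by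
    symmetry, those of [fib] leave the curvature of M, and the rest is polynomial. The f'^2 and f
    f'' groups are the curvature of the warping. *)
Lemma gauss_equation i j k m q : O q ->
  (riemann_mx g c i j q *m g c q) k m =
  warp q ^+ 2 * fib_inner q (curvature gM c' (fib q) (fib_tangent i q) (fib_tangent j
    q) (fib_tangent k q)) (fib_tangent m q)
  - warp q ^+ 2 * warp1 q ^+ 2 * (fib_inner q (fib_tangent j q) (fib_tangent k q) *
    fib_inner q (fib_tangent i q) (fib_tangent m q)
      - fib_inner q (fib_tangent i q) (fib_tangent k q) * fib_inner q (fib_tangent j q)
        (fib_tangent m q))
  - warp q * warp2 q * (dheight i q * dheight m q * fib_inner q (fib_tangent j q)
    (fib_tangent k q)
      + dheight j q * dheight k q * fib_inner q (fib_tangent i q) (fib_tangent m q)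
      - dheight i q * dheight k q * fib_inner q (fib_tangent j q) (fib_tangent m q)
      - dheight j q * dheight m q * fib_inner q (fib_tangent i q) (fib_tangent k q))
  + (second_form j k q * second_form i m q - second_form i k q * second_form j m q).
Proof.
move=> Oq; have cq := overlap_dom Oq.
rewrite (riemann_mx_lower hX hg cq (is_pd_christoffel1 i j Oq) (is_pd_christoffel1 j i
  Oq)).
have E4 (x y z w : 'M[R]_n) : (x - y - z + w) k m = x k m - y k m - z k m + w k m.
  by rewrite !mxE.
rewrite E4 !ambient_nabla_frame// !ambient_nabla_inner// [d_christoffel1 i j q k m]mxE
  [d_christoffel1 j i q k m]mxE.
(* Read backwards, curvature becomes a commutator, which matches the second covariant derivatives in
   [d_christoffel1]. *)
rewrite -(nabla_comm hX hM hgM fib_cont overlap_open overlap_dom overlap_fib fib_Ck i j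
  (smooth_fib_tangent k) Oq).
rewrite fib_innerBl -/(fib_nabla i k) -/(fib_nabla j k).
rewrite (dddheightC j i k Oq) (ddheightC j i Oq) (fib_nablaC j i Oq) (fib_innerC
  (fib_tangent j q) (fib_tangent i q) Oq).
move: (fib_inner q (nabla gM fib c c' i (fib_nabla j k) q) (fib_tangent m q)).
move: (fib_inner q (nabla gM fib c c' j (fib_nabla i k) q) (fib_tangent m q)).
move: (second_form j k q) (second_form i m q) (second_form i k q) (second_form j m q).
move: (fib_inner q (fib_nabla j k q) (fib_nabla i m q)) (fib_inner q (fib_nabla i k q)
  (fib_nabla j m q)).
move: (fib_inner q (fib_nabla i k q) (fib_tangent m q)) (fib_inner q (fib_nabla i m q)
  (fib_tangent k q)) (fib_inner q (fib_nabla i j q) (fib_tangent m q)).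
move: (fib_inner q (fib_nabla i m q) (fib_tangent j q)) (fib_inner q (fib_nabla i j q)
  (fib_tangent k q)) (fib_inner q (fib_nabla i k q) (fib_tangent j q)).
move: (fib_inner q (fib_nabla j k q) (fib_tangent m q)) (fib_inner q (fib_nabla j m q)
  (fib_tangent k q)) (fib_inner q (fib_nabla j m q) (fib_tangent i q)).
move: (fib_inner q (fib_nabla j k q) (fib_tangent i q)).
move: (fib_inner q (fib_tangent k q) (fib_tangent m q)) (fib_inner q (fib_tangent j q)
  (fib_tangent m q)) (fib_inner q (fib_tangent j q) (fib_tangent k q)).
move: (fib_inner q (fib_tangent i q) (fib_tangent m q)) (fib_inner q (fib_tangent i q)
  (fib_tangent k q)) (fib_inner q (fib_tangent i q) (fib_tangent j q)).
move: (pd c i (ddheight j k) q) (ddheight j k q) (ddheight i j q) (ddheight i k q)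
  (ddheight i m q) (ddheight j m q).
move: (dheight i q) (dheight j q) (dheight k q) (dheight m q) (warp q) (warp1 q) (warp2
  q).
by move=> *; ring.
Qed.

(** The Christoffel symbols of the product enter only here, for the sake of [covariant_along], whose
    definition refers to them. *)
Lemma conn_warped i q : O q ->
  \sum_a dmap phi c c' q i a *: christoffel_mx (X := P) gP c' a (phi q) =
  block_mx 0 ((warp1 q / warp q) *: fib_tangent i q)
    (- (warp q * warp1 q) *: (fib_tangent i q *m gM c' (fib q))^T)
    (conn gM fib c c' i q + (dheight i q * (warp1 q / warp q))%:M).
Proof.
move=> Oq; have cuq := overlap_fib Oq.
have /rowP E := dmap_phi q i.
rewrite big_split_ord big_ord1 /=.
have -> : dmap phi c c' q i (lshift n 0) = dheight i q.
  by have := E (lshift n 0); rewrite row_mxEl mxE => ->; rewrite mxE eqxx.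
have {}E a : dmap phi c c' q i (rshift 1 a) = fib_tangent i q 0 a.
  by have := E (rshift 1 a); rewrite row_mxEr mxE.
rewrite (christoffel_warped_l hM I_open hf f_gt0 hgM cuq).
under eq_bigr => a _ do rewrite E (christoffel_warped_r hM I_open hf f_gt0 hgM a cuq)
  scale_block_mx scaler0.
rewrite sum_block_mx scale_block_mx add_block_mx !scaler0 big1_eq !add0r.
rewrite scale_scalar_mx [in RHS]addrC; congr block_mx.
- rewrite [in RHS](row_sum_delta (fib_tangent i q)) scaler_sumr; apply: eq_bigr => a _.
  by rewrite !scalerA mulrC.
- rewrite mulmx_sum_row linear_sum /= scaler_sumr; apply: eq_bigr => a _.
  by rewrite [X in _ = _ *: X]linearZ /= !scalerA; congr (_ *: _); exact: mulrC.
- congr (_ + _); apply: eq_bigr => a _; congr (_ *: _).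
  by rewrite mxE.
Qed.

Lemma row_covariant_along i q : O q -> row i (covariant_along gP nu c c' q) =
  row_mx (pd c i normal0 q - warp q * warp1 q * fib_inner q (fib_tangent i q) (normalM
    q))%:M
    (nabla gM fib c c' i normalM q
      + (warp1 q / warp q) *: (dheight i q *: normalM q + normal0 q *: fib_tangent i q)).
Proof.
move=> Oq; have cuq := overlap_fib Oq.
have -> : row i (covariant_along gP nu c c' q) =
    (\row_k pd c i (fun r => nu c' r 0 k) q)
    + normal q *m \sum_a dmap phi c c' q i a *: christoffel_mx (X := P) gP c' a (phi q).
  apply/rowP => k; rewrite !mxE; congr (_ + _).
  rewrite exchange_big; apply: eq_bigr => b _ /=.
  rewrite summxE big_distrr; apply: eq_bigr => a _ /=.
  by rewrite !mxE mulrC [X in _ * X]mulrC.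
rewrite conn_warped// normalE mul_row_block !mulmx0 add0r mul_scalar_mx.
rewrite -[X in X + _]hsubmxK add_row_mx; congr row_mx.
  rewrite -scalemxAr; apply/matrixP => a b; rewrite !ord1 [RHS]mxE eqxx mulr1n.
  rewrite [LHS]mxE; congr (_ + _); first by rewrite !mxE.
  rewrite [LHS]mxE mulNr; congr (- (_ * _)).
  by rewrite /fib_inner (inner_sym _ _ (metric_sym hgM cuq)) /inner trmx_mul
    (metric_sym hgM cuq) mulmxA.
rewrite mulmxDr mul_mx_scalar scalerDr !scalerA.
rewrite (mulrC (normal0 q)) [dheight i q * _]mulrC -!addrA.
have -> : rsubmx (\row_k pd c i (fun r => nu c' r 0 k) q) = pd_row c i normalM q.
  by apply/rowP => a; rewrite !mxE; apply: (pd_near hX) => //; first exact: overlap_dom;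
    near=> r; rewrite mxE.
by rewrite /nabla [X in _ = _ + X]addrA [X in _ = _ + X]addrC.
Unshelve. all: by end_near. Qed.

Lemma orth_formula j q : O q -> dheight j q * normal0 q + warp q * warp q * fib_inner q
  (fib_tangent j q) (normalM q) = 0.
Proof.
move=> [cq cuq].
have := normal_orth nu_normal cq (cuq : @dom _ _ P c' (phi q)) (delta_mx 0 j).
by rewrite -rowE dmap_phi -/(normal q) normalE inner_warped -expr2.
Qed.

(** The Leibniz rule on [orth_formula], which holds on a neighbourhood. It trades derivatives of the
    normal for second derivatives of the immersion. *)
Lemma orth_derivative i j q : O q ->
  ddheight i j q * normal0 q + dheight j q * pd c i normal0 q
  + (2 * warp q * warp1 q * dheight i q * fib_inner q (fib_tangent j q) (normalM q)
    + warp q ^+ 2 * (fib_inner q (fib_nabla i j q) (normalM q)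
        + fib_inner q (fib_tangent j q) (nabla gM fib c c' i normalM q))) = 0.
Proof.
move=> Oq; have cq := overlap_dom Oq.
have H := is_pdD hX cq (is_pdM hX cq (is_pd_dheight i j Oq) (is_pd_normal0 i Oq))
  (is_pdM hX cq (is_pdM hX cq (is_pd_warp i Oq) (is_pd_warp i Oq))
    (is_pd_fib_inner i (smooth_fib_tangent j) smooth_normalM Oq)).
have H0 := is_pd_cst hX i 0 cq.
have N : {near q, (fun=> 0) =1
    (fun r => dheight j r * normal0 r + warp r * warp r * fib_inner r (fib_tangent j r)
      (normalM r))}.
  near=> r; apply/esym/orth_formula; near: r; exact: near_overlap.
have {H0 N}E := is_pdE (is_pd_near hX cq N H0).
rewrite -{}E (is_pdE H) -/(fib_nabla i j).
move: (fib_inner q (fib_tangent j q) (normalM q)) (fib_inner q (fib_nabla i j q)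
  (normalM q)).
move: (fib_inner q (fib_tangent j q) (nabla _ _ _ _ _ _ _)) (ddheight i j q) (pd c i
  normal0 q).
by move: (dheight i q) (dheight j q) (normal0 q) (warp q) (warp1 q) => *; ring.
Unshelve. all: by end_near. Qed.

(** Weingarten's relation: the difference of - <nabla_i nu, phi_j> and <nu, nabla_i phi_j> is, up to
    sign, the left-hand side of [orth_derivative]. *)
Lemma second_formE (A : tensor2 X) i j q : shape_operator gP nu A -> O q ->
  (A c q *m g c q) i j = second_form i j q.
Proof.
move=> hA Oq; have [cq cuq] := Oq.
have cuq' : @dom _ _ P c' (phi q) by [].
rewrite -(immersion_isometric phi_isom cq cuq') /pullback !mulmxA (hA _ _ _ cq cuq').
rewrite !mulNmx mxE -inner_rows row_covariant_along// dmap_phi inner_warped.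
rewrite /second_form normalE /ambient_nabla inner_ambient fib_inner_expandl.
rewrite -/(warp q) -/(fib q) -/(fib_inner q _ _) fib_inner_expandl.
have := orth_derivative i j Oq.
rewrite (fib_innerC (normalM q) (fib_tangent j q) Oq) (fib_innerC (fib_tangent j q)
  (nabla _ _ _ _ _ _ _) Oq).
have F0 := warp_neq0 q.
move: (fib_inner q (fib_nabla i j q) (normalM q)) (fib_inner q (nabla gM fib c c' i
  normalM q) (fib_tangent j q)).
move: (fib_inner q (fib_tangent j q) (normalM q)) (fib_inner q (fib_tangent i q)
  (normalM q)) (fib_inner q (fib_tangent i q) (fib_tangent j q)).
move: (ddheight i j q) (pd c i normal0 q) (dheight i q) (dheight j q) (normal0 q)
  (warp1 q) (warp q) F0.
move=> a b hi hj v F1 F F0 p1 p2 p3 s1 s2 E.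
apply/eqP; rewrite -subr_eq0 -oppr_eq0; apply/eqP; rewrite -[RHS]E; field.
exact: F0.
Qed.

Lemma second_form_sym i j q : O q -> second_form i j q = second_form j i q.
Proof.
move=> Oq; rewrite /second_form (_ : ambient_nabla i j q = ambient_nabla j i q)//
  /ambient_nabla (ddheightC i j Oq) (fib_nablaC i j Oq).
by rewrite (fib_innerC (fib_tangent i q) (fib_tangent j q) Oq) [dheight i q *: _ +
  _]addrC.
Qed.

Lemma partial_tE : partial_t R n = row_mx 1%:M 0.
Proof. by congr row_mx; apply/matrixP => a b; rewrite !ord1 !mxE. Qed.

Lemma fib_inner0r q v : fib_inner q v 0 = 0.
Proof. by rewrite /fib_inner /inner linear0 mulmx0 mxE. Qed.

(** The product <nabla_i phi_j, d/dt> is computed twice, from components and in the frame. Since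
    <d/dt, phi_k> = d_k h, the tangential part in the frame is the Christoffel term of the
    Hessian. *)
Lemma hessian_formula i j q : O q -> hessian g height c q i j =
  warp q * warp1 q * fib_inner q (fib_tangent i q) (fib_tangent j q)
  + second_form i j q * inner (ambient q) (normal q) (partial_t R n).
Proof.
move=> Oq; have cq := overlap_dom Oq.
have := frame_formula (ambient_nabla i j q) (partial_t R n) Oq.
have -> : inner (ambient q) (ambient_nabla i j q) (partial_t R n) =
    ddheight i j q - warp q * warp1 q * fib_inner q (fib_tangent i q) (fib_tangent j q).
  by rewrite partial_tE /ambient_nabla inner_ambient mulr1 fib_inner0r mulr0 addr0.
have -> : ambient_nabla i j q *m ambient q *m (dphi q)^T = row j (christoffel1_mx g c i
  q).
  apply/rowP => l; rewrite [RHS]mxE -ambient_nabla_tangent// /inner tr_row.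
  by rewrite [RHS]mxE [LHS]mxE; apply: eq_bigr => d _; rewrite !mxE.
have -> : partial_t R n *m ambient q *m (dphi q)^T = \row_k dheight k q.
  apply/rowP => l; rewrite [RHS]mxE.
  transitivity (inner (ambient q) (partial_t R n) (row l (dphi q))).
    by rewrite /inner tr_row [RHS]mxE [LHS]mxE; apply: eq_bigr => d _; rewrite !mxE.
  rewrite partial_tE /dphi dmap_phi inner_ambient mul1r.
  by rewrite (_ : fib_inner q 0 _ = 0) ?mulr0 ?addr0// /fib_inner /inner !mul0mx mxE.
rewrite -row_mul.
have -> : christoffel1_mx g c i q *m invmx (g c q) = christoffel_mx g c i q.
  by rewrite -(christoffel_mx_metric hg)// mulmxK// (metric_unit hg).
rewrite -/(second_form i j q) (inner_sym (partial_t R n)); last exact: warped_sym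
  (overlap_fib Oq).
have -> : (row j (christoffel_mx g c i q) *m (\row_k dheight k q)^T) 0 0 =
    \sum_k christoffel g c i j k q * dheight k q.
  by rewrite mxE; apply: eq_bigr => k _; rewrite !mxE.
rewrite mxE -/(dheight j) -/(ddheight i j).
move: (\sum_k _) => x.
move: (fib_inner q _ _) (inner _ _ _) (second_form _ _ _) (ddheight _ _ _) => a b d e E.
have {E}-> : x = e - warp q * warp1 q * a - d * b by rewrite E; ring.
ring.
Qed.

(** * Traces in an orthonormal frame at a point *)

Section Trace.
Variables (q : X) (B : 'M[R]_n) (A : tensor2 X).
Hypotheses (Oq : O q) (BG : B *m g c q *m B^T = 1%:M).
Hypothesis hA : shape_operator gP nu A.

Let cq : dom c q := overlap_dom Oq.

(** Writing the inverse metric as B^T *m B in the trace that defines Ricci presents the scalar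
    curvature as a sum over pairs of frame vectors. *)
Lemma ricci_contract :
  \tr (B *m ricci g c q *m B^T) =
  \sum_t \sum_s contract B s t (fun i j k m => (riemann_mx g c i j q *m g c q) k m).
Proof.
have ricE j k : ricci g c q j k =
    \sum_s \sum_i \sum_m B s i * B s m * (riemann_mx g c i j q *m g c q) k m.
  rewrite exchange_big mxE; apply: eq_bigr => i _ /=.
  have -> : riemann g c i j k i q = (riemann_mx g c i j q *m g c q *m (B^T *m B)) k i.
    by rewrite -(frame_invmx BG) mulmxK ?(frame_unit BG)// mxE.
  rewrite mxE exchange_big; apply: eq_bigr => m _ /=.
  rewrite [X in _ * X]mxE big_distrr; apply: eq_bigr => s _ /=.
  by rewrite [B^T m s]mxE mulrC (mulrC (B s i)).
rewrite /mxtrace; apply: eq_bigr => t _; rewrite conjE.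
rewrite [RHS]exchange_big; apply: eq_bigr => j _ /=.
rewrite [RHS]exchange_big; apply: eq_bigr => k _ /=.
by rewrite ricE big_distrr.
Qed.

Let dheight_row : 'rV[R]_n := \row_i dheight i q.
(** [Pm] is the metric of M pulled back by [fib], [Nm] is dh (x) dh and [bm] the second fundamental
    form: the Gauss equation is quadratic in these three, apart from the curvature of M. *)
Let Pm : 'M[R]_n := \matrix_(i, j) fib_inner q (fib_tangent i q) (fib_tangent j q).
Let Nm : 'M[R]_n := \matrix_(i, j) (dheight i q * dheight j q).
Let bm : 'M[R]_n := \matrix_(i, j) second_form i j q.

Lemma metric_split : g c q = Nm + warp q ^+ 2 *: Pm.
Proof. by apply/matrixP => i j; rewrite metric_formula// !mxE. Qed.

(** The bound on k_M contributes f^2 (f'^2 - f f'') times the Gram determinant of the projections.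
    Its f'^2 part cancels that of the Gauss equation, and the f f'' terms add up to -f''/f times the
    Gram determinant of e_s, e_t for g = dh (x) dh + f^2 Pm. *)
Lemma contract_le s t :
  sectional_le gM (derive1 f (height q) ^+ 2 - f (height q) * derive1 (derive1 f)
    (height q))%:E ->
  contract B s t (fun i j k m => (riemann_mx g c i j q *m g c q) k m) <=
  - (warp2 q / warp q) * (1 - (s == t)%:R)
  + (B *m bm *m B^T) t t * (B *m bm *m B^T) s s - (B *m bm *m B^T) s t ^+ 2.
Proof.
move=> sec.
pose D := dmap fib c c' q.
pose K v w z x := fib_inner q (curvature gM c' (fib q) v w z) x.
have -> : contract B s t (fun i j k m => (riemann_mx g c i j q *m g c q) k m) =
  contract B s t (fun i j k m =>
    warp q ^+ 2 * K (row i D) (row j D) (row k D) (row m D)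
    + (- (warp q ^+ 2 * warp1 q ^+ 2) * (Pm j k * Pm i m)
    + (warp q ^+ 2 * warp1 q ^+ 2 * (Pm i k * Pm j m)
    + (- (warp q * warp2 q) * (Pm j k * Nm i m)
    + (- (warp q * warp2 q) * (Nm j k * Pm i m)
    + (warp q * warp2 q * (Nm i k * Pm j m)
    + (warp q * warp2 q * (Pm i k * Nm j m)
    + (bm j k * bm i m + (- 1) * (bm i k * bm j m))))))))).
  apply: eq_contract => i j k m; rewrite gauss_equation// !mxE -/(K _ _ _ _).
  rewrite /fib_tangent /tangent -/D.
  move: (K _ _ _ _) (fib_inner q (row j D) (row k D)) (fib_inner q (row i D) (row m D)).
  move: (fib_inner q (row i D) (row k D)) (fib_inner q (row j D) (row m D)).
  move: (second_form j k q) (second_form i m q) (second_form i k q) (second_form j m q).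
  by move: (dheight i q) (dheight j q) (dheight k q) (dheight m q) (warp q) (warp1 q)
    (warp2 q) => *; ring.
rewrite !(contractD, contractZ) !contract_outer !contract_cross contract_multilinear;
  last first.
- by move=> *; rewrite /K fib_innerZr.
- by move=> *; rewrite /K curvatureZr fib_innerZl.
- by move=> *; rewrite /K curvatureZm fib_innerZl.
- by move=> *; rewrite /K curvatureZl fib_innerZl.
- by move=> *; rewrite /K fib_innerDr.
- by move=> *; rewrite /K curvatureDr fib_innerDl.
- by move=> *; rewrite /K curvatureDm fib_innerDl.
- by move=> *; rewrite /K curvatureDl fib_innerDl.
have PmE : Pm = D *m gM c' (fib q) *m D^T.
  by apply/matrixP => i j; rewrite mxE -inner_rows.
have PsE a b : (B *m Pm *m B^T) a b = fib_inner q (row a (B *m D)) (row b (B *m D)).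
  by rewrite PmE /fib_inner inner_rows trmx_mul !mulmxA.
have NsE a b : (B *m Nm *m B^T) a b = (B *m dheight_row^T) a 0 * (B *m dheight_row^T) b 0.
  rewrite (_ : Nm = dheight_row^T *m dheight_row); last first.
    by apply/matrixP => i j; rewrite !mxE big_ord1 !mxE.
  by rewrite mulmxA -mulmxA -[X in _ *m X]trmxK trmx_mul trmxK mxE big_ord1 [in X in _
    * X]mxE.
have delta a b : (a == b)%:R = (B *m dheight_row^T) a 0 * (B *m dheight_row^T) b 0 +
    warp q ^+ 2 * fib_inner q (row a (B *m D)) (row b (B *m D)).
  have := BG; rewrite metric_split mulmxDr mulmxDl => /matrixP /(_ a b).
  rewrite [RHS]mxE => <-; rewrite mxE NsE -scalemxAr -scalemxAl [X in _ + X]mxE.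
  by rewrite PsE.
have bS a b : (B *m bm *m B^T) a b = (B *m bm *m B^T) b a.
  have bT : bm^T = bm by apply/matrixP => i j; rewrite !mxE second_form_sym.
  have E : (B *m bm *m B^T)^T = B *m bm *m B^T by rewrite !trmx_mul trmxK bT mulmxA.
  by rewrite -[in LHS]E mxE.
have KL : K (row s (B *m D)) (row t (B *m D)) (row t (B *m D)) (row s (B *m D)) <=
    (warp1 q ^+ 2 - warp q * warp2 q) *
    (fib_inner q (row s (B *m D)) (row s (B *m D)) * fib_inner q (row t (B *m D)) (row
      t (B *m D))
     - fib_inner q (row s (B *m D)) (row t (B *m D)) ^+ 2).
  apply: sectional_le_curvature => //; first exact: overlap_fib.
  move=> fr; have := sec c' (fib q) _ _ (overlap_fib Oq) fr.
  by rewrite lee_fin.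
rewrite !PsE !NsE (bS t s) (fib_innerC (row t (B *m D)) (row s (B *m D)) Oq).
move: KL (delta s s) (delta t t) (delta s t); rewrite !eqxx.
move: (K _ _ _ _) (fib_inner q (row s (B *m D)) (row s (B *m D))).
move: (fib_inner q (row t (B *m D)) (row t (B *m D))) (fib_inner q (row s (B *m D))
  (row t (B *m D))).
move: ((B *m dheight_row^T) s 0) ((B *m dheight_row^T) t 0) (warp_neq0 q).
move: ((B *m bm *m B^T) t t) ((B *m bm *m B^T) s s) ((B *m bm *m B^T) s t).
move: (warp q) (warp1 q) (warp2 q) => F F1 F2 btt bss bst as_ at_ F0 ptt pst k pss KL
  dss dtt dst.
(* With the square, 1 - (s == t) is the Gram determinant of e_s and e_t, to be expanded in
   components. *)
have dd : (s == t)%:R = (s == t)%:R * (s == t)%:R :> R by rewrite -natrM mulnb andbb.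
have -> : 1 - (s == t)%:R = (as_ * as_ + F ^+ 2 * pss) * (at_ * at_ + F ^+ 2 * ptt)
    - (as_ * at_ + F ^+ 2 * pst) * (as_ * at_ + F ^+ 2 * pst).
  by rewrite -dss -dtt -dst -dd mulr1.
have F2pos : 0 <= F ^+ 2 by exact: sqr_ge0.
have {}KL := ler_wpM2l F2pos KL.
rewrite -subr_ge0; rewrite -subr_ge0 in KL.
apply: le_trans KL _; rewrite le_eqVlt; apply/orP; left; apply/eqP; field.
exact: F0.
Qed.

Lemma trace_ricci_le :
  sectional_le gM (derive1 f (height q) ^+ 2 - f (height q) * derive1 (derive1 f)
    (height q))%:E ->
  \tr (B *m ricci g c q *m B^T) <=
  - (warp2 q / warp q) * (n%:R ^+ 2 - n%:R) + (\tr (A c q)) ^+ 2.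
Proof.
move=> sec.
have trb : \sum_t (B *m bm *m B^T) t t = \tr (A c q).
  rewrite -/(\tr (B *m bm *m B^T)) (_ : bm = A c q *m g c q); last first.
    by apply/matrixP => i j; rewrite second_formE// mxE.
  rewrite mxtrace_mulC !mulmxA -(frame_invmx BG) -mulmxA mxtrace_mulC -mulmxA.
  by rewrite mulmxV ?mulmx1// (frame_unit BG).
rewrite ricci_contract.
apply: (@le_trans _ _ (\sum_t \sum_s (- (warp2 q / warp q) * (1 - (s == t)%:R)
  + (B *m bm *m B^T) t t * (B *m bm *m B^T) s s))).
  apply: ler_sum => t _; apply: ler_sum => s _.
  (* The squares discarded here add up to |A|^2. *)
  by apply: le_trans (contract_le s t sec) _; rewrite gerDl oppr_le0 sqr_ge0.
rewrite le_eqVlt; apply/orP; left; apply/eqP.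
transitivity (\sum_(t < n) (- (warp2 q / warp q) * (n%:R - 1) + (B *m bm *m B^T) t t *
  \tr (A c q))).
  apply: eq_bigr => t _; rewrite big_split -!big_distrr /= trb; congr (_ * _ + _).
  rewrite sumrB sumr_const card_ord; congr (_ - _).
  by rewrite (bigD1 t)//= eqxx big1 ?addr0// => s /negPf ->.
rewrite big_split /= -[X in _ + X]big_distrl /= trb sumr_const card_ord -mulr_natl.
by move: (warp2 q / warp q) (\tr (A c q)) => r x; ring.
Qed.

Lemma trace_shape : \tr (B *m (\matrix_(i, j) second_form i j q) *m B^T) = \tr (A c q).
Proof.
rewrite (_ : \matrix_(i, j) _ = A c q *m g c q); last first.
  by apply/matrixP => i j; rewrite second_formE// mxE.
rewrite mxtrace_mulC !mulmxA -(frame_invmx BG) -mulmxA mxtrace_mulC -mulmxA.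
by rewrite mulmxV ?mulmx1// (frame_unit BG).
Qed.

Lemma trace_metric : \tr (B *m g c q *m B^T) = n%:R.
Proof. by rewrite BG mxtrace1. Qed.

(** By [metric_split], f f' Pm = (f'/f) (g - dh (x) dh), and g has trace n. *)
Lemma trace_hessian : \tr (B *m hessian g height c q *m B^T) =
  warp1 q / warp q * (n%:R - \tr (B *m ((dfun height c q)^T *m dfun height c q) *m B^T))
  + inner (ambient q) (normal q) (partial_t R n) * \tr (A c q).
Proof.
have dhE : dfun height c q = dheight_row by apply/rowP => i; rewrite !mxE.
have NmE : dheight_row^T *m dheight_row = Nm.
  by apply/matrixP => i j; rewrite !mxE big_ord1 !mxE.
rewrite dhE NmE -trace_metric -trace_shape metric_split.
have -> : hessian g height c q = (warp q * warp1 q) *: Pm + inner (ambient q) (normal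
  q) (partial_t R n) *: bm.
  apply/matrixP => i j; rewrite hessian_formula// !mxE.
  by rewrite [second_form i j q * _]mulrC.
rewrite !(mulmxDr, mulmxDl) -!scalemxAr -!scalemxAl !mxtraceD !mxtraceZ -/bm.
have F0 := warp_neq0 q.
move: (\tr (B *m Pm *m B^T)) (\tr (B *m Nm *m B^T)) (\tr (B *m bm *m B^T)) (inner _ _ _).
by move: (warp q) (warp1 q) F0 => F F1 F0 x y z w; field.
Qed.

(** Upper bound: g - dh (x) dh = f^2 Pm is positive semidefinite, with trace n - |dh|^2. *)
Lemma trace_dh_bounds :
  0 <= \tr (B *m ((dfun height c q)^T *m dfun height c q) *m B^T) <= n%:R.
Proof.
have dhE : dfun height c q = dheight_row by apply/rowP => i; rewrite !mxE.
have NsE a : (B *m (dheight_row^T *m dheight_row) *m B^T) a a = (B *m dheight_row^T) a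
  0 ^+ 2.
  by rewrite mulmxA -mulmxA -[X in _ *m X]trmxK trmx_mul trmxK mxE big_ord1 [in X in _
    * X]mxE expr2.
rewrite dhE; apply/andP; split.
  by apply: sumr_ge0 => a _; rewrite NsE sqr_ge0.
rewrite -trace_metric metric_split mulmxDr mulmxDl mxtraceD.
have -> : Nm = dheight_row^T *m dheight_row by apply/matrixP => i j; rewrite !mxE
  big_ord1 !mxE.
rewrite lerDl -scalemxAr -scalemxAl mxtraceZ mulr_ge0 ?sqr_ge0//.
apply: sumr_ge0 => a _.
pose D := dmap fib c c' q.
have -> : Pm = D *m gM c' (fib q) *m D^T.
  by apply/matrixP => i j; rewrite mxE -inner_rows.
have -> : B *m (D *m gM c' (fib q) *m D^T) *m B^T =
   (B *m D) *m gM c' (fib q) *m (B *m D)^T by rewrite trmx_mul !mulmxA.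
rewrite -inner_rows.
have [->|v0] := eqVneq (row a (B *m D)) 0; first by rewrite /inner !mul0mx mxE.
exact/ltW/(metric_pos hgM (overlap_fib Oq)).
Qed.

End Trace.
End Normal.
End Hypersurface.

(** * Vanishing of the differential of u *)

(** The coordinates of u are locally constant, hence so is u by injectivity of the charts; its level
    sets are then open and closed. *)
Lemma zero_dmap_constant (R : realType) n p (X : charted_space R n) (Y : charted_space
  R p)
    (u : X -> Y) : smooth_manifold X -> connected_space X -> smooth_manifold Y ->
  smooth_map u ->
  (forall c c' q, dom c q -> dom c' (u q) -> dmap u c c' q = 0) ->
  exists y : Y, forall q, u q = y.
Proof.
move=> hX [[q0 _] cX] hY [cu su] du0.
have loc q : \forall r \near q, u r = u q.
  pose c := chart_at q; pose c' := chart_at (u q).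
  have cq : dom c q by exact: (chart_at_dom hX).
  have cuq : dom c' (u q) by exact: (chart_at_dom hY).
  have oU : open (u @^-1` dom c').
    by apply: open_comp; [move=> ? _; exact: cu | exact: (dom_open hY)].
  have oO : open (dom c `&` u @^-1` dom c') by apply: openI => //; exact: (dom_open hX).
  have H : forall a : 'I_p, nbhs q [set r | coord c' (u r) 0 a = coord c' (u q) 0 a].
    move=> a.
    apply: (pd0_locally_constant hX oO (@subIsetl _ _ _) (su c' a c 1%N)) => //.
    move=> r i [cr cur]; have /matrixP /(_ i a) := du0 c c' r cr cur.
    by rewrite !mxE.
  have Ha := @filter_forall _ 'I_p _ (nbhs q) (nbhs_filter q) H.
  have nU : \forall r \near q, dom c' (u r) by apply: (near_open oU).
  near=> r; apply: (coord_inj hY (c := c')).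
  - by rewrite inE; near: r.
  - by rewrite inE.
  - by apply/rowP; near: r.
have oS y : open [set q | u q = y].
  by rewrite openE => q /= <-; exact: loc.
have oSC y : open [set q | u q <> y].
  rewrite openE => q /= uqy; by have := loc q; apply: filterS => r ur; rewrite /= ur.
exists (u q0) => q.
have E : [set q | u q = u q0] = [set: X].
  apply: cX; first by exists q0.
  - by exists [set q | u q = u q0]; rewrite ?setTI.
  - exists [set q | u q = u q0]; last by rewrite setTI.
    by rewrite -openC; exact: oSC.
by have : [set: X] q by []; rewrite -E.
Unshelve. all: by end_near. Qed.

(** The trace is the sum of the squared G-lengths of the rows of B *m D, so when it is nonpositive
    they all vanish. *)
Lemma trace_pullback_ge0 (R : realType) n p (B : 'M[R]_n) (D : 'M[R]_(n, p)) (G :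
  'M[R]_p) :
  B \in unitmx -> (forall v : 'rV[R]_p, v != 0 -> 0 < inner G v v) ->
  \tr (B *m (D *m G *m D^T) *m B^T) <= 0 -> D = 0.
Proof.
move=> Bu Gpos.
have -> : B *m (D *m G *m D^T) *m B^T = (B *m D) *m G *m (B *m D)^T.
  by rewrite trmx_mul !mulmxA.
have ge0 i : 0 <= ((B *m D) *m G *m (B *m D)^T) i i.
  rewrite -inner_rows; have [->|v0] := eqVneq (row i (B *m D)) 0.
    by rewrite /inner !mul0mx mxE.
  exact/ltW/Gpos.
move=> tr0; have {tr0} : \tr ((B *m D) *m G *m (B *m D)^T) == 0.
  by rewrite eq_le tr0 sumr_ge0.
rewrite psumr_eq0 // => /allP z.
have BD : B *m D = 0.
  apply/row_matrixP => i; rewrite row0.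
  have /eqP := z i (mem_index_enum i); rewrite -inner_rows => zi.
  by apply/eqP/negP => /negP /Gpos; rewrite zi ltxx.
by rewrite -[D](mulKmx Bu) BD mulmx0.
Qed.

(** The final estimate in numbers: a = tr A, r1 = f'/f, r2 = f''/f, T is the scalar curvature, w =
    |dh|^2 and E = alpha |du|^2. *)
Lemma energy_le0 (R : realType) (n a r1 r2 T w theta m lam E H : R) :
  0 <= w <= n -> a = n * H ->
  T <= - r2 * (n ^+ 2 - n) + a ^+ 2 ->
  r1 - (n - 1) * r2 + `|m + r1| + H * (n * H + theta) <= lam ->
  T - E + (r1 * (n - w) + theta * a) - m * w = lam * n -> E <= 0.
Proof.
move=> /andP[w0 wn] -> T_le lam_ge eqE.
have n0 : 0 <= n by exact: le_trans wn.
have h1 := ler_wpM2r n0 lam_ge.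
(* The absolute value in the hypothesis on lambda absorbs the |dh|^2 terms, whatever the sign of
   their coefficient. *)
have h2 : - (m + r1) * w <= `|m + r1| * n.
  apply: (@le_trans _ _ (`|m + r1| * w)); last exact: ler_wpM2l.
  by apply: ler_wpM2r => //; rewrite -normrN ler_norm.
have -> : E = T + (r1 * (n - w) + theta * (n * H)) - m * w - lam * n by rewrite -eqE;
  ring.
nra.
Qed.

Theorem theorem4p9 (R : realType) (n p : nat)
    (Sigma : charted_space R n) (g : tensor2 Sigma)
    (N : charted_space R p) (g' : tensor2 N)
    (alpha : R) (h : Sigma -> R) (u : Sigma -> N) (mu lambda : Sigma -> R)
    (hE : gradient_Einstein_type g g' alpha h u mu lambda)
    (I : set R) (I_open : open I) (I_itv : is_interval I)
    (f : R -> R) (f_smooth : smooth_fun_on I f)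
    (f_gt0 : forall t, I t -> 0 < f t)
    (M : charted_space R n) (M_manifold : smooth_manifold M)
    (M_connected : connected_space M)
    (o : chart M -> M -> R) (o_orientation : orientation o)
    (gM : tensor2 M) (gM_metric : riemannian_metric gM)
    (phi : Sigma -> interval_prod I M)
    (phi_isom : isometric_immersion g (warped_metric f gM) phi)
    (nu : field_along phi) (nu_normal : unit_normal (warped_metric f gM) nu)
    (A : tensor2 Sigma) (A_shape : shape_operator (warped_metric f gM) nu A)
    (h_height : forall q, h q = piI (phi q))
    (kM_le : sectional_le gM
       (ereal_inf [set (derive1 f t ^+ 2 - f t * derive1n 2 f t)%:E | t in I]))
    (lambda_ge : forall q,
       let H := mean_curvature A q in
       let theta := angle f gM nu q in
       derive1 f (h q) / f (h q) - (n%:R - 1) * (derive1n 2 f (h q) / f (h q))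
         + `|mu q + derive1 f (h q) / f (h q)| + H * (n%:R * H + theta)
       <= lambda q) :
  exists y : N, forall q : Sigma, u q = y.
Proof.
have [hX cX hg _ hY hg' alpha0 su _ _ _ Eric _] := hE.
have hh : h = height phi by apply/funext.
apply: zero_dmap_constant => // c c2 q cq cuq.
(* Both H and theta are defined with the preferred charts, so the estimate is made there. *)
have c1q : dom (chart_at q) q by exact: (chart_at_dom hX).
rewrite (dmap_change_chart hX su hY cq c1q cuq).
suff -> : dmap u (chart_at q) c2 q = 0 by rewrite mulmx0.
set c1 := chart_at q in c1q *.
pose c' : chart M := chart_at (phi q).
have Oq : overlap phi c1 c' q by split => //; exact: (chart_at_dom M_manifold).
have [B BG] := metric_frame hg c1q.
apply: (trace_pullback_ge0 (frame_unitB BG) (metric_pos hg' cuq)).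
(* The infimum, possibly infinite, is replaced by its upper bound at the height of the point
   considered. *)
have sec : sectional_le gM (derive1 f (height phi q) ^+ 2
    - f (height phi q) * derive1 (derive1 f) (height phi q))%:E.
  move=> cM m v w cm fr; apply: le_trans (kM_le cM m v w cm fr) _.
  by apply: ereal_inf_lbound; exists (height phi q) => //; exact: I_height.
(* For n = 0 the division by n gives 0, in agreement with the empty trace. *)
have nH : \tr (A c1 q) = n%:R * mean_curvature A q.
  rewrite /mean_curvature -/c1; have [n0|n0] := eqVneq (n%:R : R) 0.
    rewrite n0 mul0r /mxtrace big1// => i _; move/eqP: n0.
    by rewrite pnatr_eq0 => /eqP n0; have := ltn_ord i; rewrite [X in (_ < X)%N]n0.
  by rewrite mulrC divfK.
(* Conjugation by B makes the ordinary trace the metric one, and the tensor equation becomes the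
   scalar one of [energy_le0]; positivity of alpha then removes it from E. *)
have := congr1 (fun S => \tr (B *m S *m B^T)) (Eric c1 c2 q c1q cuq).
rewrite !(mulmxDr, mulmxN, mulmxDl, mulNmx) -!scalemxAr -!scalemxAl.
rewrite !(raddfD, raddfN) /= !mxtraceZ (trace_metric BG).
rewrite hh (trace_hessian hX M_manifold I_open f_smooth f_gt0 gM_metric hg phi_isom
  nu_normal Oq BG A_shape).
have lam := lambda_ge q; rewrite h_height in lam.
move=> /(energy_le0 (trace_dh_bounds gM_metric phi_isom Oq BG) nH
  (trace_ricci_le hX M_manifold I_open f_smooth f_gt0 gM_metric hg phi_isom
    nu_normal Oq BG A_shape sec) lam).
by rewrite pmulr_rle0.
Qed.
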